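(* Let $K$ be a global field with ideal class group $\mathrm{Cl}_K$ and Hilbert class field $\widetilde K$. Assume DRH(A) for $L_K(s,\chi)$ for every nontrivial character $\chi$ of $\mathrm{Cl}_K\simeq\mathrm{Gal}(\widetilde K/K)$, and assume that $m(\sigma_{\mathfrak a})=0$ for every $[\mathfrak a]\in\mathrm{Cl}_K$. If $|\mathrm{Cl}_K|$ is even, then there exists a Chebyshev bias against principal ideals in the whole set of prime ideals of $K$.
   Context: A global field is a number field or an algebraic function field of one variable over a finite field. $I_K$ is the group of fractional ideals of $K$, $P_K$ its subgroup of principal ideals, $\mathrm{Cl}_K=I_K/P_K$. $\widetilde K$ is the Hilbert class field of $K$, so $\mathrm{Cl}_K\simeq\mathrm{Gal}(\widetilde K/K)$ with $[\mathfrak a]\in\mathrm{Cl}_K$ corresponding to $\sigma_{\mathfrak a}=\left(\frac{\widetilde K/K}{\mathfrak a}\right)$ (Artin symbol). $\mathfrak p$ denotes a prime ideal of $K$ and $N(\mathfrak p)$ its norm. For a nontrivial character $\chi$ of $\mathrm{Gal}(\widetilde K/K)$, $L_K(s,\chi)$ is the Artin $L$-function $L_K(s,\chi)=\prod_{\mathfrak p}\left(1-\chi(\mathrm{Frob}_{\mathfrak p})N(\mathfrak p)^{-s}\right)^{-1}$ $(\mathrm{Re}(s)>1)$, with analytic continuation; $m_\chi=\mathrm{ord}_{s=1/2}L_K(s,\chi)$, and $m(\sigma)=\sum_{\chi\ne\mathbf 1}\chi(\sigma)m_\chi$ with $\chi$ running through all nontrivial characters of $\mathrm{Gal}(\widetilde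 K/K)$. DRH(A) for $L_K(s,\chi)$ (the Deep Riemann Hypothesis (A)) is the statement that the limit $$\lim_{x\to\infty}\left((\log x)^{m_\chi}\prod_{N(\mathfrak p)\le x}\left(1-\chi(\mathrm{Frob}_{\mathfrak p})N(\mathfrak p)^{-1/2}\right)^{-1}\right)$$ exists and is nonzero. Chebyshev bias: suppose the set of all primes $\mathfrak p$ of $K$ with $N(\mathfrak p)\le x$ is a disjoint union $P_1(x)\cup P_2(x)$ and the limit $\delta=\lim_{x\to\infty}|P_1(x)|/|P_2(x)|$ exists. There exists a Chebyshev bias toward $P_1$, or equivalently against $P_2$, if for some $C>0$, $$\sum_{\mathfrak p\in P_1(x)}\frac1{\sqrt{N(\mathfrak p)}}-\delta\sum_{\mathfrak p\in P_2(x)}\frac1{\sqrt{N(\mathfrak p)}}\sim C\log\log x\qquad(x\to\infty),$$ where $f\sim g$ means $f(x)/g(x)\to1$. Here $P_2$ consists of the principal prime ideals and $P_1$ of the nonprincipal ones. *)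

(* Defs.v *)
From HB Require Import structures.
From mathcomp Require Import all_boot all_order all_algebra all_fingroup all_field.
From mathcomp Require Import finmap complex.
From mathcomp Require Import all_classical all_reals all_analysis.

Set Implicit Arguments.
Unset Strict Implicit.
Unset Printing Implicit Defensive.

Import Order.TTheory GRing.Theory Num.Theory.
Import numFieldNormedType.Exports.

Local Open Scope classical_set_scope.
Local Open Scope ring_scope.
Local Open Scope complex_scope.

(** A global field is a finite extension K of Q or of F(T) with F a finite
    field: [K : fieldExtType (base_field b)].  In the second case the ring of
    integers of K is the integral closure of F[T], so that the choice of T is
    the choice of a nonempty finite set of places at infinity. *)

Variant global_base := BaseRat | BaseRatFun of finFieldType.

Definition base_ring (b : global_base) : idomainType :=
  match b with
  | BaseRat => int
  | BaseRatFun F => {poly F}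
  end.

Definition base_field (b : global_base) : fieldType :=
  match b with
  | BaseRat => rat
  | BaseRatFun F => {fraction {poly F}}
  end.

Definition base_emb (b : global_base) : base_ring b -> base_field b :=
  match b with
  | BaseRat => fun n : int => n%:~R
  | BaseRatFun F => fun p : {poly F} => tofrac p
  end.

Section Embeddings.
Variables (b : global_base) (K : fieldExtType (base_field b)).
Variable L : splittingFieldType K.

Definition emb_base (a : base_ring b) : K := (base_emb a)%:A.

Definition emb_ext (x : K) : L := x%:A.

Definition integers : set K := [set x | integralOver emb_base x].

Definition integers_ext : set L :=
  [set x | integralOver (fun a => emb_ext (emb_base a)) x].

End Embeddings.

Arguments integers {b} K.
Arguments integers_ext {b K} L.
Arguments emb_ext {b K} L x.

Section Ideals.
Variables (E : fieldType) (O : set E).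

Definition submodule (I : set E) : Prop :=
  [/\ I 0,
      forall x y, I x -> I y -> I (x + y)
    & forall a x, O a -> I x -> I (a * x)].

Definition fractional (I : set E) : Prop :=
  [/\ submodule I,
      exists2 x, I x & x != 0
    & exists2 d, d != 0 & forall x, I x -> O (d * x)].

Definition ideal_mul (I J : set E) : set E :=
  [set x | exists n (u v : 'I_n -> E),
     (forall i, I (u i) /\ J (v i)) /\ x = \sum_(i < n) u i * v i].

Definition principal_ideal (a : E) : set E := [set a * x | x in O].

Definition principal (I : set E) : Prop :=
  exists2 a, a != 0 & I = principal_ideal a.

Definition prime_ideal (p : set E) : Prop :=
  [/\ submodule p,
      p `<=` O,
      exists2 x, p x & x != 0,
      ~ p 1
    & forall x y, O x -> O y -> p (x * y) -> p x \/ p y].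

(* The cardinality of [O / p]; [fset_set] of an infinite set is empty. *)
Definition ideal_norm (p : set E) : nat :=
  #|` fset_set [set [set y | O y /\ p (y - x)] | x in O]|.

(* The coset of I modulo the subgroup of principal ideals. *)
Definition ideal_class (I : set E) : set (set E) :=
  [set ideal_mul I J | J in principal].

Definition class_group : set (set (set E)) :=
  [set ideal_class I | I in fractional].

Definition class_number : nat := #|` fset_set class_group|.

End Ideals.

Section HilbertClassField.
Variables (b : global_base) (K : fieldExtType (base_field b)).
Variable L : splittingFieldType K.

Local Notation G := (gal_of {:L}).

Definition lies_above (P : set L) (p : set K) : Prop :=
  p = [set x | P (emb_ext L x)].

(* The ramification index of every prime P of L over K is 1. *)
Definition unramified_finite : Prop :=
  forall (p : set K) (P : set L),
    prime_ideal (integers K) p -> prime_ideal (integers_ext L) P ->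
    lies_above P p -> ~ (emb_ext L @` p `<=` ideal_mul P P).

(* Only number fields have embeddings into [algC]. *)
Definition unramified_archimedean : Prop :=
  forall phi : {rmorphism L -> algC},
    (forall x : K, phi (emb_ext L x) \is Num.real) ->
    forall y : L, phi y \is Num.real.

Definition valuation_ring (V : set L) : Prop :=
  [/\ V 1,
      forall x y, V x -> V y -> V (x - y),
      forall x y, V x -> V y -> V (x * y)
    & forall x, x != 0 -> V x \/ V x^-1].

(* The places at infinity of a function field are the valuation rings that do
   not contain F[T]; a number field has none, since every subring contains Z.
   A place of a Galois extension splits completely when its decomposition
   group is trivial. *)
Definition split_at_infinity : Prop :=
  forall V : set L, valuation_ring V ->
    ~ (forall a : base_ring b, V (emb_ext L (emb_base K a))) ->
    forall s : G, [set s x | x in V] = V -> s = 1%g.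

Definition unramified_abelian : Prop :=
  [/\ galois 1%VS {:L}, abelian 'Gal({:L} / 1%VS),
      unramified_finite, unramified_archimedean & split_at_infinity].

Definition is_frobenius (p : set K) (s : G) : Prop :=
  forall P : set L, prime_ideal (integers_ext L) P -> lies_above P p ->
    forall x : L, integers_ext L x ->
      P (s x - x ^+ ideal_norm (integers K) p).

(* In an unramified abelian extension the Frobenius element exists and is
   unique. *)
Definition frobenius (p : set K) : G := xget 1%g [set s | is_frobenius p s].

(* The fractional ideals are generated by the prime ideals, so these conditions
   determine [artin] on them. *)
Definition artin_symbol (artin : set K -> G) : Prop :=
  (forall I J, fractional (integers K) I -> fractional (integers K) J ->
     artin (ideal_mul I J) = (artin I * artin J)%g) /\
  (forall p, prime_ideal (integers K) p -> artin p = frobenius p).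

Definition artin_isomorphism (artin : set K -> G) : Prop :=
  [/\ artin_symbol artin,
      forall s : G, exists2 I, fractional (integers K) I & artin I = s
    & forall I, fractional (integers K) I ->
        (artin I = 1%g <-> principal (integers K) I)].

End HilbertClassField.

Definition hilbert_class_field (b : global_base)
    (K : fieldExtType (base_field b)) (L : splittingFieldType K) : Prop :=
  unramified_abelian L /\
  forall M : splittingFieldType K, unramified_abelian M ->
    inhabited {lrmorphism M -> L}.

Section Meromorphic.
Variable R : realType.

Local Notation C := (R[i])^o.

Definition holomorphic_at (f : C -> C) (z : C) : Prop :=
  \forall w \near z, derivable f w 1.

Definition laurent_factor (f : C -> C) (z : C) (m : int) (g : C -> C) : Prop :=
  holomorphic_at g z /\ \forall w \near z^', f w = (w - z) ^ m * g w.

Definition meromorphic (f : C -> C) : Prop :=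
  forall z, exists m g, laurent_factor f z m g.

Definition has_order (f : C -> C) (z : C) (m : int) : Prop :=
  exists2 g, laurent_factor f z m g & g z != 0.

(* n ^ s for n > 0 *)
Definition cpow (n : nat) (s : R[i]) : R[i] :=
  (expR (complex.Re s * ln n%:R))%:C *
  (cos (complex.Im s * ln n%:R) +i* sin (complex.Im s * ln n%:R)).

End Meromorphic.

Section LFunctions.
Variables (R : realType) (b : global_base) (K : fieldExtType (base_field b)).
Variable L : splittingFieldType K.

Local Notation G := (gal_of {:L}).
Local Notation C := (R[i])^o.
Local Notation N := (ideal_norm (integers K)).

Definition primes_upto (x : R) : set (set K) :=
  [set p | prime_ideal (integers K) p /\ (N p)%:R <= x].

Definition is_character (chi : G -> R[i]) : Prop :=
  chi 1%g = 1 /\ forall s t, chi (s * t)%g = chi s * chi t.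

Definition nontrivial_characters : set (G -> R[i]) :=
  [set chi | is_character chi /\ exists s, chi s != 1].

Definition euler_product (chi : G -> R[i]) (s : R[i]) (x : R) : C :=
  \big[*%R/1]_(p \in primes_upto x)
    (1 - chi (frobenius L p) * cpow (N p) (- s))^-1.

Definition is_artin_L (chi : G -> R[i]) (f : C -> C) : Prop :=
  meromorphic f /\
  forall s : C, 1 < complex.Re s -> euler_product chi s x @[x --> +oo] --> f s.

(* The order at 1/2 does not depend on f, since meromorphic continuations agree
   outside a discrete set. *)
Definition ord_half (chi : G -> R[i]) : int :=
  xget 0 [set m | exists2 f, is_artin_L chi f & has_order f 2^-1 m].

Definition DRH_A (chi : G -> R[i]) : Prop :=
  exists2 l : C, l != 0 &
    (((ln x)%:C ^ ord_half chi * euler_product chi 2^-1 x : C)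
       @[x --> +oo] --> l).

Definition m_sum (s : G) : R[i] :=
  \sum_(chi \in nontrivial_characters) chi s * (ord_half chi)%:~R.

End LFunctions.

Arguments primes_upto {R b} K x.
Arguments DRH_A {R b K} L chi.
Arguments m_sum R {b K} L s.
Arguments nontrivial_characters R {b K} L.

Section Bias.
Variables (R : realType) (b : global_base) (K : fieldExtType (base_field b)).

Local Notation N := (ideal_norm (integers K)).

Definition count_primes (A : set (set K)) (x : R) : R :=
  (#|` fset_set (A `&` primes_upto K x)|)%:R.

Definition sum_inv_sqrt (A : set (set K)) (x : R) : R :=
  \sum_(p \in A `&` primes_upto K x) (Num.sqrt (N p)%:R : R)^-1.

(* A bias toward A1, or against A2. *)
Definition chebyshev_bias (A1 A2 : set (set K)) : Prop :=
  [/\ A1 `|` A2 = prime_ideal (integers K),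
      A1 `&` A2 = set0
    & exists delta : R,
        (count_primes A1 x / count_primes A2 x @[x --> +oo] --> delta) /\
        exists2 c : R, 0 < c &
          ((sum_inv_sqrt A1 x - delta * sum_inv_sqrt A2 x) /
             (c * ln (ln x)) @[x --> +oo] --> (1 : R))].

Definition principal_primes : set (set K) :=
  [set p | prime_ideal (integers K) p /\ principal (integers K) p].

Definition nonprincipal_primes : set (set K) :=
  [set p | prime_ideal (integers K) p /\ ~ principal (integers K) p].

End Bias.

Arguments chebyshev_bias R {b K} A1 A2.
Arguments principal_primes {b} K.
Arguments nonprincipal_primes {b} K.

(* Main.v *)
(* The Artin map identifies the class group with the Galois group G, so every
   fractional ideal is invertible and G is commutative.  Since m vanishes on G,
   orthogonality of characters gives m_chi = 0 for every nontrivial chi, and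
   DRH(A) says that the Euler product at 1/2 stays away from 0 and infinity.
   The square of the absolute value of an Euler factor is 1 / (1 - t) with
   t = 2 Re chi(p) / sqrt (N p) - 1 / N p; taking logarithms,
     sum_(N p <= x) Re chi(p) / sqrt (N p)
       = - 1/2 sum_(N p <= x) Re chi(p)^2 / N p + O(1).
   The right-hand side is bounded when chi^2 is nontrivial and is
   - 1/2 ln ln x + O(1) when chi^2 = 1.  Summing over the nontrivial chi, of
   which at least one has chi^2 = 1 because |G| is even, gives the bias.
   The estimate sum_(N p <= x) 1 / N p = ln ln x + O(1) and the growth of the
   number of primes rest on Mertens' theorem for K, which is proved by counting
   the multiplicity of each prime in the principal ideals (z + y), where z is a
   large element of Z or F[T] and y runs over the integers of K of bounded
   size. *)

From HB Require Import structures.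
Require Import Defs.
From mathcomp Require Import all_boot all_order all_algebra all_fingroup all_field.
From mathcomp Require Import finmap complex.
From mathcomp Require Import all_classical all_reals all_analysis.
From mathcomp Require Import all_solvable mxred mxrepresentation.
From mathcomp Require Import ring lra zify.

Set Implicit Arguments.
Unset Strict Implicit.
Unset Printing Implicit Defensive.

Import Order.TTheory GRing.Theory Num.Theory.
Import numFieldNormedType.Exports.

Local Open Scope classical_set_scope.
Local Open Scope ring_scope.

(** * Cosets and lattice points *)

(** Squared absolute values are used because only real parts are needed: the sum over all nontrivial
    characters is real, and no branch of a complex logarithm has to be followed. The obstacle is the
    sum of Re chi(p)^2 / N p for chi^2 nontrivial, which concerns L(1, chi^2). It is settled by
    DRH(A) for chi^2 itself: its main identity, with Re chi^4 bounded crudely by 1, makes the sum of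
    Re chi^2(p) / sqrt (N p) at most of order n^(1/4), and partial summation then bounds the sum
    with N p in place of sqrt (N p). The same crude bound makes the sum of Re chi(p) at most of
    order n^(3/4); set against a lower bound of order n / ln n for the number of primes, it gives
    the ratio delta = |G| - 1. In Mertens' theorem the ball is centred at a large z because the norm
    of an element can be far smaller than its size allows, whereas near z all norms have the same
    order. The upper bound for the primes of norm at most m comes from an element of Z or F[T] that
    lies in all of them and has size exp(O(m)). *)

Lemma card_fsetM (K K' : choiceType) (A : {fset K}) (B : {fset K'}) :
  #|` (A `*` B)%fset| = (#|` A| * #|` B|)%N.
Proof.
pose s := [seq (a, b) | a <- enum_fset A, b <- enum_fset B].
have us : uniq s.
  apply: allpairs_uniq => //; try exact: fset_uniq.
  by move=> [a b] [c d] _ _ /= [-> ->].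
have -> : (A `*` B)%fset = [fset x in s]%fset.
  apply/fsetP => -[a b]; rewrite in_fsetM /= !inE /=.
  apply/andP/idP => [[aA bB]|/allpairsP[[c d] [/= cA dB [-> ->]]] //].
  by apply/allpairsP; exists (a, b).
by rewrite card_fseq undup_id // size_allpairs.
Qed.

Section Cosets.
Variable E : fieldType.
Implicit Types (G H O p : set E).

Definition subgroup H := H 0 /\ forall x y, H x -> H y -> H (x - y).

Lemma subgroupN H x : subgroup H -> H x -> H (- x).
Proof. by move=> [H0 HB] Hx; rewrite -sub0r; apply: HB. Qed.

Lemma subgroupD H x y : subgroup H -> H x -> H y -> H (x + y).
Proof. by move=> sH Hx Hy; rewrite -(opprK y); apply: sH.2 => //; apply: subgroupN. Qed.

Lemma subgroupBC H x y : subgroup H -> H (x - y) -> H (y - x).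
Proof. by move=> sH Hxy; rewrite -opprB; apply: subgroupN. Qed.

Lemma subgroup_trans H x y z : subgroup H -> H (x - y) -> H (y - z) -> H (x - z).
Proof. by move=> sH hx hy; rewrite -(subrKA y); apply: subgroupD. Qed.

(** The finiteness of G/H is carried by an explicit system of representatives: [ideal_norm] is 0 on
    an infinite quotient, so a norm is meaningful only next to a transversal. *)
Definition transversal G H (T : {fset E}) : Prop :=
  [/\ forall t, t \in T -> G t,
      forall x, G x -> exists2 t, t \in T & H (x - t)
    & forall t u, t \in T -> u \in T -> H (t - u) -> t = u].

Lemma transversal_rep G H T : transversal G H T ->
  exists f, forall x, G x -> f x \in T /\ H (x - f x).
Proof.
move=> [_ Ts _]; exists (fun x => xget 0 [set t | t \in T /\ H (x - t)]) => x Gx.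
by case: xgetP => [//|]; have [t tT Ht] := Ts x Gx => /(_ t); case.
Qed.

Lemma card_transversal G H T : subgroup G -> subgroup H ->
  transversal G H T -> ideal_norm G H = #|` T|.
Proof.
move=> sG sH [TG Tsurj Tinj]; rewrite /ideal_norm.
pose cos x := [set y | G y /\ H (y - x)].
have -> : [set cos x | x in G] = [set` (cos @` T)%fset].
  apply/seteqP; split=> [_ [x Gx <-]|_ /= /imfsetP[t /= tT ->]].
    have [t tT Hxt] := Tsurj x Gx.
    apply/imfsetP; exists t => //; apply/seteqP; split=> y [Gy Hy]; split=> //.
      exact: (subgroup_trans sH Hy).
    by apply: (subgroup_trans sH Hy); apply: subgroupBC.
  by exists t => //; exact: TG.
rewrite set_fsetK card_in_imfset //= => t u tT uT /seteqP[sub _].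
apply: Tinj => //; apply: (sub t _).2; split; first exact: TG.
by rewrite subrr; exact: sH.1.
Qed.

(** Keeping the representatives inside [S] is the point: a size bound on [S] becomes a size bound on
    the transversal. *)
Lemma transversal_from_reps G H (S : set E) : subgroup H -> finite_set S ->
  S `<=` G -> (forall x, G x -> exists2 y, S y & H (x - y)) ->
  exists2 T, transversal G H T & [set` T] `<=` S.
Proof.
move=> sH finS SG Srep.
pose rep x := xget 0 [set y | S y /\ H (x - y)].
have repP x : G x -> S (rep x) /\ H (x - rep x).
  move=> Gx; rewrite /rep; case: xgetP => [y _ //|].
  by have [y Sy Hy] := Srep x Gx => /(_ y); case.
(* The set handed to [xget] depends only on the coset of its argument, hence so does the choice. *)
have rep_eq x y : H (x - y) -> rep x = rep y.
  move=> Hxy; rewrite /rep; congr (xget _ _); apply/seteqP; split=> z [Sz Hz]; split=> //.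
    by apply: (subgroup_trans sH _ Hz); apply: subgroupBC.
  exact: (subgroup_trans sH Hxy).
have TP t : t \in (rep @` fset_set S)%fset -> exists2 s, S s & t = rep s.
  by case/imfsetP=> s /=; rewrite in_fset_set // inE => Ss ->; exists s.
exists (rep @` fset_set S)%fset.
  split.
  - by move=> t /TP[s /SG Gs ->]; apply: SG; case: (repP s).
  - move=> x Gx; have [SRx Hx] := repP x Gx; exists (rep x) => //.
    apply/imfsetP; exists (rep x); first by rewrite /= in_fset_set // inE.
    exact: rep_eq.
  - move=> t u /TP[s /SG Gs ->] /TP[r /SG Gr ->] Hsr.
    apply: rep_eq; have [_ hs] := repP s Gs; have [_ hr] := repP r Gr.
    apply: (subgroup_trans sH hs); apply: (subgroup_trans sH Hsr).
    exact: subgroupBC.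
by move=> t /= /TP[s /SG Gs ->]; case: (repP s).
Qed.

Lemma transversal_coarse G H H' T : subgroup H' -> transversal G H T ->
  H `<=` H' -> exists T', transversal G H' T'.
Proof.
move=> sH' [TG Ts _] HH'.
have [|//|x /Ts[t tT /HH' Hxt]|T' TT' _] := @transversal_from_reps G H' [set` T] sH'.
- exact: finite_fset.
- by exists t.
- by exists T'.
Qed.

(** Sums of a representative of G/H and one of H/H' represent G/H'. This multiplicativity of the
    index is what makes the norm multiplicative. *)
Lemma transversal_tower G H H' T1 T2 : subgroup H -> subgroup H' ->
  subgroup G -> H `<=` G -> H' `<=` H ->
  transversal G H T1 -> transversal H H' T2 ->
  exists2 T, transversal G H' T & #|` T| = (#|` T1| * #|` T2|)%N.
Proof.
move=> sH sH' sG HG H'H [T1G T1s T1i] [T2H T2s T2i].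
pose f (u : E * E) := u.1 + u.2.
have fi : {in (T1 `*` T2)%fset &, injective f}.
  move=> [t1 t2] [u1 u2]; rewrite !in_fsetM /= => /andP[t1T t2T] /andP[u1T u2T].
  rewrite /f /= => e.
  have t1u1 : t1 = u1.
    apply: T1i => //.
    have -> : t1 - u1 = u2 - t2.
      by apply/eqP; rewrite subr_eq addrAC eq_sym subr_eq e addrC.
    by apply: sH.2; apply: T2H.
  by move: e; rewrite t1u1 => /addrI ->.
exists (f @` (T1 `*` T2))%fset; last first.
  by rewrite card_in_imfset //= card_fsetM.
split.
- move=> w /imfsetP[[a c] /=]; rewrite in_fsetM /= => /andP[aT cT] ->.
  by apply: subgroupD => //; [apply: T1G|apply/HG/T2H].
- move=> x Gx; have [t1 t1T Hx] := T1s _ Gx.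
  have [t2 t2T Hx2] := T2s _ Hx.
  exists (t1 + t2); last by rewrite opprD addrA.
  by apply/imfsetP; exists (t1, t2); rewrite //= in_fsetM t1T.
- move=> w w' /imfsetP[[t1 t2] /=]; rewrite in_fsetM /= => /andP[t1T t2T] ->.
  move=> /imfsetP[[u1 u2] /=]; rewrite in_fsetM /= => /andP[u1T u2T] ->.
  rewrite /f /= => e.
  have t1u1 : t1 = u1.
    apply: T1i => //.
    have -> : t1 - u1 = (t1 + t2 - (u1 + u2)) + (u2 - t2).
      by ring.
    by apply: subgroupD => //; [apply: H'H|apply: sH.2; apply: T2H].
  move: e; rewrite t1u1 opprD addrACA subrr add0r => e.
  by congr (_ + _); apply: T2i.
Qed.

End Cosets.

Section Counting.
Variables (R : realType) (E : fieldType) (sz : E -> R).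
Implicit Types (G H : set E).
Hypothesis szD : forall x y, sz (x + y) <= sz x + sz y.
Hypothesis szN : forall x, sz (- x) = sz x.

Definition ball_in G (z : E) (Y : R) : set E := [set x | G x /\ sz (x - z) <= Y].

Definition count_in G z Y : nat := #|` fset_set (ball_in G z Y)|.

Lemma card_fset_set_inj (U V : choiceType) (A : set U) (B : set V) (f : U -> V) :
  finite_set A -> finite_set B -> (forall x, A x -> B (f x)) ->
  (forall x y, A x -> A y -> f x = f y -> x = y) ->
  (#|` fset_set A| <= #|` fset_set B|)%N.
Proof.
move=> fA fB fAB fi.
have <- : #|` (f @` fset_set A)%fset| = #|` fset_set A|.
  rewrite card_in_imfset //= => x y.
  by rewrite !in_fset_set // => /set_mem Ax /set_mem Ay; apply: fi.
apply: fsubset_leq_card; apply/fsubsetP => _ /imfsetP[x /= xA ->].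
by move: xA; rewrite !in_fset_set // !inE => /fAB.
Qed.

Lemma ball_in_recenter G z Y : (forall r, finite_set (ball_in G 0 r)) ->
  finite_set (ball_in G z Y).
Proof.
move=> fG; apply: sub_finite_set (fG (Y + sz z)) => y [Gy yr]; split=> //.
by rewrite subr0 -(subrK z y); apply: le_trans (szD _ _) _; exact: lerD.
Qed.

Variables (G H : set E).
Hypothesis sG : subgroup G.
Hypothesis sH : subgroup H.
Hypothesis HG : H `<=` G.
Hypothesis finG : forall z Y, finite_set (ball_in G z Y).

Lemma ball_in_sub z Y Y' : Y <= Y' -> ball_in G z Y `<=` ball_in G z Y'.
Proof. by move=> YY' x [Gx sx]; split=> //; apply: le_trans YY'. Qed.

Lemma ball_in_finite_sub z Y : finite_set (ball_in H z Y).
Proof. by apply: sub_finite_set (finG z Y) => x [/HG]. Qed.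

Lemma count_in_shift z Y : G z -> count_in G z Y = count_in G 0 Y.
Proof.
move=> Gz; apply/eqP; rewrite eqn_leq; apply/andP; split.
  apply: (@card_fset_set_inj _ _ _ _ (fun x => x - z)) => //.
    by move=> x [Gx sx]; split; [apply: sG.2|rewrite subr0].
  by move=> x y _ _ /addIr.
apply: (@card_fset_set_inj _ _ _ _ (fun x => x + z)) => //.
  by move=> x [Gx sx]; split; [apply: subgroupD|rewrite addrK -[x]subr0].
by move=> x y _ _ /addIr.
Qed.

Section Transversal.
Variables (T : {fset E}) (r : R).
Hypothesis TT : transversal G H T.
Hypothesis Tr : forall t, t \in T -> sz t <= r.

(** The map (t, x) -> t + x is injective and moves x by at most r. Together with [count_in_le_mul],
    which rests on the splitting x = f x + (x - f x), it pins the count in H to the count in G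
    divided by the index, up to a change r of the radius. *)
Lemma count_in_mul_le z Y : (#|` T| * count_in H z Y <= count_in G z (Y + r))%N.
Proof.
have [TG Ts Ti] := TT.
have fT : finite_set [set` T] by [].
rewrite -card_fsetM /count_in -(set_fsetK (_ `*` _)%fset).
apply: (@card_fset_set_inj _ _ _ _ (fun u : E * E => u.1 + u.2)) => //.
  move=> [t x]; rewrite /= in_fsetM /= in_fset_set ?inE; last exact: ball_in_finite_sub.
  move=> /andP[tT /set_mem[Hx sx]]; split.
    by apply: subgroupD => //; [exact: TG|exact: HG].
  rewrite -addrA addrC; apply: le_trans (szD _ _) _.
  by apply: lerD => //; apply: Tr.
move=> [t x] [u y]; rewrite /= !in_fsetM /= !in_fset_set; try exact: ball_in_finite_sub.
move=> /andP[tT /set_mem[Hx _]] /andP[uT /set_mem[Hy _]] e.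
have tu : t = u.
  apply: Ti => //; have -> : t - u = y - x.
    by apply/eqP; rewrite subr_eq addrAC eq_sym subr_eq e addrC.
  exact: sH.2.
by move: e; rewrite tu => /addrI ->.
Qed.

Lemma count_in_le_mul z Y : (count_in G z Y <= #|` T| * count_in H z (Y + r))%N.
Proof.
have [f fP] := transversal_rep TT.
rewrite -card_fsetM /count_in -[X in (_ <= #|` X|)%N]set_fsetK.
apply: (@card_fset_set_inj _ _ _ _ (fun x => (f x, x - f x))) => //.
  move=> x [Gx sx]; have [fx Hx] := fP x Gx.
  rewrite /= in_fsetM /= fx /= in_fset_set; last exact: ball_in_finite_sub.
  rewrite inE; split=> //.
  rewrite addrAC; apply: le_trans (szD _ _) _; rewrite szN.
  by apply: lerD => //; apply: Tr.
by move=> x y _ _ [->] /addIr.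
Qed.

End Transversal.

End Counting.

(** * Ideals when every fractional ideal is invertible *)

Section Dedekind.
Variables (E : fieldType) (O : set E).
Implicit Types (I J M p q : set E) (s : seq (set E)) (k : nat).
Local Notation "I ** J" := (ideal_mul I J) (at level 40, left associativity).

Lemma ideal_mulM I J x y : I x -> J y -> (I ** J) (x * y).
Proof.
by move=> Ix Jy; exists 1%N, (fun=> x), (fun=> y); split=> //; rewrite big_ord1.
Qed.

Lemma ideal_mul0 I J : (I ** J) 0.
Proof.
by exists 0%N, (fun=> 0), (fun=> 0); split; [case|rewrite big_ord0].
Qed.

Lemma ideal_mulD I J x y : (I ** J) x -> (I ** J) y -> (I ** J) (x + y).
Proof.
move=> [n [u [v [uv ->]]]] [m [u' [v' [uv' ->]]]].
pose w (a : 'I_n -> E) (c : 'I_m -> E) (i : 'I_(n + m)) :=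
  match fintype.split i with inl j => a j | inr j => c j end.
exists (n + m)%N, (w u u'), (w v v'); split.
  by move=> i; rewrite /w; case: (fintype.split i) => j.
rewrite big_split_ord /=; congr (_ + _); apply: eq_bigr => i _; rewrite /w.
  by case: fintype.split_ordP => j /(congr1 val) /= e;
     [have -> : i = j by apply: val_inj|have := ltn_ord i; rewrite e ltnNge leq_addr].
case: fintype.split_ordP => j /(congr1 val) /= e.
  by have := ltn_ord j; rewrite -e ltnNge leq_addr.
by have -> : i = j by apply: val_inj; apply: (@addnI n).
Qed.

Lemma ideal_mul_min I J M : (forall x y, I x -> J y -> M (x * y)) ->
  M 0 -> (forall x y, M x -> M y -> M (x + y)) -> I ** J `<=` M.
Proof.
move=> MM M0 MD _ [n [u [v [uv ->]]]].
by apply: big_ind => // i _; case: (uv i); apply: MM.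
Qed.

Lemma ideal_mul_ind I J (M : E -> Prop) : (forall x y, I x -> J y -> M (x * y)) ->
  M 0 -> (forall x y, M x -> M y -> M (x + y)) -> forall x, (I ** J) x -> M x.
Proof. exact: ideal_mul_min. Qed.

Lemma ideal_mulC I J : I ** J = J ** I.
Proof.
suff H M N : M ** N `<=` N ** M by apply/seteqP; split; exact: H.
apply: ideal_mul_min; [|exact: ideal_mul0|exact: ideal_mulD].
by move=> x y Mx Ny; rewrite mulrC; apply: ideal_mulM.
Qed.

Lemma ideal_mulS I J M N : I `<=` J -> M `<=` N -> I ** M `<=` J ** N.
Proof.
move=> IJ MN; apply: ideal_mul_min; [|exact: ideal_mul0|exact: ideal_mulD].
by move=> x y /IJ Jx /MN Ny; exact: ideal_mulM.
Qed.

Lemma ideal_mulA I J M : I ** (J ** M) = I ** J ** M.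
Proof.
have sub (A B C : set E) : A ** (B ** C) `<=` A ** B ** C.
  apply: (@ideal_mul_min A (B ** C) (A ** B ** C)); [|exact: ideal_mul0|exact: ideal_mulD].
  move=> x y Ax; move: y; apply: (@ideal_mul_ind B C (fun y => (A ** B ** C) (x * y))).
  - by move=> u v Bu Cv; rewrite mulrA; do 2 apply: ideal_mulM => //.
  - by rewrite mulr0; exact: ideal_mul0.
  - by move=> u v; rewrite mulrDr; exact: ideal_mulD.
apply/seteqP; split; first exact: sub.
rewrite (ideal_mulC (I ** J) M) (ideal_mulC I J) (ideal_mulC I (J ** M)) (ideal_mulC J M).
exact: sub.
Qed.

Hypothesis O1 : O 1.
Hypothesis OB : forall x y, O x -> O y -> O (x - y).
Hypothesis OM : forall x y, O x -> O y -> O (x * y).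

Lemma subring_subgroup : subgroup O.
Proof. by split=> //; rewrite -(subrr 1); apply: OB. Qed.

Let sO := subring_subgroup.

Lemma submodule_subgroup I : submodule O I -> subgroup I.
Proof.
move=> [I0 ID IM]; split=> // x y Ix Iy; apply: ID => //.
by rewrite -mulN1r; apply: IM => //; exact: subgroupN.
Qed.

Lemma ideal_mul1 I : submodule O I -> O ** I = I.
Proof.
move=> [I0 ID IM]; apply/seteqP; split; first exact: ideal_mul_min.
by move=> x Ix; rewrite -(mul1r x); apply: ideal_mulM.
Qed.

Lemma submodule_mul I J : submodule O I -> submodule O (I ** J).
Proof.
move=> [I0 ID IM]; split; [exact: ideal_mul0|exact: ideal_mulD|].
move=> a x Oa; move: x; apply: (@ideal_mul_ind I J (fun x => (I ** J) (a * x))).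
- by move=> u v Iu Jv; rewrite mulrA; apply: ideal_mulM => //; exact: IM.
- by rewrite mulr0; exact: ideal_mul0.
- by move=> u v; rewrite mulrDr; exact: ideal_mulD.
Qed.

Lemma submodule_ring : submodule O O.
Proof. by split=> //; [exact: sO.1|move=> x y; apply: subgroupD]. Qed.

Lemma fractional_mul I J :
  fractional O I -> fractional O J -> fractional O (I ** J).
Proof.
move=> [sI [x Ix x0] [d d0 dI]] [sJ [y Jy y0] [e e0 eJ]]; split.
- exact: submodule_mul.
- by exists (x * y); [exact: ideal_mulM|rewrite mulf_neq0].
exists (d * e); first by rewrite mulf_neq0.
apply: (@ideal_mul_ind I J (fun z => O (d * e * z))).
- by move=> u v Iu Jv; rewrite mulrACA; apply: OM; [apply: dI|apply: eJ].
- by rewrite mulr0; exact: sO.1.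
- by move=> u v; rewrite mulrDr; apply: subgroupD.
Qed.

Definition ideal I := [/\ submodule O I, I `<=` O & exists2 x, I x & x != 0].

Lemma ideal_fractional I : ideal I -> fractional O I.
Proof.
move=> [sI IO nI]; split=> //; exists 1; first exact: oner_neq0.
by move=> x /IO; rewrite mul1r.
Qed.

Lemma ideal_ring : ideal O.
Proof. by split=> //; [exact: submodule_ring|exists 1 => //; exact: oner_neq0]. Qed.

Lemma ideal_prime p : prime_ideal O p -> ideal p.
Proof. by case. Qed.

Lemma ideal_prod I J : ideal I -> ideal J -> ideal (I ** J).
Proof.
move=> [sI IO [x Ix x0]] [sJ JO [y Jy y0]]; split.
- exact: submodule_mul.
- apply: ideal_mul_min; [|exact: sO.1|move=> u v; exact: subgroupD].
  by move=> u v /IO Ou /JO Ov; exact: OM.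
- by exists (x * y); [exact: ideal_mulM|rewrite mulf_neq0].
Qed.

Lemma ideal_principal a : O a -> a != 0 -> ideal (principal_ideal O a).
Proof.
move=> Oa a0; split.
- split.
  + by exists 0; [exact: sO.1|rewrite mulr0].
  + by move=> x y [u Ou <-] [v Ov <-]; exists (u + v); [exact: subgroupD|rewrite mulrDr].
  + by move=> c x Oc [u Ou <-]; exists (c * u); [exact: OM|rewrite mulrCA].
- by move=> x [u Ou <-]; exact: OM.
- by exists a => //; exists 1 => //; rewrite mulr1.
Qed.

Lemma principal_ideal_sub a I : submodule O I -> I a -> principal_ideal O a `<=` I.
Proof. by move=> [_ _ IM] Ia _ [u Ou <-]; rewrite mulrC; apply: IM. Qed.

Lemma ideal_mul_subl I J : submodule O I -> J `<=` O -> J ** I `<=` I.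
Proof.
by move=> sI JO; rewrite -[X in _ `<=` X]ideal_mul1 //; apply: ideal_mulS.
Qed.

Lemma prime_mul_sub p I J : prime_ideal O p -> I `<=` O -> J `<=` O ->
  I ** J `<=` p -> I `<=` p \/ J `<=` p.
Proof.
move=> [_ _ _ _ pP] IO JO IJp; apply: contrapT => /not_orP[nI nJ].
have [x Ix npx] : exists2 x, I x & ~ p x.
  by apply: contrapT => h; apply: nI => x Ix; apply: contrapT => npx; apply: h; exists x.
apply: nJ => y Jy; case: (pP x y) => //; [exact: IO|exact: JO|].
by apply: IJp; exact: ideal_mulM.
Qed.

Definition ideal_pow p k : set E := iter k (ideal_mul p) O.
Definition ideal_prods s : set E := foldr (@ideal_mul E) O s.

Lemma ideal_powP p k : ideal p -> ideal (ideal_pow p k).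
Proof.
by move=> ip; elim: k => [|k IH]; [exact: ideal_ring|exact: ideal_prod].
Qed.

Lemma ideal_prodsP s : (forall p, p \in s -> prime_ideal O p) -> ideal (ideal_prods s).
Proof.
elim: s => [_|p s IH ps]; first exact: ideal_ring.
apply: ideal_prod; first by apply/ideal_prime/ps; rewrite mem_head.
by apply: IH => q qs; apply: ps; rewrite in_cons qs orbT.
Qed.

Hypothesis inv : forall I, fractional O I ->
  exists2 J, fractional O J & I ** J = O.
Hypothesis fin : forall a, O a -> a != 0 ->
  exists T, transversal O (principal_ideal O a) T.

Lemma ideal_mul_cancel I J M : fractional O I -> submodule O J -> submodule O M ->
  I ** J `<=` I ** M -> J `<=` M.
Proof.
move=> fI sJ sM IJM; have [I' fI' II'] := inv fI.
rewrite -(ideal_mul1 sJ) -(ideal_mul1 sM) -II' (ideal_mulC I) -!ideal_mulA.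
exact: ideal_mulS.
Qed.

(** To contain is to divide: the quotient is p^-1 I, which is integral because I lies in p. *)
Lemma ideal_divide p I : ideal p -> ideal I -> I `<=` p ->
  exists2 J, ideal J & p ** J = I.
Proof.
move=> ip iI Ip; have fp := ideal_fractional ip.
have [p' fp' pp'] := inv fp; have [sI IO [x Ix x0]] := iI.
exists (p' ** I); last by rewrite ideal_mulA pp' ideal_mul1.
split.
- by case: fp' => sp' _ _; exact: submodule_mul.
- by rewrite -pp' ideal_mulC; exact: ideal_mulS.
- have [_ [y p'y y0] _] := fp'.
  by exists (y * x); [exact: ideal_mulM|rewrite mulf_neq0].
Qed.

Lemma ideal_transversal I : ideal I -> exists T, transversal O I T.
Proof.
move=> [sI IO [x Ix x0]]; have [T TT] := fin (IO _ Ix) x0.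
apply: (transversal_coarse (submodule_subgroup sI) TT).
exact: principal_ideal_sub.
Qed.

Local Notation N := (ideal_norm O).

Lemma ideal_norm_card I T : ideal I -> transversal O I T -> N I = #|` T|.
Proof.
by move=> [sI _ _]; apply: card_transversal => //; exact: submodule_subgroup.
Qed.

Lemma ideal_norm_gt0 I : ideal I -> (0 < N I)%N.
Proof.
move=> iI; have [T TT] := ideal_transversal iI; rewrite (ideal_norm_card iI TT).
have [_ Ts _] := TT; have [t tT _] := Ts 1 O1.
by rewrite cardfs_gt0; apply/fset0Pn; exists t.
Qed.

Lemma ideal_norm_ring : N O = 1%N.
Proof.
rewrite (@ideal_norm_card _ [fset 0]%fset) ?cardfs1 //; first exact: ideal_ring.
split.
- by move=> t /fset1P ->; exact: sO.1.
- by move=> x Ox; exists 0; rewrite ?inE // subr0.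
- by move=> t u /fset1P -> /fset1P ->.
Qed.

(** A transversal of I contains one of J. If they were equal, the representatives of x and of 0
    modulo I, congruent modulo J, would coincide and put x in I. *)
Lemma ideal_norm_lt I J x : ideal I -> ideal J -> I `<=` J -> J x -> ~ I x ->
  (N J < N I)%N.
Proof.
move=> iI iJ IJ Jx nIx; have [T TT] := ideal_transversal iI.
have [sI _ _] := iI; have [sJ JO _] := iJ.
have gI := submodule_subgroup sI; have gJ := submodule_subgroup sJ.
have [TO Ts Ti] := TT.
have [|y Oy|T' TT' T'T] := @transversal_from_reps _ O J [set` T] gJ (finite_fset _).
- by move=> t; exact: TO.
- by have [t tT Iyt] := Ts y Oy; exists t => //; exact: IJ.
rewrite (ideal_norm_card iI TT) (ideal_norm_card iJ TT').
have T'T' : (T' `<=` T)%fset by apply/fsubsetP => t; exact: T'T.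
rewrite ltn_neqAle fsubset_leq_card // andbT; apply/eqP => eT.
have eTT : T' = T by apply/eqP; rewrite eqEfcard T'T' eT /=.
have [t tT Ixt] := Ts x (JO _ Jx); have [u uT I0u] := Ts 0 sO.1.
have Itu : t = u.
  have [_ _ Ti'] := TT'; apply: Ti'; rewrite ?eTT //.
  have -> : t - u = x - (x - t) + (0 - u) by ring.
  by apply: subgroupD => //; [apply: gJ.2 => //|]; exact: IJ.
apply: nIx; have -> : x = (x - t) - (0 - u) by rewrite Itu; ring.
exact: gI.2.
Qed.

(** Multiplication by x is injective on the finite domain O/p, hence surjective, and reaches the
    class of 1. *)
Lemma prime_inverse p x : prime_ideal O p -> O x -> ~ p x ->
  exists2 y, O y & p (1 - x * y).
Proof.
move=> pp Ox npx; have ip := ideal_prime pp.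
have [T TT] := ideal_transversal ip; have [TO Ts Ti] := TT.
have [sp pO _ _ pP] := pp; have gp := submodule_subgroup sp.
have [g gP] := transversal_rep TT; pose f t := g (x * t).
have fP t : t \in T -> f t \in T /\ p (x * t - f t).
  by move=> tT; apply/gP/OM => //; exact: TO.
have fi : {in T &, injective f}.
  move=> t u tT uT e; apply: Ti => //.
  have [_ pt] := fP t tT; have [_ pu] := fP u uT.
  case: (pP x (t - u)) => //; first by apply: OB; exact: TO.
  have -> : x * (t - u) = (x * t - f t) - (x * u - f u) by rewrite e; ring.
  exact: gp.2.
have fT : (f @` T)%fset = T.
  apply/eqP; rewrite eqEfcard card_in_imfset // leqnn andbT.
  by apply/fsubsetP => u /imfsetP[t /= tT ->]; case: (fP t tT).
have [u uT p1u] := Ts 1 O1.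
move: (uT); rewrite -{1}fT => /imfsetP[t /= tT ue].
have [_ pt] := fP t tT; exists t; first exact: TO.
have -> : 1 - x * t = (1 - u) - (x * t - f t) by rewrite ue; ring.
exact: gp.2.
Qed.

Lemma prime_maximal p q : prime_ideal O p -> prime_ideal O q -> q `<=` p -> q = p.
Proof.
move=> pp pq qp; apply/seteqP; split=> // x px.
have [[sp _ _] pO _ np1 _] := pp; have [[q0 qD qM] qO _ _ _] := pq.
apply: contrapT => nqx; have [y Oy qy] := prime_inverse pq (pO _ px) nqx.
apply: np1; have -> : 1 = (1 - x * y) + y * x by ring.
have [_ pD pM] : submodule O p by case: pp.
by apply: pD; [exact: qp|exact: pM].
Qed.

(** Multiplication by an element a of I outside pI carries O/p bijectively onto I/pI, and the tower
    pI, I, O gives the product of indices. An element z of I^-1 with a z outside p serves to undo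
    this multiplication modulo p. *)
Lemma ideal_norm_prime_mul p I : prime_ideal O p -> ideal I ->
  N (p ** I) = (N p * N I)%N.
Proof.
move=> pp iI; have ip := ideal_prime pp; have ipI := ideal_prod ip iI.
have [sI IO _] := iI; have gI := submodule_subgroup sI.
have [spI pIO _] := ipI; have gpI := submodule_subgroup spI.
have [sp pO _ np1 pP] := pp; have gp := submodule_subgroup sp.
have [I' fI' II'] := inv (ideal_fractional iI).
have pII : p ** I `<=` I by exact: ideal_mul_subl.
have [a Ia npIa] : exists2 a, I a & ~ (p ** I) a.
  apply: contrapT => h; apply: np1; suff : O `<=` p by apply.
  apply: (ideal_mul_cancel (ideal_fractional iI) submodule_ring sp).
  rewrite ideal_mulC ideal_mul1 // ideal_mulC => a Ia.
  by apply: contrapT => npa; apply: h; exists a.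
(* J = a I^-1 is an integral ideal not contained in p *)
have aI'O z : I' z -> O (a * z) by move=> I'z; rewrite -II'; exact: ideal_mulM.
have [z I'z npaz] : exists2 z, I' z & ~ p (a * z).
  apply: contrapT => h; apply: npIa; rewrite -(mulr1 a).
  have : (I' ** I) 1 by rewrite ideal_mulC II'.
  move: 1; apply: (@ideal_mul_ind I' I (fun x => (p ** I) (a * x))).
  - move=> u v I'u Iv; rewrite mulrA; apply: ideal_mulM => //.
    by apply: contrapT => npu; apply: h; exists u.
  - by rewrite mulr0; exact: ideal_mul0.
  - by move=> u v; rewrite mulrDr; exact: ideal_mulD.
have [y Oy py] := prime_inverse pp (aI'O _ I'z) npaz.
have [Tp TTp] := ideal_transversal ip; have [TpO Tps Tpi] := TTp.
have [TI TTI] := ideal_transversal iI.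
have [_ ID IM] := sI.
have TT' : transversal I (p ** I) ((fun t => a * t) @` Tp)%fset.
  split.
  - by move=> w /imfsetP[t /= tT ->]; rewrite mulrC; apply: IM => //; exact: TpO.
  - move=> x Ix.
    have Ozx : O (z * x) by rewrite -II' ideal_mulC; exact: ideal_mulM.
    (* Since a z y is 1 modulo p, x agrees with a (y z x) modulo pI. *)
    have [t tT pt] := Tps (y * (z * x)) (OM Oy Ozx).
    exists (a * t); first by apply/imfsetP; exists t.
    have -> : x - a * t = (1 - a * z * y) * x + (y * (z * x) - t) * a by ring.
    by apply: ideal_mulD; apply: ideal_mulM.
  - move=> w w' /imfsetP[t /= tT ->] /imfsetP[u /= uT ->] H.
    congr (_ * _); apply: Tpi => //.
    case: (pP (a * z) (t - u)) => //; [exact: aI'O|by apply: OB; exact: TpO|].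
    have -> : a * z * (t - u) = z * (a * t - a * u) by ring.
    have : (I' ** (p ** I)) (z * (a * t - a * u)) by exact: ideal_mulM.
    by rewrite (ideal_mulC p) ideal_mulA (ideal_mulC I') II' ideal_mul1.
have [T TT cT] := transversal_tower gI gpI sO IO pII TTI TT'.
rewrite (ideal_norm_card ipI TT) cT (ideal_norm_card iI TTI) (ideal_norm_card ip TTp) mulnC.
rewrite card_imfset //; apply: mulfI; apply/eqP => a0; apply: npIa.
by rewrite a0; exact: ideal_mul0.
Qed.

Lemma prime_norm_gt1 p : prime_ideal O p -> (1 < N p)%N.
Proof.
move=> pp; have [_ pO _ np1 _] := pp.
by rewrite -[1%N]ideal_norm_ring; apply: ideal_norm_lt np1 => //;
  [exact: ideal_prime|exact: ideal_ring].
Qed.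

Lemma ideal_norm_pow p k : prime_ideal O p -> N (ideal_pow p k) = (N p ^ k)%N.
Proof.
move=> pp; elim: k => [|k IH]; first by rewrite ideal_norm_ring.
rewrite /= ideal_norm_prime_mul //; last exact/ideal_powP/ideal_prime.
by rewrite IH expnS.
Qed.

Lemma ideal_norm_prods s : (forall p, p \in s -> prime_ideal O p) ->
  N (ideal_prods s) = (\prod_(p <- s) N p)%N.
Proof.
elim: s => [_|p s IH ps]; first by rewrite big_nil ideal_norm_ring.
have ps' q : q \in s -> prime_ideal O q by move=> qs; apply: ps; rewrite in_cons qs orbT.
rewrite big_cons /= ideal_norm_prime_mul ?IH //; first by apply: ps; rewrite mem_head.
exact: ideal_prodsP.
Qed.

(** Induction on the norm. If x y is in I but neither x nor y is, then I + xO has smaller norm and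
    is still proper: 1 = u + x v with u in I would give y = y u + v (x y) in I. *)
Lemma exists_prime_above I : ideal I -> ~ I 1 ->
  exists2 p, prime_ideal O p & I `<=` p.
Proof.
have [n] := ubnP (N I); elim: n I => // n IH I nI iI nI1.
have [sI IO nzI] := iI; have gI := submodule_subgroup sI; have [_ ID IM] := sI.
have [pI|npI] := pselect (prime_ideal O I); first by exists I.
have [x [y [Ox Oy Ixy nx ny]]] :
    exists x y, [/\ O x, O y, I (x * y), ~ I x & ~ I y].
  apply: contrapT => h; apply: npI; split=> // x y Ox Oy Ixy.
  by apply: contrapT => /not_orP[nx ny]; apply: h; exists x, y.
pose J := [set u + x * v | u in I & v in O].
have IJ : I `<=` J.
  by move=> u Iu; exists u => //; exists 0; [exact: sO.1|rewrite mulr0 addr0].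
have iJ : ideal J.
  split.
  - split; first exact/IJ/gI.1.
      move=> _ _ [u Iu [v Ov <-]] [u' Iu' [v' Ov' <-]].
      exists (u + u'); first exact: ID.
      by exists (v + v'); [exact: subgroupD|ring].
    move=> a _ Oa [u Iu [v Ov <-]]; exists (a * u); first exact: IM.
    by exists (a * v); [exact: OM|ring].
  - by move=> _ [u Iu [v Ov <-]]; apply: subgroupD => //; [exact: IO|exact: OM].
  - by have [w Iw w0] := nzI; exists w => //; exact: IJ.
have Jx : J x by exists 0; [exact: gI.1|exists 1 => //; rewrite mulr1 add0r].
have [|//|[u Iu [v Ov e]]|p pp Jp] := IH J.
- by rewrite ltnS in nI; apply: leq_trans nI; exact: (ideal_norm_lt iI iJ IJ Jx).
- apply: ny; have -> : y = y * u + v * (x * y) by rewrite -[LHS]mulr1 -e; ring.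
  by apply: ID; exact: IM.
by exists p => // u /IJ /Jp.
Qed.

Lemma ideal_factorization I : ideal I ->
  exists2 s, (forall p, p \in s -> prime_ideal O p) & I = ideal_prods s.
Proof.
have [n] := ubnP (N I); elim: n I => // n IH I nI iI.
have [I1|nI1] := pselect (I 1).
  exists [::] => //=; have [[_ _ IM] IO _] := iI.
  by apply/seteqP; split=> // x Ox; rewrite -(mulr1 x); exact: IM.
have [p pp Ip] := exists_prime_above iI nI1; have ip := ideal_prime pp.
have [J iJ pJ] := ideal_divide ip iI Ip.
have [|//|s ps Js] := IH J.
  rewrite ltnS -pJ ideal_norm_prime_mul // in nI; apply: leq_trans nI.
  by rewrite ltn_Pmull ?prime_norm_gt1 ?ideal_norm_gt0.
exists (p :: s); last by rewrite /= -Js.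
by move=> q; rewrite in_cons => /orP[/eqP ->|/ps].
Qed.

(** Induction on the exponent: with J = p^k M, cancelling p^k from the next inclusion leaves q M
    inside p; as q is not inside p, M is, which yields one more factor p. *)
Lemma coprime_cancel p q J k : prime_ideal O p -> prime_ideal O q -> q != p ->
  ideal J -> q ** J `<=` ideal_pow p k -> J `<=` ideal_pow p k.
Proof.
move=> pp pq qp iJ; have ip := ideal_prime pp; have iq := ideal_prime pq.
have [_ JO _] := iJ; have [sq qO _ _ _] := pq; have [sp _ _ _ _] := pp.
elim: k => // k IH qJ; have ipk := ideal_powP k ip; have [spk pkO _] := ipk.
have Jk : J `<=` ideal_pow p k.
  by apply: IH => x /qJ /=; apply: ideal_mul_subl => //; case: ip.
have [M iM pM] := ideal_divide ipk iJ Jk; have [sM MO _] := iM.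
have qM : q ** M `<=` p.
  apply: (ideal_mul_cancel (ideal_fractional ipk)) => //; first exact: submodule_mul.
  by rewrite ideal_mulA (ideal_mulC _ q) -ideal_mulA pM (ideal_mulC _ p).
have [/(prime_maximal pp pq)/eqP|Mp] := prime_mul_sub pp qO MO qM.
  by rewrite (negPf qp).
by rewrite -pM /= ideal_mulC; exact: ideal_mulS.
Qed.

Lemma ideal_prods_sub_pow s p k : (forall q, q \in s -> prime_ideal O q) ->
  prime_ideal O p -> ideal_prods s `<=` ideal_pow p k <-> (k <= count_mem p s)%N.
Proof.
move=> ps pp; have ip := ideal_prime pp; have [_ pO _ np1 _] := pp.
elim: s k ps => [|q s IH] [|k] ps /=.
- by split=> // _; exact: subset_refl.
- split=> // h; case: np1; have := h 1 O1.
  by rewrite ideal_mulC; apply: ideal_mul_subl; [case: ip|case: (ideal_powP k ip)].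
- split=> // _; have [] // : ideal (ideal_prods (q :: s)) by exact: ideal_prodsP.
have ps' r : r \in s -> prime_ideal O r by move=> rs; apply: ps; rewrite in_cons rs orbT.
have pq : prime_ideal O q by apply: ps; rewrite mem_head.
have is' := ideal_prodsP ps'; have ipk := ideal_powP k ip.
have [ss' _ _] := is'; have [spk _ _] := ipk.
have [->|qp] := eqVneq q p.
  rewrite add1n ltnS -IH //; split=> h; last exact: ideal_mulS.
  exact: (ideal_mul_cancel (ideal_fractional ip) ss' spk h).
rewrite add0n -IH //; split=> [h|h].
  exact: (@coprime_cancel p q _ k.+1).
by apply: subset_trans h; apply: ideal_mul_subl => //; case: pq.
Qed.

(** Membership in the powers of p counts the multiplicity of p in (a); this turns ln N(a) into a sum
    over the prime powers that contain a. *)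
Lemma principal_factorization a : O a -> a != 0 ->
  exists s, [/\ forall p, p \in s -> prime_ideal O p,
    N (principal_ideal O a) = (\prod_(p <- s) N p)%N
  & forall p k, prime_ideal O p -> ideal_pow p k a <-> (k <= count_mem p s)%N].
Proof.
move=> Oa a0; have ia := ideal_principal Oa a0.
have [s ps es] := ideal_factorization ia; exists s; split=> //.
  by rewrite es ideal_norm_prods.
move=> p k pp; rewrite -ideal_prods_sub_pow // -es; split=> [pa|].
  by apply: principal_ideal_sub => //; case: (ideal_powP k (ideal_prime pp)).
by apply; exists 1; rewrite ?mulr1.
Qed.

End Dedekind.

(** * Sums over elements of bounded norm *)

Lemma exprB_le (R : realDomainType) (x y : R) n : 0 <= y -> y <= x ->
  x ^+ n - y ^+ n <= n%:R * (x - y) * x ^+ n.-1.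
Proof.
move=> y0 yx; have x0 := le_trans y0 yx.
rewrite subrXX -mulrA [leRHS]mulrCA ler_wpM2l ?subr_ge0 // mulr_natl -[X in _ *+ X]card_ord.
rewrite -sumr_const; apply: ler_sum => -[i ilt] _ /=.
have id : (i <= n.-1)%N by rewrite -ltnS prednK // (leq_ltn_trans _ ilt).
by rewrite -[X in _ <= x ^+ X](subnK id) exprD ler_wpM2l ?exprn_ge0 // lerXn2r ?nnegrE.
Qed.

Section PartialSummation.
Variables (R : realType) (T : choiceType) (S : set T) (N : T -> nat).
Implicit Types (f w : T -> R) (g : nat -> R) (n m k : nat).

Definition upto n : {fset T} := fset_set [set p | S p /\ (N p <= n)%N].

Hypothesis finS : forall n, finite_set [set p | S p /\ (N p <= n)%N].
Hypothesis N_gt1 : forall p, S p -> (1 < N p)%N.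

Lemma in_upto n p : (p \in upto n) <-> S p /\ (N p <= n)%N.
Proof. by rewrite in_fset_set // inE. Qed.

Lemma upto_gt1 n p : p \in upto n -> (1 < N p)%N.
Proof. by move=> /in_upto[/N_gt1]. Qed.

Lemma upto0 : upto 0 = fset0.
Proof. by apply/fsetP => p; rewrite inE; apply/negP => /in_upto[/N_gt1]; case: N. Qed.

Lemma upto_sum_le n m f : (m <= n)%N ->
  \sum_(p <- upto n | (N p <= m)%N) f p = \sum_(p <- upto m) f p.
Proof.
move=> mn; rewrite -big_filter; apply: perm_big; apply: uniq_perm.
- exact/filter_uniq/fset_uniq.
- exact: fset_uniq.
move=> p; rewrite mem_filter; apply/andP/idP => [[pm /in_upto[Sp _]]|/in_upto[Sp pm]].
  exact/in_upto.
by split=> //; apply/in_upto; split=> //; exact: leq_trans mn.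
Qed.

Lemma upto_sumB n m f : (m <= n)%N ->
  \sum_(p <- upto n) f p - \sum_(p <- upto m) f p =
  \sum_(p <- upto n | (m < N p)%N) f p.
Proof.
move=> mn; rewrite (bigID (fun p => (N p <= m)%N)) /= upto_sum_le // [X in X - _]addrC addrK.
by apply: eq_bigl => p; rewrite ltnNge.
Qed.

(** Abel summation over the integer values of the norm. The value [g 0] only meets the empty sum
    over [upto 0], so it may be a default value such as [0^-1]. *)
Lemma partial_summation f g n :
  \sum_(p <- upto n) f p * g (N p) =
  (\sum_(p <- upto n) f p) * g n +
  \sum_(k < n) (\sum_(p <- upto k) f p) * (g k - g k.+1).
Proof.
elim: n => [|n IH]; first by rewrite upto0 !big_seq_fset0 big_ord0 mul0r addr0.
have := upto_sumB (fun p => f p * g (N p)) (leqnSn n).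
have := upto_sumB f (leqnSn n).
move=> /eqP; rewrite subr_eq => /eqP ->; move=> /eqP; rewrite subr_eq => /eqP ->.
rewrite IH big_ord_recr /=.
have -> : \sum_(p <- upto n.+1 | (n < N p)%N) f p * g (N p) =
          (\sum_(p <- upto n.+1 | (n < N p)%N) f p) * g n.+1.
  rewrite mulr_suml big_seq_cond [RHS]big_seq_cond; apply: eq_bigr => p.
  move=> /andP[/in_upto[_ pn] np]; congr (_ * g _).
  by apply/eqP; rewrite eqn_leq pn.
ring.
Qed.

Lemma sum_le_of_linear w g C n : (forall k, \sum_(p <- upto k) w p <= C * k%:R) ->
  (forall k, (0 < k)%N -> g k.+1 <= g k) -> 0 <= g n ->
  \sum_(p <- upto n) w p * g (N p) <= C * \sum_(k < n) g k.+1.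
Proof.
move=> wC gd gn; rewrite partial_summation.
apply: (@le_trans _ _ (C * n%:R * g n + \sum_(k < n) C * k%:R * (g k - g k.+1))).
  apply: lerD; first exact: ler_wpM2r.
  apply: ler_sum => -[[|k] kn] _ /=; first by rewrite upto0 big_seq_fset0 mulr0 !mul0r.
  by apply: ler_wpM2r; rewrite // subr_ge0 gd.
(* Abel summation for the constant weight C, read backwards. *)
rewrite le_eqVlt; apply/orP; left; apply/eqP; elim: n {gn} => [|n IH].
  by rewrite !big_ord0; ring.
rewrite !big_ord_recr /= [RHS]mulrDr -IH -natr1; ring.
Qed.

Lemma sum_inv_sqr_le n : \sum_(k < n) (k.+1%:R ^- 2 : R) <= 2.
Proof.
(* The subtracted term makes the induction close. *)
suff : \sum_(k < n.+1) (k.+1%:R ^- 2 : R) <= 2 - (n.+1)%:R^-1.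
  rewrite big_ord_recr /= => h; apply: le_trans (_ : 2 - n.+1%:R^-1 <= 2).
    by apply: le_trans h; rewrite lerDl.
  by rewrite lerBlDr lerDl invr_ge0.
elim: n => [|n IH]; first by rewrite big_ord1 expr1n invr1; lra.
rewrite big_ord_recr /=; apply: le_trans (lerD IH (lexx _)) _.
have -> : n.+2%:R = n%:R + 2 :> R by rewrite -addn2 natrD.
have -> : n.+1%:R = n%:R + 1 :> R by rewrite -addn1 natrD.
set x : R := n%:R; have x0 : 0 <= x by [].
rewrite -subr_ge0.
have -> : 2 - (x + 2)^-1 - (2 - (x + 1)^-1 + (x + 2) ^- 2) =
   1 / ((x+1) * (x + 2) ^+ 2).
  by field; apply/andP; split; lra.
by rewrite divr_ge0 // mulr_ge0 ?exprn_ge0 //; lra.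
Qed.

(** With u and v the d-th roots of k + 1 and k, 1 = u^d - v^d <= d (u - v) u^(d-1). Multiplied by u
    / u^d, this bounds the k-th term by d (u - v), which telescopes. *)
Lemma sum_root_le d n : (0 < d)%N ->
  \sum_(k < n) (k.+1%:R `^ (d%:R^-1) / k.+1%:R : R) <= d%:R * n%:R `^ (d%:R^-1).
Proof.
move=> d0; have d0' : (d%:R : R) != 0 by rewrite pnatr_eq0 -lt0n.
elim: n => [|n IH]; first by rewrite big_ord0 mulr_ge0 // powR_ge0.
rewrite big_ord_recr /=; set u := n.+1%:R `^ _; set v := n%:R `^ _ in IH *.
have rootK (k : nat) : (k%:R `^ (d%:R^-1) : R) ^+ d = k%:R.
  by rewrite -powR_mulrn ?powR_ge0 // -powRrM mulVf // powRr1.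
have u0 : 0 <= u by exact: powR_ge0.
have v0 : 0 <= v by exact: powR_ge0.
have vu : v <= u.
  by apply: ge0_ler_powR; rewrite ?invr_ge0 // ?nnegrE // ler_nat.
suff h : u / n.+1%:R <= d%:R * (u - v).
  by apply: le_trans (lerD IH h) _; rewrite -mulrDr addrC subrK.
have e : u ^+ d - v ^+ d = 1 by rewrite !rootK -natr1 addrC addKr.
have en : n.+1%:R = u ^+ d by rewrite rootK.
rewrite ler_pdivrMr //; apply: (@le_trans _ _ (u * (u ^+ d - v ^+ d))).
  by rewrite e mulr1.
by apply: le_trans (ler_wpM2l u0 (exprB_le d v0 vu)) _; rewrite mulrCA -exprS prednK // en.
Qed.

End PartialSummation.

Section NormSums.
Variables (R : realType) (T : choiceType) (S : set T) (N : T -> nat).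
Hypothesis finS : forall n, finite_set [set p | S p /\ (N p <= n)%N].
Hypothesis N_gt1 : forall p, S p -> (1 < N p)%N.
Local Notation upto := (upto S N).

(** The fourth root. It dominates [ln] up to a constant but grows more slowly than the square root,
    so a sum with weights 1 / sqrt N that is of this order becomes bounded once the weights are 1 /
    N. *)
Definition qrt (k : nat) : R := Num.sqrt (Num.sqrt k%:R).

Lemma qrt_sqr k : qrt k ^+ 2 = Num.sqrt k%:R.
Proof. by rewrite sqr_sqrtr // sqrtr_ge0. Qed.

Lemma sqrt_sqr k : Num.sqrt k%:R ^+ 2 = k%:R :> R.
Proof. by rewrite sqr_sqrtr. Qed.

Lemma qrt_ge0 k : 0 <= qrt k. Proof. exact: sqrtr_ge0. Qed.

Lemma qrt_gt0 k : (0 < k)%N -> 0 < qrt k.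
Proof. by move=> k0; rewrite /qrt !sqrtr_gt0 ltr0n. Qed.

Lemma qrt_le k m : (k <= m)%N -> qrt k <= qrt m.
Proof. by move=> km; rewrite /qrt ler_wsqrtr // ler_wsqrtr // ler_nat. Qed.

Lemma qrt_ge1 k : (0 < k)%N -> 1 <= qrt k.
Proof. by move=> k0; rewrite /qrt -[leLHS]sqrtr1 ler_wsqrtr // -[leLHS]sqrtr1 ler_wsqrtr // ler1n. Qed.

Section BoundedByQrt.
Variables (f : T -> R) (C : R).
Hypothesis C0 : 0 <= C.
Hypothesis fC : forall n, (0 < n)%N ->
  `|\sum_(p <- upto n) f p / Num.sqrt (N p)%:R| <= C * qrt n.

Let F n := \sum_(p <- upto n) f p / Num.sqrt (N p)%:R.

Let F0 : F 0 = 0. Proof. by rewrite /F (upto0 finS N_gt1) big_seq_fset0. Qed.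

(** The boundary term contributes C. With a and c the fourth roots of consecutive integers, a (a^-2
    - c^-2) <= 2 (a^-1 - c^-1), so the remaining sum telescopes to at most 2 C. *)
Lemma sum_div_norm_le n : `|\sum_(p <- upto n) f p / (N p)%:R| <= 3 * C.
Proof.
have -> : \sum_(p <- upto n) f p / (N p)%:R =
    \sum_(p <- upto n) (f p / Num.sqrt (N p)%:R) * (Num.sqrt (N p)%:R)^-1.
  by apply: eq_bigr => p _; rewrite -mulrA -invfM -expr2 sqrt_sqr.
rewrite (partial_summation finS N_gt1 _ (fun k => (Num.sqrt k%:R)^-1)).
case: n => [|n]; first
  by rewrite (F0 : \sum_(p <- upto 0) _ = 0) mul0r big_ord0 addr0 normr0 mulr_ge0.
apply: le_trans (ler_normD _ _) _; rewrite big_ord_recl.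
rewrite (F0 : \sum_(p <- upto (nat_of_ord (@ord0 n))) _ = 0) mul0r add0r.
apply: (@le_trans _ _ (C + 2 * C)); last by lra.
have q1 := qrt_ge1 (ltn0Sn n); have q0 := qrt_gt0 (ltn0Sn n).
apply: lerD.
  rewrite normrM (ger0_norm (x := (Num.sqrt _)^-1)) ?invr_ge0 ?sqrtr_ge0 //.
  rewrite -qrt_sqr ler_pdivrMr ?exprn_gt0 //; apply: le_trans (fC (ltn0Sn n)) _.
  by rewrite ler_wpM2l // expr2 ler_peMl // ltW.
apply: (@le_trans _ _ (\sum_(k < n) 2 * C * ((qrt k.+1)^-1 - (qrt k.+2)^-1))).
  apply: le_trans (ler_norm_sum _ _ _) _; apply: ler_sum => k _; rewrite lift0.
  have a0 := qrt_gt0 (ltn0Sn k); have b0 := qrt_gt0 (ltn0Sn k.+1).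
  have ab := qrt_le (leqnSn k.+1); have := fC (ltn0Sn k).
  rewrite -!qrt_sqr; set a : R := qrt k.+1 in a0 ab *; set c : R := qrt k.+2 in b0 ab *.
  have ac : c^-1 <= a^-1 by rewrite lef_pV2.
  have c'0 : 0 < c^-1 by rewrite invr_gt0.
  have acd : a ^- 2 - c ^- 2 = (a^-1 - c^-1) * (a^-1 + c^-1) by rewrite -!exprVn; ring.
  rewrite normrM acd (ger0_norm (x := _ * _)) => [h|]; last first.
    by rewrite mulr_ge0 ?subr_ge0 ?addr_ge0 // ltW // invr_gt0.
  apply: (@le_trans _ _ (C * a * ((a^-1 - c^-1) * (a^-1 + c^-1)))).
    by apply: ler_wpM2r => //; rewrite mulr_ge0 ?subr_ge0 ?addr_ge0 // ltW // invr_gt0.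
  have -> : C * a * ((a^-1 - c^-1) * (a^-1 + c^-1)) =
    C * (a^-1 - c^-1) * (1 + a / c) by field; apply/andP; split; rewrite gt_eqF.
  rewrite [2 * C]mulrC -[leRHS]mulrA [2 * _]mulrC mulrA; apply: ler_wpM2l.
    by rewrite mulr_ge0 // subr_ge0.
  have : a / c <= 1 by rewrite ler_pdivrMr // mul1r.
  lra.
rewrite -mulr_sumr -[leRHS]mulr1 ler_wpM2l ?mulr_ge0 //.
have -> : \sum_(k < n) ((qrt k.+1)^-1 - (qrt k.+2)^-1) = 1 - (qrt n.+1)^-1 :> R.
  elim: n {q0 q1} => [|n IH]; first by rewrite big_ord0 /qrt !sqrtr1 invr1 subrr.
  by rewrite big_ord_recr /= IH addrA subrK.
by rewrite lerBlDr lerDl invr_ge0 ltW.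
Qed.

(** Partial summation in the other direction: the boundary term and the telescoping sum give C
    n^(3/4) each. *)
Lemma sum_norm_le n : `|\sum_(p <- upto n) f p| <= 2 * C * qrt n ^+ 3.
Proof.
have -> : \sum_(p <- upto n) f p =
    \sum_(p <- upto n) (f p / Num.sqrt (N p)%:R) * Num.sqrt (N p)%:R.
  rewrite big_seq [RHS]big_seq; apply: eq_bigr => p /(upto_gt1 finS N_gt1) h.
  by rewrite divfK // gt_eqF // sqrtr_gt0 ltr0n ltnW.
rewrite (partial_summation finS N_gt1 _ (fun k => Num.sqrt k%:R)).
case: n => [|n]; first
  by rewrite (F0 : \sum_(p <- upto 0) _ = 0) mul0r big_ord0 addr0 normr0
    mulr_ge0 ?exprn_ge0 ?qrt_ge0 // mulr_ge0.
apply: le_trans (ler_normD _ _) _.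
have q0 := qrt_gt0 (ltn0Sn n).
apply: (@le_trans _ _ (C * qrt n.+1 ^+ 3 + C * qrt n.+1 ^+ 3)); last by lra.
apply: lerD.
  rewrite normrM (ger0_norm (sqrtr_ge0 _)) -qrt_sqr [qrt n.+1 ^+ 3]exprS mulrA.
  by apply: ler_wpM2r; [exact: exprn_ge0 (ltW q0)|exact: fC].
apply: (@le_trans _ _ (\sum_(k < n.+1) C * qrt n.+1 * (Num.sqrt k.+1%:R - Num.sqrt k%:R))).
  apply: le_trans (ler_norm_sum _ _ _) _; apply: ler_sum => k _.
  rewrite normrM distrC (ger0_norm (x := _ - _)); last first.
    by rewrite subr_ge0 ler_wsqrtr // ler_nat.
  apply: ler_wpM2r; first by rewrite subr_ge0 ler_wsqrtr // ler_nat.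
  case: k => -[|k] kn /=; first by rewrite (F0 : \sum_(p <- upto 0) _ = 0) normr0 mulr_ge0 // ltW.
  apply: le_trans (fC (ltn0Sn k)) _; rewrite ler_wpM2l // qrt_le //.
  exact: ltnW.
rewrite -mulr_sumr.
have -> : \sum_(k < n.+1) (Num.sqrt k.+1%:R - Num.sqrt k%:R) = Num.sqrt n.+1%:R :> R.
  elim: n.+1 => [|m IH]; first by rewrite big_ord0 sqrtr0.
  by rewrite big_ord_recr /= IH addrC subrK.
by rewrite -qrt_sqr -mulrA -exprS.
Qed.

End BoundedByQrt.

End NormSums.

(** * Mertens' theorem *)

(* The size [sz] is a norm on [E] in which [O] is a lattice of rank [d], [Y]
   lists the radii at which lattice points are counted, and [z n] is an element
   of [O] so large that every [z n + x] with [sz x <= Y n] has norm of the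
   order of [Y n ^+ d]. *)
Record lattice_size (R : realType) (E : fieldType) (O : set E) (sz : E -> R)
    (d : nat) (Y : nat -> R) (z : nat -> E) (B C : R) : Prop := LatticeSize {
  ls_dim : (0 < d)%N;
  ls_B : 0 <= B;
  ls_C : 1 <= C;
  ls_0 : sz 0 = 0;
  ls_ge0 : forall x, 0 <= sz x;
  ls_N : forall x, sz (- x) = sz x;
  ls_D : forall x y, sz (x + y) <= sz x + sz y;
  ls_M : forall x y, sz (x * y) <= B * (sz x * sz y);
  ls_cobounded : forall x, exists2 y, O y & sz (x - y) <= C;
  ls_discrete : forall x, O x -> x != 0 -> 1 <= C * sz x;
  ls_finite : forall r, finite_set (ball_in sz O 0 r);
  ls_count_ub : forall r, 1 <= r -> (count_in sz O 0 r)%:R <= C * r ^+ d;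
  ls_count_lb : forall r, 0 <= r -> r ^+ d <= C * (count_in sz O 0 r)%:R;
  ls_count_reg : forall n r, 1 <= r -> (count_in sz O 0 (Y n + r))%:R <=
    (count_in sz O 0 (Y n - r))%:R + C * r * (Y n + r) ^+ d.-1;
  ls_Y1 : forall n, 1 <= Y n;
  ls_Ycofinal : forall r, 1 <= r -> exists n, r <= Y n <= C * r;
  ls_z : forall n, O (z n);
  ls_z_le : forall n, sz (z n) <= C * Y n;
  ls_z_ge : forall n x, (B + 1) * Y n * sz x <= sz (z n * x) }.

Section Mertens.
Variables (R : realType) (E : fieldType) (O : set E) (sz : E -> R) (d : nat).
Variables (Y : nat -> R) (z : nat -> E) (B C : R).
Hypothesis O1 : O 1.
Hypothesis OB : forall x y, O x -> O y -> O (x - y).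
Hypothesis OM : forall x y, O x -> O y -> O (x * y).
Hypothesis inv : forall I, fractional O I ->
  exists2 J, fractional O J & ideal_mul I J = O.
Hypothesis ls : lattice_size O sz d Y z B C.

Local Notation N := (ideal_norm O).
Local Notation cnt r := (count_in sz O 0 r)%:R.
Local Notation pow := (ideal_pow O).

Let sO := subring_subgroup O1 OB.
Let C0 : 0 < C. Proof. exact: lt_le_trans ltr01 (ls_C ls). Qed.
Let C0' : 0 <= C. Proof. exact: ltW. Qed.
Let B0 := ls_B ls.
Let d0 := ls_dim ls.
Let Y0 n : 0 < Y n. Proof. exact: lt_le_trans ltr01 (ls_Y1 ls n). Qed.
Let sz0 := ls_ge0 ls.

Lemma ball_finite x r : finite_set (ball_in sz O x r).
Proof.
apply: (ball_in_recenter (ls_D ls)); exact: ls_finite ls.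
Qed.

Lemma count_mono r s : r <= s -> cnt r <= cnt s :> R.
Proof.
move=> rs; rewrite ler_nat; apply: fsubset_leq_card.
rewrite -fset_set_sub; try exact: ball_finite.
exact: ball_in_sub.
Qed.

Lemma count_gt0 n : 0 < cnt (Y n) :> R.
Proof.
have := ls_count_lb ls (ltW (Y0 n)); have := exprn_gt0 d (Y0 n).
by move=> h1 h2; rewrite -(pmulr_rgt0 _ C0); apply: lt_le_trans h2.
Qed.

Lemma short_transversal I r : ideal O I ->
  (forall c, O c -> exists y, [/\ O y, I (c - y) & sz y <= r]) ->
  exists2 T, transversal O I T & forall t, t \in T -> sz t <= r.
Proof.
move=> [sI IO _] h.
have [| |x [] //|c Oc|T TT Tb] := @transversal_from_reps _ O I (ball_in sz O 0 r).
- exact: (submodule_subgroup O1 OB sI).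
- exact: ball_finite.
- by have [y [Oy Iy yr]] := h c Oc; exists y => //; split; rewrite ?subr0.
by exists T => // t /Tb[_]; rewrite subr0.
Qed.

(** Division with remainder up to a constant: the quotient c / a is rounded to O, and the remainder
    is a times the rounding error. *)
Lemma reduce_mod a c : a != 0 -> exists2 y, O y & sz (c - a * y) <= B * C * sz a.
Proof.
move=> a0; have [y Oy yC] := ls_cobounded ls (c / a); exists y => //.
have -> : c - a * y = a * (c / a - y) by field.
apply: le_trans (ls_M ls _ _) _; rewrite -mulrA ler_wpM2l // mulrC.
exact: ler_wpM2r.
Qed.

Lemma principal_short_transversal a : O a -> a != 0 ->
  exists2 T, transversal O (principal_ideal O a) T &
    forall t, t \in T -> sz t <= B * C * sz a.
Proof.
move=> Oa a0; apply: short_transversal; first exact: ideal_principal.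
move=> c Oc; have [y Oy yr] := reduce_mod c a0.
exists (c - a * y); split=> //; first by apply: OB => //; exact: OM.
by exists y => //; ring.
Qed.

Lemma fin_principal a : O a -> a != 0 ->
  exists T, transversal O (principal_ideal O a) T.
Proof.
by move=> Oa a0; have [T TT _] := principal_short_transversal Oa a0; exists T.
Qed.

Let fin := fin_principal.

Lemma norm_principal_le a : O a -> a != 0 ->
  (N (principal_ideal O a))%:R <= cnt (B * C * sz a) :> R.
Proof.
move=> Oa a0; have [T TT Tr] := principal_short_transversal Oa a0.
have [TO _ _] := TT.
rewrite (ideal_norm_card O1 OB (ideal_principal O1 OB OM Oa a0) TT) ler_nat.
rewrite /count_in; apply: fsubset_leq_card; apply/fsubsetP => t tT.
rewrite in_fset_set ?inE; last exact: ball_finite.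
by split; [exact: TO|rewrite subr0; exact: Tr].
Qed.

(** Two of the counted elements agree modulo I, and [a] is their difference. This has the role of
    Minkowski's theorem. *)
Lemma pigeonhole I r : ideal O I -> (N I)%:R < (cnt r : R) ->
  exists a, [/\ I a, a != 0 & sz a <= r + r].
Proof.
move=> iI; have [T TT] := ideal_transversal O1 OB fin iI.
have [sI IO _] := iI; have gI := submodule_subgroup O1 OB sI.
rewrite (ideal_norm_card O1 OB iI TT) ltr_nat ltnNge => /negP h.
apply: contrapT => nex; apply: h.
have [f fP] := transversal_rep TT.
rewrite /count_in -[X in (_ <= #|` X|)%N]set_fsetK.
apply: (@card_fset_set_inj _ _ _ _ f) => //; first exact: ball_finite.
  by move=> x [Ox _]; case: (fP x Ox).
move=> x y [Ox xr] [Oy yr] fxy; apply/eqP; rewrite -subr_eq0; apply/negPn/negP => xy.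
apply: nex; exists (x - y); split=> //.
  have [_ Ix] := fP x Ox; have [_ Iy] := fP y Oy.
  by apply: (subgroup_trans gI Ix); rewrite fxy; exact: subgroupBC.
apply: le_trans (ls_D ls _ _) _; rewrite (ls_N ls).
by rewrite !subr0 in xr yr; exact: lerD.
Qed.

Local Notation root n := (n%:R `^ (d%:R^-1)).

Lemma rootK n : root n ^+ d = n%:R :> R.
Proof.
rewrite -powR_mulrn ?powR_ge0 // -powRrM mulVf ?powRr1 //.
by rewrite pnatr_eq0 -lt0n.
Qed.

Lemma root_ge1 n : (0 < n)%N -> 1 <= root n :> R.
Proof.
move=> n0; rewrite leNgt; apply/negP => h.
have := exprn_ilt1 d (powR_ge0 _ _) h.
by rewrite rootK -lt0n d0 ltrn1 ltnNge n0.
Qed.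

(** I contains a nonzero element of size O(N(I)^(1/d)), and remainders modulo it have the same order
    of size. The radius 2 C N(I)^(1/d) in the proof makes the ball hold more than N(I) elements. *)
Lemma short_reps : exists2 D : R, 1 <= D & forall I, ideal O I ->
  exists2 T, transversal O I T & forall t, t \in T -> sz t <= D * root (N I).
Proof.
exists (B * C * (4 * C) + 1).
  by rewrite lerDr; rewrite !mulr_ge0.
move=> I iI; have N0 := ideal_norm_gt0 O1 OB fin iI.
have nu1 := root_ge1 N0; have nu0 : 0 <= root (N I) :> R by exact: powR_ge0.
have [|a [Ia a0 asz]] := @pigeonhole I (2 * C * root (N I)) iI.
  rewrite -(ltr_pM2l C0); apply: lt_le_trans (ls_count_lb ls _); last first.
    by rewrite !mulr_ge0.
  rewrite exprMn rootK ltr_pM2r ?ltr0n //.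
  apply: (@lt_le_trans _ _ (2 * C)); first by have := C0; lra.
  by rewrite -[leLHS]expr1 ler_eXn2l //; have := ls_C ls; lra.
apply: short_transversal => // c Oc.
have [sI IO _] := iI.
have [y Oy yr] := reduce_mod c a0; exists (c - a * y).
have Iay : I (a * y) by rewrite mulrC; case: sI => _ _; apply.
split.
- by apply: OB => //; exact: IO.
- by have -> : c - (c - a * y) = a * y by ring.
apply: le_trans yr _; apply: (@le_trans _ _ (B * C * (4 * C * root (N I)))).
  by apply: ler_wpM2l; [exact: mulr_ge0|lra].
lra.
Qed.

(* Every element of the n-th ball has norm at most [cN * Y n ^+ d]; the lock
   keeps [lra] and [ring] from expanding the constant. *)
Let cN : R := locked (C * (B * C * (C + 1) + 1) ^+ d).

Let cN_ge1 : 1 <= cN.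
Proof.
rewrite /cN -lock -[leLHS]mulr1; apply: ler_pM => //; first exact: ls_C ls.
by apply: exprn_ege1; rewrite lerDr !mulr_ge0 // addr_ge0.
Qed.
Let cN_gt0 : 0 < cN. Proof. exact: lt_le_trans ltr01 _. Qed.
Let cN_ge0 : 0 <= cN. Proof. exact: ltW. Qed.

Local Notation ball n := (ball_in sz O (z n) (Y n)).

(** In x w = z w + (x - z) w the first term has size at least (B + 1) Y sz w and the second at most
    B Y sz w; this is the purpose of the factor B + 1 in [ls_z_ge]. *)
Lemma ball_expand n x w : ball n x -> Y n * sz w <= sz (x * w).
Proof.
move=> [Ox xz]; have := ls_z_ge ls n w.
have -> : z n * w = x * w + - ((x - z n) * w) by ring.
move=> h; have := le_trans h (ls_D ls _ _); rewrite (ls_N ls).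
have := ls_M ls (x - z n) w.
have : B * (sz (x - z n) * sz w) <= B * (Y n * sz w).
  by apply: ler_wpM2l => //; apply: ler_wpM2r.
lra.
Qed.

Lemma ball_neq0 n x : ball n x -> x != 0.
Proof.
move=> bx; apply/eqP => x0; have := ball_expand 1 bx.
rewrite x0 mul0r (ls_0 ls) => h.
have s1 := ls_discrete ls O1 (oner_neq0 _).
have s0 : 0 < sz 1 by rewrite -(pmulr_rgt0 _ C0); apply: lt_le_trans s1.
by have := lt_le_trans (mulr_gt0 (Y0 n) s0) h; rewrite ltxx.
Qed.

(** Origin of [cN]: x has size at most (C + 1) Y, remainders modulo x have size at most B C (C + 1)
    Y, and the added 1 keeps the radius at least 1, as [ls_count_ub] asks. *)
Lemma ball_norm_ub n x : ball n x -> (N (principal_ideal O x))%:R <= cN * Y n ^+ d.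
Proof.
move=> bx; have [Ox xz] := bx; apply: le_trans (norm_principal_le Ox (ball_neq0 bx)) _.
have szx : sz x <= (C + 1) * Y n.
  rewrite -(subrK (z n) x); apply: le_trans (ls_D ls _ _) _.
  by have := ls_z_le ls n; lra.
rewrite /cN -lock -[leRHS]mulrA -exprMn; apply: le_trans (ls_count_ub ls _).
  apply: count_mono; apply: (@le_trans _ _ (B * C * ((C + 1) * Y n))).
    by apply: ler_wpM2l => //; exact: mulr_ge0.
  by rewrite [leRHS]mulrDl mul1r mulrA lerDl ltW.
rewrite mulrDl mul1r -[leLHS]add0r; apply: lerD; last exact: (ls_Y1 ls).
by rewrite !mulr_ge0 ?addr_ge0 // ltW.
Qed.

(** A norm below the number of elements of size at most r = Y / (3 C) would produce a nonzero
    multiple x w of size at most 2 r, while [ball_expand] and discreteness give it size at least Y /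
    C. *)
Lemma ball_norm_lb : exists2 c : R, 1 <= c &
  forall n x, ball n x -> Y n ^+ d <= c * (N (principal_ideal O x))%:R.
Proof.
have C3 : 1 <= 3 * C by have := ls_C ls; lra.
exists (C * (3 * C) ^+ d).
  by rewrite -[leLHS]mulr1; apply: ler_pM => //; [exact: ls_C ls|exact: exprn_ege1].
move=> n x bx; have x0 := ball_neq0 bx; have [Ox _] := bx.
pose r := Y n / (3 * C).
have r0 : 0 <= r by rewrite divr_ge0 // ?ltW // mulr_gt0.
have ix := ideal_principal O1 OB OM Ox x0.
suff h : cnt r <= (N (principal_ideal O x))%:R :> R.
  have -> : Y n = (3 * C) * r by rewrite /r mulrC divfK // gt_eqF // mulr_gt0.
  rewrite exprMn [C * _]mulrC -mulrA; apply: ler_wpM2l.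
    by apply: exprn_ge0; apply: ltW; exact: mulr_gt0.
  by apply: le_trans (ls_count_lb ls r0) _; exact: ler_wpM2l.
rewrite leNgt; apply/negP => /(pigeonhole ix)[_ [[w Ow <-] xw0 szxw]].
have w0 : w != 0 by apply: contra_neq xw0 => ->; rewrite mulr0.
have h1 := ls_discrete ls Ow w0; have h2 := ball_expand w bx.
have h3 : Y n * 1 <= Y n * (C * sz w) by rewrite ler_pM2l.
have h4 : C * (Y n * sz w) <= C * (r + r).
  by rewrite ler_pM2l //; apply: le_trans szxw.
have h5 : C * r = Y n / 3 by rewrite /r; field; rewrite gt_eqF.
have := Y0 n; lra.
Qed.

Lemma root_le n m : m%:R <= cN * Y n ^+ d -> root m <= cN * Y n.
Proof.
move=> h; have cY : 0 <= cN * Y n by apply: mulr_ge0; exact: ltW.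
rewrite -(ler_pXn2r d0) ?nnegrE ?powR_ge0 //.
rewrite rootK exprMn; apply: le_trans h _; apply: ler_wpM2r.
  by rewrite exprn_ge0 // ltW.
by rewrite -[leLHS]expr1; apply: ler_weXn2l.
Qed.

(** Representatives of O/I of size at most r = O(N(I)^(1/d)) change the radius by r, so the error is
    the number of points in a shell of thickness r. The bound on N(I) keeps r within a constant
    times Y. *)
Lemma count_ideal : exists2 K : R, 1 <= K & forall n I, ideal O I ->
  (N I)%:R <= cN * Y n ^+ d ->
  `|(N I)%:R * (count_in sz I (z n) (Y n))%:R - cnt (Y n)| <=
    K * root (N I) * Y n ^+ d.-1.
Proof.
have [D D1 Dt] := short_reps; have D0 : 0 <= D := le_trans ler01 D1.
exists (C * D * (1 + D * cN) ^+ d.-1).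
  rewrite -[leLHS]mulr1; apply: ler_pM => //.
    by rewrite -[leLHS]mulr1; apply: ler_pM => //; exact: ls_C ls.
  by apply: exprn_ege1; rewrite lerDl mulr_ge0 // ltW.
move=> n I iI NI; have [T TT Tr] := Dt I iI.
have N0 := ideal_norm_gt0 O1 OB fin iI.
have nu1 := root_ge1 N0; set nu : R := root (N I) in nu1 Tr *.
have nu0 : 0 <= nu := le_trans ler01 nu1.
have nuY : nu <= cN * Y n := root_le NI.
have [sI IO _] := iI; have gI := submodule_subgroup O1 OB sI.
pose r := D * nu.
have r1 : 1 <= r by rewrite /r -[leLHS]mulr1; apply: ler_pM.
have shift s : count_in sz O (z n) s = count_in sz O 0 s.
  exact: (count_in_shift sO ball_finite s (ls_z ls n)).
have eT := ideal_norm_card O1 OB iI TT.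
have up : (N I)%:R * (count_in sz I (z n) (Y n))%:R <= cnt (Y n + r) :> R.
  rewrite -natrM ler_nat -shift eT.
  exact: (count_in_mul_le (ls_D ls) sO gI IO ball_finite TT Tr).
have lo : cnt (Y n - r) <= (N I)%:R * (count_in sz I (z n) (Y n))%:R :> R.
  rewrite -natrM ler_nat -shift eT -{2}(subrK r (Y n)).
  exact: (count_in_le_mul (ls_D ls) (ls_N ls) IO ball_finite TT Tr).
have reg := ls_count_reg ls n r1.
have m1 : cnt (Y n) <= cnt (Y n + r) :> R by apply: count_mono; lra.
have m2 : cnt (Y n - r) <= cnt (Y n) :> R by apply: count_mono; lra.
suff : C * r * (Y n + r) ^+ d.-1 <= C * D * (1 + D * cN) ^+ d.-1 * nu * Y n ^+ d.-1.
  by move=> h; rewrite ler_norml; apply/andP; split; lra.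
have -> : C * D * (1 + D * cN) ^+ d.-1 * nu * Y n ^+ d.-1 =
          C * r * ((1 + D * cN) * Y n) ^+ d.-1 by rewrite exprMn /r; ring.
apply: ler_wpM2l; first by rewrite mulr_ge0 // (le_trans ler01).
have Yr : Y n + r <= (1 + D * cN) * Y n.
  by rewrite mulrDl mul1r lerD2l /r -mulrA ler_wpM2l.
have Yr0 : 0 <= Y n + r by have := Y0 n; lra.
by apply: lerXn2r; rewrite ?nnegrE //; exact: le_trans Yr.
Qed.

Variable Cp : R.
Hypothesis Cp_ge1 : 1 <= Cp.
(** An analogue of the primorial. It yields the finiteness of the set of primes of bounded norm and
    Chebyshev's upper bound [theta_le]. *)
Hypothesis prime_product : forall m, exists a, [/\ O a, a != 0,
    sz a <= Cp * expR (Cp * m%:R)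
  & forall p, prime_ideal O p -> (N p <= m)%N -> p a].

Lemma prime_product_factorization m : exists a s,
  [/\ O a, a != 0, sz a <= Cp * expR (Cp * m%:R),
      N (principal_ideal O a) = (\prod_(p <- s) N p)%N /\
      (forall p, p \in s -> prime_ideal O p)
    & forall p, prime_ideal O p -> (N p <= m)%N -> p \in s].
Proof.
have [a [Oa a0 az ap]] := prime_product m.
have [s [ps Ns cs]] := principal_factorization O1 OB OM inv fin Oa a0.
exists a, s; split=> // p pp Np.
rewrite -has_pred1 has_count -(cs p 1%N pp) /=.
have ip := ideal_prime pp; have [sp _ _] := ip.
rewrite ideal_mulC (ideal_mul1 O1) //; exact: ap.
Qed.

Lemma finite_primes m : finite_set [set p | prime_ideal O p /\ (N p <= m)%N].
Proof.
have [a [s [_ _ _ _ h]]] := prime_product_factorization m.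
by apply: (@sub_finite_set _ _ [set` s]) (finite_seq s) => p [pp Np]; exact: h.
Qed.

Lemma norm_gt1 p : prime_ideal O p -> (1 < N p)%N.
Proof. exact: (prime_norm_gt1 O1 OB OM fin). Qed.

Local Notation primes := (upto (prime_ideal O) N).
Let in_primes m p : (p \in primes m) <-> prime_ideal O p /\ (N p <= m)%N.
Proof. exact: (in_upto finite_primes). Qed.

Lemma ln_norm_ge0 p : prime_ideal O p -> 0 <= ln (N p)%:R :> R.
Proof. by move=> /norm_gt1 h; apply: ln_ge0; rewrite ler1n ltnW. Qed.

Lemma ln_prod_nat (I : eqType) (s : seq I) (F : I -> nat) :
  (forall i, i \in s -> (0 < F i)%N) ->
  ln (\prod_(i <- s) F i)%N%:R = \sum_(i <- s) ln (F i)%:R :> R.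
Proof.
elim: s => [_|i s IH F0]; first by rewrite !big_nil ln1.
rewrite !big_cons natrM lnM ?posrE ?ltr0n ?IH //.
- by move=> j js; apply: F0; rewrite in_cons js orbT.
- by apply: F0; rewrite mem_head.
rewrite big_seq; apply: prodn_cond_gt0 => j js; apply: F0.
by rewrite in_cons js orbT.
Qed.

Lemma leq_norm_principal I a : ideal O I -> O a -> a != 0 -> I a ->
  (N I <= N (principal_ideal O a))%N.
Proof.
move=> iI Oa a0 Ia; have ia := ideal_principal O1 OB OM Oa a0; have [sI IO _] := iI.
have aI := principal_ideal_sub sI Ia.
have [Iaa|/existsNP[x /not_implyP[Ix nax]]] := pselect (I `<=` principal_ideal O a).
  by have -> : I = principal_ideal O a by apply/seteqP; split.
exact/ltnW/(ideal_norm_lt O1 OB fin ia iI aI Ix nax).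
Qed.

Lemma sum_seq_count (T : choiceType) (P : {fset T}) (s : seq T) (F : T -> R) :
  {subset s <= P} -> \sum_(p <- s) F p = \sum_(p <- P) (count_mem p s)%:R * F p.
Proof.
elim: s => [_|x s IH sP]; first by rewrite big_nil big1 // => p _; rewrite mul0r.
have sP' : {subset s <= P} by move=> y ys; apply: sP; rewrite in_cons ys orbT.
have xP : x \in P by apply: sP; rewrite mem_head.
rewrite big_cons IH //=; under [RHS]eq_bigr do rewrite natrD mulrDl.
rewrite big_split /=; congr (_ + _).
rewrite (big_fsetD1 x) //= eqxx mul1r big_seq big1 ?addr0 // => p.
by rewrite in_fsetD1 eq_sym => /andP[/negPf ->]; rewrite mul0r.
Qed.

Lemma sum_count_seq (s : seq (set E)) m :
  (forall p, p \in s -> prime_ideal O p) -> (\prod_(p <- s) N p <= m)%N ->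
  {subset s <= primes m} /\ (size s <= m)%N.
Proof.
move=> ps sm; split=> [p sp|].
  apply/in_primes; split; [exact: ps|apply: leq_trans sm].
  apply: dvdn_leq; last by rewrite (big_rem p) //= dvdn_mulr.
  by rewrite big_seq; apply: prodn_cond_gt0 => q /ps/norm_gt1/ltnW.
apply: leq_trans sm; elim: s ps => [|p s IH] ps; first by rewrite big_nil.
rewrite big_cons /=.
have h : (size s <= \prod_(q <- s) N q)%N.
  by apply: IH => q qs; apply: ps; rewrite in_cons qs orbT.
have h0 : (0 < \prod_(q <- s) N q)%N.
  rewrite big_seq; apply: prodn_cond_gt0 => q qs.
  by apply/ltnW/norm_gt1/ps; rewrite in_cons qs orbT.
have := norm_gt1 (ps p (mem_head _ _)); nia.
Qed.

(** All primes of norm at most m divide the element a of [prime_product], so the sum is at most ln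
    N(a), and N(a) is at most C r^d with r = c exp(Cp m). For m >= 1 the constants ln C and ln c are
    absorbed by the factor m. *)
Lemma theta_le : exists2 K : R, 0 <= K & forall m,
  \sum_(p <- primes m) ln (N p)%:R <= K * m%:R :> R.
Proof.
have Cp0 : 0 <= Cp := le_trans ler01 Cp_ge1.
pose c := B * C * Cp + 1; have c1 : 1 <= c by rewrite lerDr !mulr_ge0.
have c0 : 0 < c := lt_le_trans ltr01 c1.
have lc0 : 0 <= ln c :> R by exact: ln_ge0.
have lC0 : 0 <= ln C :> R by apply: ln_ge0; exact: ls_C ls.
exists (ln C + d%:R * (ln c + Cp)).
  by rewrite !(addr_ge0, mulr_ge0).
case=> [|m]; first by rewrite (upto0 finite_primes norm_gt1) big_seq_fset0 mulr0.
have [a [s [Oa a0 az [Ns ps] h]]] := prime_product_factorization m.+1.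
have s0 p : p \in s -> (0 < N p)%N by move=> /ps /norm_gt1; exact: ltnW.
apply: (@le_trans _ _ (ln (N (principal_ideal O a))%:R)).
  (* A range that holds all factors of [a] as well as all primes of norm at most [m.+1]. *)
  pose M := (m.+1 + \prod_(p <- s) N p)%N.
  have [sM _] := sum_count_seq ps (leq_addl m.+1 _).
  rewrite Ns ln_prod_nat // (sum_seq_count _ sM) -subr_ge0.
  have := upto_sumB finite_primes (fun p => (count_mem p s)%:R * ln (N p)%:R : R)
    (leq_addr (\prod_(p <- s) N p) m.+1).
  move=> /eqP; rewrite subr_eq => /eqP ->; rewrite -addrA addr_ge0 //.
    by rewrite big_seq_cond; apply: sumr_ge0 => p /andP[/in_primes[pp _] _];
       rewrite mulr_ge0 // ln_norm_ge0.
  rewrite subr_ge0 big_seq [leRHS]big_seq; apply: ler_sum => p /in_primes[pp pm].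
  rewrite -[leLHS]mul1r; apply: ler_wpM2r; first exact: ln_norm_ge0.
  by rewrite ler1n -has_count has_pred1; exact: h.
pose r := c * expR (Cp * m.+1%:R).
have e1 : 1 <= expR (Cp * m.+1%:R) by rewrite -[leLHS]expR0 ler_expR mulr_ge0.
have r1 : 1 <= r by rewrite /r -[leLHS]mulr1; apply: ler_pM.
have r0 : 0 < r := lt_le_trans ltr01 r1.
have Nr : (N (principal_ideal O a))%:R <= C * r ^+ d.
  apply: le_trans (norm_principal_le Oa a0) _; apply: le_trans (ls_count_ub ls r1).
  apply: count_mono; apply: (@le_trans _ _ (B * C * (Cp * expR (Cp * m.+1%:R)))).
    by apply: ler_wpM2l => //; exact: mulr_ge0.
  by rewrite mulrA ler_wpM2r ?expR_ge0 // lerDl.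
have ia := ideal_principal O1 OB OM Oa a0.
have N0 : (0 : R) < (N (principal_ideal O a))%:R.
  by rewrite ltr0n; exact: (ideal_norm_gt0 O1 OB fin ia).
apply: (@le_trans _ _ (ln (C * r ^+ d))).
  by rewrite ler_ln ?posrE // mulr_gt0 // exprn_gt0.
rewrite lnM ?posrE ?exprn_gt0 // lnXn // /r lnM ?posrE ?expR_gt0 // expRK.
rewrite -[_ *+ d]mulr_natl.
have m1 : 1 <= m.+1%:R :> R by rewrite ler1n.
have l1 : ln C <= ln C * m.+1%:R by rewrite ler_peMr.
have l2 : d%:R * ln c <= d%:R * ln c * m.+1%:R by rewrite ler_peMr ?mulr_ge0.
have -> : (ln C + d%:R * (ln c + Cp)) * m.+1%:R =
  ln C * m.+1%:R + d%:R * ln c * m.+1%:R + d%:R * (Cp * m.+1%:R) by ring.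
rewrite mulrDr; lra.
Qed.

Lemma sum_ltn c m : (c <= m)%N -> \sum_(k < m) ((k < c)%N)%:R = c%:R :> R.
Proof.
move=> cm; rewrite -natr_sum; congr _%:R.
rewrite -(big_mkord xpredT (fun k => (k < c)%N : nat)) (big_cat_nat (n := c)) //=.
rewrite -[RHS]addn0; congr (_ + _)%N.
  by rewrite big_nat (eq_bigr (fun=> 1%N)) -?big_nat ?sum_nat_const_nat ?subn0 ?muln1 // => k /andP[_ ->].
by rewrite big_nat big1 // => k /andP[ck _]; rewrite ltnNge ck.
Qed.

(** Legendre's formula for ln N(a). Exponents up to m suffice: every prime factor has norm at least
    2, so (a) has at most m of them. *)
Lemma ln_norm_principal a m : O a -> a != 0 -> (N (principal_ideal O a) <= m)%N ->
  ln (N (principal_ideal O a))%:R =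
  \sum_(p <- primes m) \sum_(k < m) `[< pow p k.+1 a >]%:R * ln (N p)%:R :> R.
Proof.
move=> Oa a0; have [s [ps -> cs]] := principal_factorization O1 OB OM inv fin Oa a0.
move=> sm; have [sP ssz] := sum_count_seq ps sm.
rewrite ln_prod_nat; last by move=> p /ps/norm_gt1/ltnW.
rewrite (sum_seq_count _ sP) big_seq [RHS]big_seq; apply: eq_bigr => p /in_primes[pp _].
rewrite -mulr_suml -(@sum_ltn (count_mem p s) m); last first.
  by apply: leq_trans ssz; exact: count_size.
congr (_ * _); apply: eq_bigr => k _; congr (nat_of_bool _)%:R.
by apply/idP/asboolP => h; apply/(cs _ _ pp).
Qed.

Lemma sum_count_in n I : I `<=` O ->
  \sum_(x <- fset_set (ball n)) `[< I x >]%:R = (count_in sz I (z n) (Y n))%:R :> R.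
Proof.
move=> IO; rewrite -natr_sum -big_mkcond /= sum1_count -size_filter; congr _%:R.
apply: perm_size; apply: uniq_perm.
- exact/filter_uniq/fset_uniq.
- exact: fset_uniq.
move=> x; rewrite mem_filter !in_fset_set; try exact: ball_finite.
  by apply/andP/idP => [[/asboolP Ix /set_mem[Ox xz]]|/set_mem[Ix xz]];
    [apply/mem_set|split; [exact/asboolP|apply/mem_set; split=> //; exact: IO]].
by apply: sub_finite_set (ball_finite (z n) (Y n)) => y [/IO].
Qed.

Local Notation cpow n p k := (count_in sz (pow p k) (z n) (Y n))%:R.
Local Notation M n := (cnt (Y n)).

Lemma Yd_le n : Y n * Y n ^+ d.-1 <= C * M n.
Proof. by rewrite -exprS prednK //; exact: (ls_count_lb ls (ltW (Y0 n))). Qed.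

(** For N(p^k) at most cN Y^d this follows from [count_ideal]. Beyond that no element of the ball
    lies in p^k, because its norm would be at least N(p^k). *)
Lemma count_pow_ub : exists2 c : R, 0 <= c & forall n p k, prime_ideal O p ->
  (N p)%:R ^+ k * cpow n p k <= c * M n.
Proof.
have [K K1 Kc] := count_ideal; have K0 : 0 <= K := le_trans ler01 K1.
exists (1 + K * cN * C); first by rewrite !(addr_ge0, mulr_ge0).
move=> n p k pp; have M0 := count_gt0 n.
have ipk := ideal_powP O1 OB OM k (ideal_prime pp).
have Npk : N (pow p k) = (N p ^ k)%N := ideal_norm_pow O1 OB OM inv fin k pp.
have [h|h] := leP (N (pow p k))%:R (cN * Y n ^+ d).
  have := Kc n _ ipk h; rewrite ler_norml => /andP[_ h2].
  have h3 := root_le h.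
  have h4 : K * root (N (pow p k)) * Y n ^+ d.-1 <= K * cN * (C * M n).
    apply: (@le_trans _ _ (K * cN * (Y n * Y n ^+ d.-1))); last first.
      by apply: ler_wpM2l (Yd_le n); rewrite mulr_ge0 // ltW.
    rewrite -!mulrA; apply: ler_wpM2l => //; rewrite !mulrA; apply: ler_wpM2r => //.
    by rewrite exprn_ge0 // ltW.
  by rewrite -natrX -Npk; lra.
suff -> : count_in sz (pow p k) (z n) (Y n) = 0%N.
  by rewrite mulr0 !(addr_ge0, mulr_ge0).
apply/eqP; rewrite /count_in cardfs_eq0 -fset_set0; apply/eqP; congr fset_set.
apply/seteqP; split=> // x [px xz]; have [_ pO _] := ipk.
have bx : ball n x by split=> //; exact: pO.
have := ball_norm_ub bx; rewrite leNgt => /negP; apply; apply: lt_le_trans h _.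
by rewrite ler_nat; apply: leq_norm_principal => //; [exact: pO|exact: ball_neq0 bx].
Qed.

Lemma geometric_le (x : R) m : 0 <= x -> x <= 2^-1 -> \sum_(k < m) x ^+ k <= 2.
Proof.
move=> x0 x2; have := subrX1 x m; set s := \sum_(k < m) _ => e.
have s0 : 0 <= s by apply: sumr_ge0 => k _; exact: exprn_ge0.
have := exprn_ge0 m x0.
have : 2^-1 * s <= (1 - x) * s by apply: ler_wpM2r => //; lra.
lra.
Qed.

(** Only k = 1 needs the main term of [count_ideal]; from p^2 on, [count_pow_ub] bounds the terms by
    a geometric series of ratio at most 1/2. *)
Lemma count_pow_sum : exists2 K : R, 0 <= K & forall n p m, prime_ideal O p ->
  (N p <= m)%N -> m%:R <= cN * Y n ^+ d ->
  `|(\sum_(k < m) cpow n p k.+1) - M n / (N p)%:R| <=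
  K * (root (N p) / (N p)%:R * Y n ^+ d.-1 + M n * (N p)%:R ^- 2).
Proof.
have [K1 K11 K1c] := count_ideal; have K10 : 0 <= K1 := le_trans ler01 K11.
have [K2 K20 K2c] := count_pow_ub.
exists (K1 + 2 * K2); first by rewrite addr_ge0 // mulr_ge0.
move=> n p m pp pm mc; have M0 := count_gt0 n; have N1 := norm_gt1 pp.
have Nc : (N p)%:R <= cN * Y n ^+ d by apply: le_trans mc; rewrite ler_nat.
have ip := ideal_prime pp.
have p1 : pow p 1 = p.
  by rewrite /= ideal_mulC (ideal_mul1 O1) //; case: ip.
have N0 : 0 < (N p)%:R :> R by rewrite ltr0n ltnW.
set q : R := (N p)%:R in N0 Nc *.
case: m pm mc => [|m] pm mc; first by have := leq_trans N1 pm.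
rewrite big_ord_recl (p1 : pow p (@ord0 m).+1 = p).
have h1 : `|(count_in sz p (z n) (Y n))%:R - M n / q| <= K1 * (root (N p) / q * Y n ^+ d.-1).
  have := K1c n p ip Nc; rewrite -/q => h.
  have -> : (count_in sz p (z n) (Y n))%:R - M n / q =
     q^-1 * (q * (count_in sz p (z n) (Y n))%:R - M n) by field; rewrite gt_eqF.
  have q'0 : 0 <= q^-1 by rewrite invr_ge0 ltW.
  rewrite normrM (ger0_norm q'0).
  have -> : K1 * (root (N p) / q * Y n ^+ d.-1) = q^-1 * (K1 * root (N p) * Y n ^+ d.-1) by ring.
  exact: ler_wpM2l.
have h2 : `|\sum_(k < m) cpow n p (lift ord0 k).+1| <= 2 * K2 * (M n * q ^- 2).
  rewrite ger0_norm ?sumr_ge0 //.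
  apply: (@le_trans _ _ (\sum_(k < m) K2 * M n * q ^- 2 * q^-1 ^+ k)).
    apply: ler_sum => k _; rewrite lift0; have := K2c n p k.+2 pp; rewrite -/q => h.
    rewrite -[leLHS](mulKf (x := q ^+ k.+2)) ?expf_neq0 ?gt_eqF //.
    have -> : K2 * M n * q ^- 2 * q^-1 ^+ k = (q ^+ k.+2)^-1 * (K2 * M n).
      by rewrite -(addn2 k) exprD exprVn [(q ^+ k * _)^-1]invfM [RHS]mulrC [X in _ = _ * X]mulrC mulrA.
    by apply: ler_wpM2l => //; rewrite invr_ge0 exprn_ge0 // ltW.
  rewrite -mulr_sumr.
  have -> : 2 * K2 * (M n * q ^- 2) = K2 * M n * q ^- 2 * 2 by ring.
  apply: ler_wpM2l.
    by rewrite !mulr_ge0 ?invr_ge0 ?exprn_ge0 // ltW.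
  apply: geometric_le; first by rewrite invr_ge0 ltW.
  by rewrite lef_pV2 ?posrE // ler_nat.
rewrite addrAC; apply: le_trans (ler_normD _ _) _.
apply: le_trans (lerD h1 h2) _.
set u := root (N p) / q * _; set v := M n * _.
have u0 : 0 <= u.
  by rewrite !mulr_ge0 ?powR_ge0 ?invr_ge0 ?exprn_ge0 // ltW.
have v0 : 0 <= v by rewrite mulr_ge0 ?invr_ge0 ?exprn_ge0 // ltW.
have := mulr_ge0 K10 v0; have := mulr_ge0 K20 u0; lra.
Qed.

Lemma root_div_decr k : (0 < k)%N ->
  root k.+1 / k.+1%:R <= root k / k%:R :> R.
Proof.
move=> k0; have h j : (0 < j)%N -> root j / j%:R = (root j ^+ d.-1)^-1 :> R.
  move=> j0; rewrite -[X in _ / X]rootK -[X in _ / _ ^+ X](prednK d0) exprS invfM mulrA mulfV ?mul1r //.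
  by rewrite gt_eqF //; exact: lt_le_trans ltr01 (root_ge1 j0).
have r0 j : (0 < j)%N -> 0 < root j :> R by move=> /root_ge1; exact: lt_le_trans.
rewrite !h // lef_pV2 ?posrE ?exprn_gt0 ?r0 //; apply: lerXn2r; rewrite ?nnegrE ?powR_ge0 //.
by apply: ge0_ler_powR; rewrite ?invr_ge0 ?nnegrE // ler_nat.
Qed.

(** The sum T of ln N(x) over the ball plays the part of ln n! in the classical proof. It is M (d ln
    Y + O(1)) because all N(x) are of order Y^d, and by Legendre's formula and the count of each p^k
    it is also M times the sum of ln N(p) / N(p), up to O(M). *)
Lemma mertens_balls : exists2 K : R, 0 <= K & forall n m,
  m = Num.truncn (cN * Y n ^+ d) ->
  `|\sum_(p <- primes m) ln (N p)%:R / (N p)%:R - d%:R * ln (Y n)| <= K.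
Proof.
have [c c1 clb] := ball_norm_lb; have c0 : 0 < c := lt_le_trans ltr01 c1.
have [K K0 Ks] := count_pow_sum; have [Kt Kt0 th] := theta_le.
have lc0 : 0 <= ln c by exact: ln_ge0.
have lc9 : 0 <= ln cN by exact: ln_ge0.
exists (ln c + ln cN + K * (Kt * (d%:R * cN) * C + Kt * 2)).
  by rewrite !(addr_ge0, mulr_ge0).
move=> n m em; have M0 := count_gt0 n; have Yn := Y0 n.
have Yd0 : 0 < Y n ^+ d by exact: exprn_gt0.
have X0 : 0 <= cN * Y n ^+ d by rewrite mulr_ge0 // ltW.
have mX : m%:R <= cN * Y n ^+ d by rewrite em truncn_le.
pose A := fset_set (ball n).
have AP x : (x \in A) -> ball n x.
  by rewrite in_fset_set; [exact: set_mem|exact: ball_finite].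
have cA : \sum_(x <- A) 1 = M n :> R.
  rewrite -(count_in_shift sO ball_finite (Y n) (ls_z ls n)).
  transitivity (\sum_(x <- A) `[< O x >]%:R : R); last exact: sum_count_in.
  by rewrite [RHS]big_seq big_seq; apply: eq_bigr => x /AP[Ox _]; rewrite asboolT.
pose T := \sum_(x <- A) ln (N (principal_ideal O x))%:R : R.
have T1 : `|T - M n * (d%:R * ln (Y n))| <= M n * (ln c + ln cN).
  rewrite -cA !mulr_suml /T -sumrB; apply: le_trans (ler_norm_sum _ _ _) _.
  rewrite big_seq [leRHS]big_seq; apply: ler_sum => x /AP bx; rewrite !mul1r.
  have [Ox _] := bx; have x0 := ball_neq0 bx.
  have N0 : (0 : R) < (N (principal_ideal O x))%:R.
    by rewrite ltr0n; exact/(ideal_norm_gt0 O1 OB fin)/(ideal_principal O1 OB OM).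
  have up := ball_norm_ub bx; have lo := clb n x bx.
  rewrite -ler_ln ?posrE ?mulr_gt0 // lnM ?posrE // lnXn // -(mulr_natl (ln (Y n))) in up.
  rewrite -ler_ln ?posrE ?mulr_gt0 // lnM ?posrE // lnXn // -(mulr_natl (ln (Y n))) in lo.
  by rewrite ler_norml; apply/andP; split; lra.
have T2 : T = \sum_(p <- primes m) (\sum_(k < m) cpow n p k.+1) * ln (N p)%:R.
  rewrite /T big_seq; transitivity (\sum_(x <- A) \sum_(p <- primes m)
      \sum_(k < m) `[< pow p k.+1 x >]%:R * ln (N p)%:R : R).
    rewrite [RHS]big_seq; apply: eq_bigr => x /AP bx; have [Ox _] := bx.
    apply: ln_norm_principal => //; first exact: ball_neq0 bx.
    by rewrite em truncn_ge_nat //; exact: ball_norm_ub bx.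
  rewrite exchange_big big_seq [RHS]big_seq; apply: eq_bigr => p /in_primes[pp _].
  rewrite exchange_big mulr_suml; apply: eq_bigr => k _; rewrite -mulr_suml.
  rewrite sum_count_in //.
  by case: (ideal_powP O1 OB OM k.+1 (ideal_prime pp)).
(* Summed over p, the boundary errors of [count_pow_sum] stay O(Y^d): Chebyshev's bound gives
   O(m^(1/d)) here, and m^(1/d) is O(Y). *)
have sroot : \sum_(p <- primes m) ln (N p)%:R * (root (N p) / (N p)%:R) <=
    Kt * (d%:R * cN * Y n) :> R.
  apply: (@le_trans _ _ (Kt * (d%:R * root m))).
    apply: le_trans (sum_le_of_linear finite_primes norm_gt1 (g := fun k => root k / k%:R) th _ _) _.
    - exact: root_div_decr.
    - by rewrite mulr_ge0 ?invr_ge0 // powR_ge0.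
    - by apply: ler_wpM2l => //; exact: sum_root_le.
  by apply: ler_wpM2l => //; rewrite -mulrA; apply: ler_wpM2l => //; exact: root_le.
have ssqr : \sum_(p <- primes m) ln (N p)%:R * (N p)%:R ^- 2 <= Kt * 2 :> R.
  apply: le_trans (sum_le_of_linear finite_primes norm_gt1 (g := fun k => k%:R ^- 2) th _ _) _.
  - by move=> k k0; rewrite lef_pV2 ?posrE ?exprn_gt0 ?ltr0n // lerXn2r ?nnegrE // ler_nat.
  - by rewrite invr_ge0 exprn_ge0.
  - by apply: ler_wpM2l => //; exact: sum_inv_sqr_le.
have T3 : `|T - M n * \sum_(p <- primes m) ln (N p)%:R / (N p)%:R| <=
    M n * (K * (Kt * (d%:R * cN) * C + Kt * 2)).
  rewrite T2 mulr_sumr -sumrB; apply: le_trans (ler_norm_sum _ _ _) _.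
  apply: (@le_trans _ _ (\sum_(p <- primes m) K *
     (ln (N p)%:R * (root (N p) / (N p)%:R) * Y n ^+ d.-1 +
      M n * (ln (N p)%:R * (N p)%:R ^- 2)))).
    rewrite big_seq [leRHS]big_seq; apply: ler_sum => p /in_primes[pp pm].
    have := Ks n p m pp pm mX; have l0 := ln_norm_ge0 pp.
    set s := \sum_(k < m) _; set l := ln _ in l0 *.
    have -> : s * l - M n * (l / (N p)%:R) = l * (s - M n / (N p)%:R) by ring.
    rewrite normrM (ger0_norm l0) => h; apply: le_trans (ler_wpM2l l0 h) _.
    lra.
  rewrite -mulr_sumr big_split /= -mulr_suml -mulr_sumr mulrCA; apply: ler_wpM2l => //.
  rewrite mulrDr; apply: lerD; last by apply: ler_wpM2l => //; exact: ltW.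
  have h := ler_wpM2r (exprn_ge0 d.-1 (ltW Yn)) sroot.
  apply: le_trans h _.
  have := ler_wpM2l (mulr_ge0 Kt0 (mulr_ge0 (ler0n R d) (ltW cN_gt0))) (Yd_le n).
  lra.
rewrite -(ler_pM2l M0) -[X in X * `|_|]gtr0_norm // -normrM.
set Q := \sum_(p <- primes m) _ in T3 *.
have -> : M n * (Q - d%:R * ln (Y n)) =
  (T - M n * (d%:R * ln (Y n))) - (T - M n * Q) by ring.
apply: le_trans (ler_normB _ _) _; apply: le_trans (lerD T1 T3) _.
by rewrite -mulrDr.
Qed.

(** The sum is monotone in m, and the values cN Y^d treated by [mertens_balls] approach m within a
    constant factor, from above and, once m is large, from below. *)
Lemma mertens : exists K : R, forall m, (0 < m)%N ->
  `|\sum_(p <- primes m) ln (N p)%:R / (N p)%:R - ln m%:R| <= K.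
Proof.
have [K K0 Kb] := mertens_balls.
have lC0 : 0 <= ln C by apply: ln_ge0; exact: ls_C ls.
have lc9 : 0 <= ln cN by exact: ln_ge0.
have mono m n : (m <= n)%N -> \sum_(p <- primes m) ln (N p)%:R / (N p)%:R <=
    \sum_(p <- primes n) ln (N p)%:R / (N p)%:R :> R.
  move=> mn; rewrite -subr_ge0 (upto_sumB finite_primes _ mn) big_seq_cond.
  apply: sumr_ge0 => p /andP[/in_primes[pp _] _].
  by rewrite divr_ge0 // ln_norm_ge0.
have pos m : 0 <= \sum_(p <- primes m) ln (N p)%:R / (N p)%:R :> R.
  rewrite big_seq; apply: sumr_ge0 => p /in_primes[pp _].
  by rewrite divr_ge0 // ln_norm_ge0.
exists (K + ln cN + d%:R * ln C + d%:R * ln C) => m m0.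
have dC0 : 0 <= d%:R * ln C by exact: mulr_ge0.
have mR : 0 < m%:R :> R by rewrite ltr0n.
have lm : d%:R * ln (root m) = ln m%:R :> R.
  by rewrite ln_powR mulrA mulfV ?mul1r // pnatr_eq0 -lt0n.
have lnY n t : 1 <= t -> t <= Y n <= C * t ->
    d%:R * ln t <= d%:R * ln (Y n) <= d%:R * ln C + d%:R * ln t.
  move=> t1 /andP[tY Yt]; have t0 : 0 < t := lt_le_trans ltr01 t1.
  rewrite -mulrDr -lnM ?posrE //.
  by rewrite !ler_wpM2l ?ler_ln ?posrE ?mulr_gt0.
rewrite ler_norml; apply/andP; split; last first.
  have r1 := root_ge1 m0; have [n nb] := ls_Ycofinal ls r1.
  have /andP[_ h1] := lnY _ _ r1 nb; rewrite lm in h1.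
  have := Kb n _ erefl; rewrite ler_norml => /andP[_ h2].
  have mX : (m <= Num.truncn (cN * Y n ^+ d))%N.
    rewrite truncn_ge_nat; last by rewrite mulr_ge0 // exprn_ge0 // ltW.
    apply: (@le_trans _ _ (Y n ^+ d)); last by rewrite ler_peMl // exprn_ge0 // ltW.
    rewrite -rootK; case/andP: nb => nb _; apply: lerXn2r; rewrite ?nnegrE ?powR_ge0 //.
    exact: ltW.
  have := mono _ _ mX; lra.
(* Chosen so that any Y between t and C t satisfies cN Y^d <= m. *)
pose t := (m%:R / cN) `^ d%:R^-1 / C.
have mc0 : 0 < m%:R / cN by exact: divr_gt0.
have tC : (t * C) ^+ d = m%:R / cN.
  rewrite /t divfK ?gt_eqF // -powR_mulrn ?powR_ge0 // -powRrM mulVf ?powRr1 ?ltW //.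
  by rewrite pnatr_eq0 -lt0n.
have t0 : 0 < t by rewrite /t divr_gt0 // powR_gt0.
have lt : d%:R * ln t + d%:R * ln C = ln m%:R - ln cN.
  rewrite -mulrDr -lnM ?posrE // -ln_div ?posrE // -tC lnXn ?(mulr_gt0 t0 C0) //.
  by rewrite mulr_natl.
(* For t < 1 no radius is available, but then ln m is bounded and the sum is nonnegative. *)
have [t1|t1] := leP 1 t; last first.
  have l0 : d%:R * ln t <= 0 by rewrite mulr_ge0_le0 // ln_le0 // ltW.
  by have := pos m; lra.
have [n nb] := ls_Ycofinal ls t1; have /andP[h1 _] := lnY _ _ t1 nb.
have := Kb n _ erefl; rewrite ler_norml => /andP[h2 _].
have Xm : (Num.truncn (cN * Y n ^+ d) <= m)%N.
  rewrite -(ler_nat R); apply: le_trans (_ : cN * Y n ^+ d <= _).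
    by rewrite truncn_le mulr_ge0 // exprn_ge0 // ltW.
  have : Y n ^+ d <= (t * C) ^+ d.
    case/andP: nb => _ nb; rewrite [t * C]mulrC.
    apply: lerXn2r; rewrite ?nnegrE //; first exact: ltW.
    exact: ltW (mulr_gt0 C0 t0).
  by rewrite tC ler_pdivlMr // mulrC.
have := mono _ _ Xm; lra.
Qed.

End Mertens.

(** * Sizes on Z and F[T] *)

Section BaseSize.
Variables (R : realType) (A : idomainType) (k : fieldType) (io : {rmorphism A -> k}).
Variable av : k -> R.

Definition base_ball (r : R) : set A := [set a | av (io a) <= r].
Definition base_count r : nat := #|` fset_set (base_ball r)|.

Lemma base_ball_lt0 r : (forall x, 0 <= av x) -> r < 0 -> base_ball r = set0.
Proof.
move=> av0 r0; apply/seteqP; split=> // a /(le_trans (av0 _)).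
by move=> /le_lt_trans /(_ r0); rewrite ltxx.
Qed.

(** The traces on A of the prime ideals of an extension are of this kind. *)
Definition prime_subset (I : set A) : Prop :=
  [/\ forall a x, I x -> I (a * x), ~ I 1 & forall x y, I (x * y) -> I x \/ I y].

(** The common part of Z in Q with the usual absolute value and of F[T] in F(T) with the absolute
    value at infinity. The sequence [Y] leaves room to choose radii near which the count has no
    large jump. The condition on [f] in [bs_prime_product] says, as a pigeonhole principle, that A
    has at most m classes modulo I. *)
Record base_size (Y : nat -> R) (C : R) : Prop := BaseSize {
  bs_C : 1 <= C;
  bs_ge0 : forall x, 0 <= av x;
  bs_0 : av 0 = 0;
  bs_M : forall x y, av (x * y) = av x * av y;
  bs_D : forall x y, av (x + y) <= av x + av y;
  bs_int : forall a, a != 0 -> 1 <= av (io a);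
  bs_round : forall x, exists a, av (x - io a) <= 1;
  bs_frac : forall x, exists a c, c != 0 /\ x = io a / io c;
  bs_finite : forall r, finite_set (base_ball r);
  bs_count_ub : forall r, 1 <= r -> (base_count r)%:R <= C * r;
  bs_count_lb : forall r, 0 <= r -> r <= C * (base_count r)%:R;
  bs_count_reg : forall n r, 1 <= r ->
    (base_count (Y n + r))%:R <= (base_count (Y n - r))%:R + C * r;
  bs_Y1 : forall n, 1 <= Y n;
  bs_Ycofinal : forall r, 1 <= r -> exists n, r <= Y n <= C * r;
  bs_large : forall r, 1 <= r -> exists a, r <= av (io a) <= C * r;
  bs_prime_product : forall m, exists a, [/\ a != 0, av (io a) <= expR (C * m%:R)
    & forall I, prime_subset I ->
      (forall f : nat -> A, exists i j, (i < j <= m)%N /\ I (f j - f i)) -> I a] }.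

End BaseSize.

(** * Chebyshev's bound for the product of the primes up to n *)

Section Primorial.
Local Open Scope nat_scope.

Definition primorial n := \prod_(p < n.+1 | prime p) p.

Lemma primorial_gt0 n : 0 < primorial n.
Proof. by apply: prodn_cond_gt0 => i; exact: prime_gt0. Qed.

Lemma dvdn_primorial p n : prime p -> p <= n -> p %| primorial n.
Proof.
move=> pp pn; rewrite -ltnS in pn.
by rewrite /primorial (bigD1 (Ordinal pn)) //= dvdn_mulr.
Qed.

Lemma primorial_recr n : primorial n.+1 = primorial n * (if prime n.+1 then n.+1 else 1).
Proof. by rewrite /primorial big_mkcond big_ord_recr /= -big_mkcond. Qed.

Lemma coprime_prime_prod (s : seq nat) q : prime q -> all prime s -> q \notin s ->
  coprime q (\prod_(p <- s) p).
Proof.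
move=> qq; elim: s => [_ _|p s IH /= /andP[pp ps]]; first by rewrite big_nil coprimen1.
rewrite in_cons negb_or => /andP[qp qs].
rewrite big_cons coprimeMr IH // andbT prime_coprime // dvdn_prime2 //.
Qed.

Lemma prod_primes_dvdn (s : seq nat) m : uniq s -> all prime s ->
  (forall p : nat, p \in s -> p %| m) -> \prod_(p <- s) p %| m.
Proof.
elim: s => [_ _ _|p s IH /= /andP[ps us] /andP[pp sp] h]; first by rewrite big_nil dvd1n.
rewrite big_cons Gauss_dvd ?coprime_prime_prod // h ?mem_head //=.
by apply: IH => // q qs; apply: h; rewrite in_cons qs orbT.
Qed.

Lemma prime_ndvd_fact p n : prime p -> n < p -> ~~ (p %| n`!).
Proof.
move=> pp; elim: n => [|n IH] np; first by rewrite dvdn1 neq_ltn prime_gt1 ?orbT.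
rewrite factS Euclid_dvdM // negb_or IH ?andbT; last exact: ltnW.
by rewrite gtnNdvd.
Qed.

(** The two middle coefficients are equal, and their sum is at most 2^(2m+1). *)
Lemma bin_half_le m : 'C(m.*2.+1, m) <= 4 ^ m.
Proof.
have e : \sum_(i < m.*2.+2) 'C(m.*2.+1, i) = 2 ^ m.*2.+1.
  rewrite -[2]/(1 + 1) expnDn; apply: eq_bigr => i _.
  by rewrite !exp1n !muln1.
have m1 : m < m.*2.+2 by lia.
have m2 : m.+1 < m.*2.+2 by lia.
have : 'C(m.*2.+1, m) + 'C(m.*2.+1, m.+1) <= 2 ^ m.*2.+1.
  rewrite -e (bigD1 (Ordinal m1)) //= leq_add2l (bigD1 (Ordinal m2)) /=.
    exact: leq_addr.
  by rewrite -val_eqE /=; lia.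
have -> : 'C(m.*2.+1, m.+1) = 'C(m.*2.+1, m).
  by rewrite -bin_sub; [congr 'C(_, _); lia|lia].
rewrite expnS -[m.*2]muln2 mulnC expnM -[2 ^ 2]/4.
lia.
Qed.

(** Erdos's argument: the primes from m + 2 to 2m + 1 all divide the binomial coefficient of 2m + 1
    over m, which is at most 4^m, and an even number above 2 adds no prime. *)
Lemma primorial_le n : primorial n <= 4 ^ n.
Proof.
elim/ltn_ind: n => -[|[|[|n]]] IH.
- by rewrite /primorial big_mkcond big_ord_recl big_ord0.
- by rewrite /primorial big_mkcond !big_ord_recl big_ord0.
- by rewrite /primorial big_mkcond !big_ord_recl big_ord0.
have [odn|evn] := boolP (odd n); last first.
  pose m := n./2.+1.
  have em : n.+3 = m.*2.+1 by rewrite /m; have := odd_double_half n; rewrite (negPf evn); lia.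
  move: m em => m em.
  have hm : primorial m.+1 <= 4 ^ m.+1 by apply: IH; lia.
  pose s := [seq p <- iota m.+2 m | prime p].
  have us : uniq s by rewrite filter_uniq // iota_uniq.
  have sp : all prime s by exact: filter_all.
  have es : primorial n.+3 = primorial m.+1 * \prod_(p <- s) p.
    rewrite em /primorial -!(big_mkord prime id) (big_cat_nat (n := m.+2)) //=; last by lia.
    congr (_ * _); rewrite /index_iota (_ : m.*2.+2 - m.+2 = m); last by lia.
    by rewrite big_filter.
  have sd : \prod_(p <- s) p %| 'C(m.*2.+1, m).
    apply: prod_primes_dvdn => // p; rewrite mem_filter mem_iota => /andP[pp pm].
    have mm : m <= m.*2.+1 by lia.
    have /andP[pm1 pm2] := pm.
    have pm3 : p <= m.*2.+1 by rewrite -ltnS (leq_trans pm2) // -addnn !addSn.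
    have : p %| m.*2.+1`! by apply: dvdn_fact; rewrite prime_gt0.
    rewrite -(bin_fact mm) !Euclid_dvdM // (negPf (prime_ndvd_fact pp _)); last by lia.
    by rewrite (negPf (prime_ndvd_fact pp _)) ?orbF //; lia.
  rewrite es em; apply: leq_trans (leq_mul hm (dvdn_leq _ sd)) _; first by rewrite bin_gt0; lia.
  apply: leq_trans (leq_mul (leqnn _) (bin_half_le m)) _.
  by rewrite -expnD leq_exp2l //; lia.
rewrite primorial_recr; have [pn|_] := boolP (prime n.+3).
  have := even_prime pn; rewrite /= odn; lia.
rewrite muln1; apply: leq_trans (IH _ _) _ => //.
by rewrite leq_exp2l.
Qed.

End Primorial.

(** * The integers with the usual absolute value *)

Section IntSize.
Variable R : realType.
Local Notation io := (intr : {rmorphism int -> rat}).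
Local Notation av := (fun x : rat => `|ratr x : R|).

Lemma int_avE a : av (io a) = `|a|%N%:R.
Proof. by rewrite /= ratr_int natr_absz intr_norm. Qed.

Lemma absz_shift (a : int) n : (absz a <= n)%N ->
  (absz (a + n%:Z)%R < n.*2.+1)%N /\ a = (absz (a + n%:Z)%R)%:Z - n%:Z.
Proof. lia. Qed.

Lemma absz_sub_le i n : (i < n.*2.+1)%N -> (absz (i%:Z - n%:Z)%R <= n)%N.
Proof. lia. Qed.

Definition int_shift n (i : 'I_n.*2.+1) : int := i%:Z - n%:Z.

Lemma int_ballE r : 0 <= r ->
  base_ball io av r = [set` [fset int_shift i | i : 'I_(Num.truncn r).*2.+1]%fset].
Proof.
move=> r0; set n := Num.truncn r; apply/seteqP; split=> a /=.
  rewrite /base_ball /= int_avE -truncn_ge_nat // -/n => an.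
  have [h1 h2] := absz_shift an.
  by apply/imfsetP; exists (Ordinal h1).
move=> /imfsetP[i /= _ ->]; have ib := ltn_ord i.
by rewrite /base_ball /= int_avE -truncn_ge_nat // -/n; exact: absz_sub_le.
Qed.

Lemma int_countE r : 0 <= r -> base_count io av r = (Num.truncn r).*2.+1.
Proof.
move=> r0; rewrite /base_count int_ballE // set_fsetK card_imfset /=; last first.
  by move=> i j /addIr [] /val_inj.
by rewrite -cardE card_ord.
Qed.

Lemma int_base_size : base_size io av (fun n => n.+1%:R) 8.
Proof.
(* The constant 8 covers the bounds that follow from this one, as well as 4^m <= exp(8 m), with room
   to spare. *)
have bnd r : 2 * r - 1 <= (base_count io av r)%:R <= 2 * `|r| + 1.
  have [r0|r0] := leP 0 r; last first.
    rewrite /base_count base_ball_lt0 // fset_set0 cardfs0 ltr0_norm //.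
    by apply/andP; split; lra.
  rewrite int_countE // ger0_norm //.
  have -> : (Num.truncn r).*2.+1%:R = 2 * (Num.truncn r)%:R + 1 :> R.
    by rewrite -addn1 natrD -muln2 natrM mulrC.
  have /andP[h1 h2] := truncn_itv r0; rewrite -natr1 in h2.
  by apply/andP; split; lra.
split.
- by rewrite ler1n.
- by move=> x; exact: normr_ge0.
- by rewrite rmorph0 normr0.
- by move=> x y; rewrite rmorphM normrM.
- by move=> x y; rewrite rmorphD; exact: ler_normD.
- by move=> a a0; rewrite int_avE ler1n absz_gt0.
- move=> x; exists (Num.floor x).
  have /andP[h1 h2] : 0 <= x - (Num.floor x)%:~R <= 1.
    by rewrite subr_ge0 floor_le lerBlDl ltW // -[X in _ < X]intrD1 floorD1_gt.
  have e1 : ratr 1 = 1 :> R by rewrite rmorph1.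
  by rewrite /= ger0_norm ?ler0q // -e1 ler_rat.
- move=> x; exists (numq x), (denq x); rewrite denq_neq0; split=> //.
  by rewrite /= divq_num_den.
- move=> r; have [r0|r0] := leP 0 r; last by rewrite base_ball_lt0.
  by rewrite int_ballE //; exact: finite_fset.
- move=> r r1; have /andP[_ h] := bnd r; apply: le_trans h _.
  by rewrite ger0_norm; lra.
- move=> r r0; have [r1|r1] := leP 1 r.
    by have /andP[h _] := bnd r; lra.
  have /truncn0Pn t0 : ~~ (1 <= r) by rewrite -ltNge.
  by rewrite int_countE // t0 double0 mulr1; lra.
- move=> n r r1; have /andP[_ h1] := bnd (n.+1%:R + r).
  have /andP[h2 _] := bnd (n.+1%:R - r).
  have n0 : 0 <= n.+1%:R :> R by [].
  by rewrite ger0_norm in h1; lra.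
- by move=> n; rewrite ler1n.
- move=> r r1; exists (Num.truncn r).
  have r0 : 0 <= r by lra.
  have /andP[h1 h2] := truncn_itv r0; rewrite -natr1 in h2 *.
  by apply/andP; split; lra.
- move=> r r1; exists (Num.truncn r).+1%:Z.
  have r0 : 0 <= r by lra.
  have /andP[h1 h2] := truncn_itv r0; rewrite int_avE /= -natr1 in h2 *.
  by apply/andP; split; lra.
move=> m; exists (primorial m)%:Z; split.
- by have := primorial_gt0 m; lia.
- rewrite int_avE /=; apply: (@le_trans _ _ (4 ^ m)%N%:R).
    by rewrite ler_nat primorial_le.
  rewrite natrX expRM_natr; apply: lerXn2r; rewrite ?nnegrE ?expR_ge0 //.
  by apply: le_trans (expR_ge1Dx _); lra.
(* Pigeonhole among 0, ..., m puts some t with 0 < t <= m in I; one of its prime factors is then in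
   I and divides the primorial. *)
move=> I [IM nI1 IP] /(_ Posz)[i [j [/andP[ij jm] Iij]]].
have : exists2 t, (0 < t <= m)%N & I t%:Z.
  exists (j - i)%N; first by lia.
  by rewrite -subzn // ltnW.
move=> [t tm It]; have {tm It} : exists2 p, prime p && (p <= m)%N & I p%:Z.
  elim/ltn_ind: t tm It => t IH tm It.
  have [t1|t1] := leqP t 1; first by case: nI1; have t1' : t = 1%N; [lia|rewrite t1' in It].
  have pt := pdiv_prime t1; have /dvdnP[s st] := pdiv_dvd t.
  have p1 := prime_gt1 pt.
  have := It; rewrite {1}st PoszM => /IP[Is|Ip].
    have s0 : (0 < s)%N by case: s st Is => // st; move: t1; rewrite st.
    have st' : (s < t)%N by rewrite st ltn_Pmulr.
    by apply: (IH s) => //; case/andP: tm => _ tm; rewrite s0 (leq_trans (ltnW st')).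
  exists (pdiv t) => //; rewrite pt /=; case/andP: tm => t0 tm.
  exact: leq_trans (dvdn_leq t0 (pdiv_dvd t)) tm.
move=> [p /andP[pp pm] Ip]; have /dvdnP[s ->] := dvdn_primorial pp pm.
by rewrite PoszM; exact: IM.
Qed.

End IntSize.

Lemma fracP (A : idomainType) (x : {fraction A}) :
  exists p r : A, r != 0 /\ x = tofrac p / tofrac r.
Proof.
elim/quotW: x => x; have d0 := denom_ratioP x.
exists (frac x).1, (frac x).2; split=> //.
apply: (canRL (mulfK _)); first by rewrite tofrac_eq0.
unlock FracField.tofrac; rewrite -[LHS]FracField.pi_mul; apply/eqmodP.
rewrite /= FracField.equivfE /FracField.mulf.
by rewrite !numden_Ratio ?(oner_neq0, mulf_neq0) // !mulr1 mulrC.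
Qed.

(** * Polynomials over a finite field with the absolute value at infinity *)

Section PolySize.
Variables (R : realType) (F : finFieldType).
Local Notation q := #|F|.
Local Notation io := (@tofrac {poly F} : {rmorphism {poly F} -> {fraction {poly F}}}).

Let q1 : (1 < q)%N := card_finNzRing_gt1 F.
Let qR : 2 <= q%:R :> R. Proof. by rewrite ler_nat. Qed.
Let qR1 : 1 <= q%:R :> R. Proof. by rewrite ler1n ltnW. Qed.
Let qR0 : 0 < q%:R :> R. Proof. by rewrite ltr0n ltnW. Qed.

Definition poly_weight (p : {poly F}) : R := if p == 0 then 0 else q%:R ^+ (size p).-1.

Lemma poly_weight0 : poly_weight 0 = 0. Proof. by rewrite /poly_weight eqxx. Qed.

Lemma poly_weightE p : p != 0 -> poly_weight p = q%:R ^+ (size p).-1.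
Proof. by move=> /negPf p0; rewrite /poly_weight p0. Qed.

Lemma poly_weight_gt0 p : p != 0 -> 0 < poly_weight p.
Proof. by move=> p0; rewrite poly_weightE // exprn_gt0. Qed.

Lemma poly_weight_ge0 p : 0 <= poly_weight p.
Proof. by have [->|/poly_weight_gt0/ltW//] := eqVneq p 0; rewrite poly_weight0. Qed.

Lemma poly_weight_ge1 p : p != 0 -> 1 <= poly_weight p.
Proof. by move=> p0; rewrite poly_weightE // exprn_ege1. Qed.

Lemma poly_weightM p r : poly_weight (p * r) = poly_weight p * poly_weight r.
Proof.
have [->|p0] := eqVneq p 0; first by rewrite !(mul0r, poly_weight0).
have [->|r0] := eqVneq r 0; first by rewrite !(mulr0, poly_weight0).
rewrite !poly_weightE ?mulf_neq0 // size_mul // -exprD; congr (_ ^+ _).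
have := r0; have := p0; rewrite -!size_poly_gt0.
by case: (size p) => // a; case: (size r) => // b _ _ /=; rewrite addnS.
Qed.

Lemma poly_weight_le p n : p != 0 -> (poly_weight p <= q%:R ^+ n) = (size p <= n.+1)%N.
Proof.
move=> p0; rewrite poly_weightE // ler_eXn2l ?ltr1n //.
by have := p0; rewrite -size_poly_gt0; case: (size p).
Qed.

Lemma poly_weightD p r : poly_weight (p + r) <= poly_weight p + poly_weight r.
Proof.
have [->|p0] := eqVneq p 0; first by rewrite add0r poly_weight0 add0r.
have [->|r0] := eqVneq r 0; first by rewrite addr0 poly_weight0 addr0.
have [->|s0] := eqVneq (p + r) 0.
  by rewrite poly_weight0 addr_ge0 // poly_weight_ge0.
have [sz|sz] := leqP (size p) (size r).
  apply: le_trans (_ : poly_weight r <= _); last by rewrite lerDr poly_weight_ge0.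
  rewrite [leRHS]poly_weightE // poly_weight_le // prednK ?size_poly_gt0 //.
  by apply: leq_trans (size_polyD _ _) _; rewrite geq_max sz leqnn.
apply: le_trans (_ : poly_weight p <= _); last by rewrite lerDl poly_weight_ge0.
rewrite [leRHS]poly_weightE // poly_weight_le // prednK ?size_poly_gt0 //.
by apply: leq_trans (size_polyD _ _) _; rewrite geq_max leqnn ltnW.
Qed.

(** The absolute value at infinity, read off from an arbitrary way of writing x as a fraction; by
    [frac_weightE] all of them agree. *)
Definition frac_weight (x : {fraction {poly F}}) : R :=
  let u := xget (0, 1) [set u | u.2 != 0 /\ x = io u.1 / io u.2] in
  poly_weight u.1 / poly_weight u.2.

Lemma frac_weightE p r : r != 0 -> frac_weight (io p / io r) = poly_weight p / poly_weight r.
Proof.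
move=> r0; rewrite /frac_weight; case: xgetP => [[a c] _ [/= c0 e]|/(_ (p, r))]; last by case.
have e' : p * c = a * r.
  have io0 s : s != 0 -> io s != 0 by rewrite /= tofrac_eq0.
  move/eqP: e; rewrite eqr_div ?io0 // -!rmorphM /= tofrac_eq => /eqP.
  by rewrite [X in _ = X]mulrC => ->; rewrite mulrC.
have := congr1 poly_weight e'; rewrite !poly_weightM => h.
have w0 s : s != 0 -> poly_weight s != 0 by move=> /poly_weight_gt0/gt_eqF ->.
by apply/eqP; rewrite eqr_div ?w0 // h.
Qed.

Lemma frac_weight_io p : frac_weight (io p) = poly_weight p.
Proof.
rewrite -[io p]divr1 -[1](rmorph1 io) frac_weightE ?oner_neq0 //.
by rewrite (poly_weightE (oner_neq0 _)) size_poly1 expr0 divr1.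
Qed.

Lemma poly_ballE n : [set p : {poly F} | (size p <= n)%N] =
  [set` [fset rVpoly v | v : 'rV[F]_n]%fset].
Proof.
apply/seteqP; split=> p /=.
  by move=> pn; apply/imfsetP; exists (poly_rV p) => //; rewrite poly_rV_K.
by move=> /imfsetP[v /= _ ->]; exact: size_poly.
Qed.

Lemma finite_poly_ball n : finite_set [set p : {poly F} | (size p <= n)%N].
Proof. by rewrite poly_ballE; exact: finite_fset. Qed.

Lemma card_poly_ball n : #|` fset_set [set p : {poly F} | (size p <= n)%N]| = (q ^ n)%N.
Proof.
rewrite poly_ballE set_fsetK card_imfset /=; last exact: can_inj rVpolyK.
by rewrite -cardE card_mx mul1n.
Qed.

Lemma exists_expn (r : R) : 1 <= r -> exists n, q%:R ^+ n <= r < q%:R ^+ n.+1.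
Proof.
move=> r1; have r0 : 0 <= r by lra.
have rt : (0 < Num.truncn r)%N by rewrite truncn_gt0.
exists (trunc_log q (Num.truncn r)); have /andP[h1 h2] := trunc_log_bounds q1 rt.
rewrite -!natrX -truncn_ge_nat // h1 /= -truncn_lt_nat //.
Qed.

Lemma frac_ballE r n : q%:R ^+ n <= r < q%:R ^+ n.+1 ->
  base_ball io frac_weight r = [set p | (size p <= n.+1)%N].
Proof.
move=> /andP[h1 h2]; apply/seteqP; split=> p; rewrite /base_ball /= frac_weight_io.
  have [->|p0] := eqVneq p 0; first by rewrite size_poly0.
  move=> pr; have := le_lt_trans pr h2; rewrite poly_weightE // ltr_eXn2l ?ltr1n //.
  by case: (size p).
have [-> _|p0] := eqVneq p 0.
  by rewrite poly_weight0; apply: le_trans h1; exact: exprn_ge0.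
by rewrite -poly_weight_le // => /le_trans; apply.
Qed.

Lemma frac_countE r n : q%:R ^+ n <= r < q%:R ^+ n.+1 ->
  base_count io frac_weight r = (q ^ n.+1)%N.
Proof. by move=> h; rewrite /base_count (frac_ballE h) card_poly_ball. Qed.

Lemma frac_ball_small r : 0 <= r < 1 -> base_ball io frac_weight r = [set 0].
Proof.
move=> /andP[r0 r1]; apply/seteqP; split=> p; rewrite /base_ball /= frac_weight_io.
  move=> pr; apply/eqP/negPn/negP => /poly_weight_ge1.
  by rewrite leNgt => /negP; apply; apply: le_lt_trans pr r1.
by move=> ->; rewrite poly_weight0.
Qed.

Lemma frac_weight_ge0 x : 0 <= frac_weight x.
Proof. by rewrite divr_ge0 ?poly_weight_ge0. Qed.

Lemma frac_count_ub r : 1 <= r -> (base_count io frac_weight r)%:R <= q%:R * r.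
Proof.
move=> /exists_expn[n h]; rewrite (frac_countE h) natrX exprS ler_wpM2l //.
by case/andP: h.
Qed.

Lemma frac_count_lb r : 0 <= r -> r <= (base_count io frac_weight r)%:R.
Proof.
move=> r0; have [r1|r1] := leP 1 r.
  have [n h] := exists_expn r1; rewrite (frac_countE h) natrX.
  by case/andP: h => _ /ltW.
by rewrite /base_count frac_ball_small ?r0 // fset_set1 cardfs1 ltW.
Qed.

(** Once P is made monic, F[X]/(P) is a field with q^(deg P) elements, in which the class x of X
    satisfies x^(q^(deg P)) = x. *)
Lemma irreducible_dvd_frobenius (P : {poly F}) : irreducible_poly P ->
  P %| 'X^(q ^ (size P).-1) - 'X.
Proof.
move=> irP; have P0 : P != 0 by apply/irredp_neq0.
pose h := (lead_coef P)^-1 *: P.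
have lc0 : lead_coef P != 0 by rewrite lead_coef_eq0.
have hP : h %= P by apply: eqp_scale; rewrite invr_eq0.
have sh : size h = size P by rewrite size_scale // invr_eq0.
have hm : h \is monic by rewrite monicE lead_coefZ mulVf.
have hi : irreducible_poly h.
  case: irP => P1 irP; split; first by rewrite sh.
  move=> s s1 sh'; rewrite (eqp_rtrans hP); apply: irP => //.
  by rewrite -(eqp_dvdr _ hP).
pose hI : monic_irreducible_poly h := (hi, hm).
rewrite -(eqp_dvdl _ hP) -sh.
pose x : {poly %/ h with hI} := in_qpoly h 'X.
have := expf_card x; rewrite card_qfpoly => e.
have e2 : in_qpoly h ('X^(q ^ (size h).-1) - 'X) = 0.
  have -> : in_qpoly h ('X^(q ^ (size h).-1) - 'X) =
    (in_qpoly h 'X) ^+ (q ^ (size h).-1) - in_qpoly h 'X by rewrite rmorphB rmorphXn.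
  by rewrite [X in X - _]e subrr.
have := congr1 val e2; rewrite /= mk_monicE // => e3.
by rewrite /dvdp Pdiv.IdomainMonic.modpE // e3.
Qed.

(** The counterpart of the primorial: every irreducible polynomial of degree between 1 and n divides
    it, and its degree, the sum of the q^j, is at most 2 q^n. *)
Definition frobenius_product n : {poly F} := \prod_(1 <= j < n.+1) ('X^(q ^ j) - 'X).

Lemma size_frobenius_factor j : (0 < j)%N ->
  size ('X^(q ^ j) - 'X : {poly F}) = (q ^ j).+1.
Proof.
move=> j0; rewrite size_polyDl size_polyXn // size_polyN size_polyX ltnS.
by apply: leq_trans q1 _; rewrite -[leqLHS]expn1 leq_exp2l.
Qed.

Lemma weight_frobenius_product n :
  frobenius_product n != 0 /\ poly_weight (frobenius_product n) <= q%:R ^+ (q ^ n).*2.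
Proof.
elim: n => [|n [IH0 IH]].
  rewrite /frobenius_product big_nil oner_neq0; split=> //.
  by rewrite poly_weightE ?oner_neq0 // size_poly1 expr0 exprn_ege1.
have e : frobenius_product n.+1 = frobenius_product n * ('X^(q ^ n.+1) - 'X).
  by rewrite /frobenius_product big_nat_recr.
have f0 : 'X^(q ^ n.+1) - 'X != 0 :> {poly F}.
  by rewrite -size_poly_gt0 size_frobenius_factor.
rewrite e mulf_neq0 //; split=> //; rewrite poly_weightM [X in _ * X]poly_weightE //.
rewrite size_frobenius_factor //=.
apply: le_trans (ler_wpM2r _ IH) _; first exact: exprn_ge0.
rewrite -exprD; apply: ler_weXn2l => //.
by rewrite -[leqRHS]addnn leq_add2r expnS -mul2n leq_mul2r q1 orbT.
Qed.

(** A nonzero element P of I of least degree is irreducible, because in any factorization one factor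
    lies in I; having degree at most n, it divides the product. *)
Lemma prime_subset_frobenius (I : set {poly F}) n t : prime_subset I ->
  I t -> t != 0 -> (size t <= n.+1)%N -> I (frobenius_product n).
Proof.
move=> [IM nI1 IP] It t0 tn.
have [P [IP' P0 Pn Pmin]] : exists P, [/\ I P, P != 0, (size P <= n.+1)%N &
    forall s, I s -> s != 0 -> (size P <= size s)%N].
  have ex : exists m, `[< exists P, [/\ I P, P != 0 & size P = m] >].
    by exists (size t); apply/asboolP; exists t.
  case: (ex_minnP ex) => m /asboolP[P [IP' P0 Pm]] mmin; exists P; split=> //.
    by rewrite Pm; apply: leq_trans tn; apply: mmin; apply/asboolP; exists t.
  by move=> s Is s0; rewrite Pm; apply: mmin; apply/asboolP; exists s.
have P1 : (1 < size P)%N.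
  rewrite ltnNge; apply/negP => /size1_polyC e; apply: nI1.
  have c0 : P`_0 != 0 by rewrite -polyC_eq0 -e.
  by have := IM (P`_0)^-1%:P P IP'; rewrite [X in _ * X]e -polyCM mulVf // polyC1.
have irP : irreducible_poly P.
  split=> // s s1 sP; have /dvdpP[u e] := sP.
  have u0 : u != 0 by apply: contra_neq P0 => u0; rewrite e u0 mul0r.
  have s0 : s != 0 by apply: contra_neq P0 => s0; rewrite e s0 mulr0.
  have := size_mul u0 s0; rewrite -e => sz.
  have u1 := u0; have s2 := s0; rewrite -size_poly_gt0 in u1; rewrite -size_poly_gt0 in s2.
  have Ius : I (u * s) by rewrite -e.
  have [Iu|Is] := IP _ _ Ius.
    have arith (a b c : nat) : (0 < a -> 0 < b -> c = (a + b).-1 -> c <= a -> b = 1)%N by lia.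
    by case/negP: s1; apply/eqP; apply: arith u1 s2 sz _; exact: Pmin.
  by rewrite -dvdp_size_eqp // eqn_leq dvdp_leq //= Pmin.
have : P %| frobenius_product n.
  apply: dvdp_trans (irreducible_dvd_frobenius irP) _.
  rewrite /frobenius_product (big_rem (size P).-1) ?dvdp_mulr //=.
  by rewrite mem_index_iota; move: P1 Pn; case: (size P) => // k k0 kn; apply/andP.
by case/dvdpP => s ->; exact: IM.
Qed.

(** The number of polynomials of weight at most r jumps when r passes a power of q. The radius 3/2
    q^n keeps a distance of at least q^n / 2 from these powers, and for a larger change r of the
    radius the whole count is already at most 16 q r. *)
Lemma poly_base_size :
  base_size io frac_weight (fun n => 3 / 2 * q%:R ^+ n) (16 * q%:R).
Proof.
have C1 : 1 <= 16 * q%:R :> R by have := qR; lra.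
split=> //.
- exact: frac_weight_ge0.
- by rewrite -(rmorph0 io) frac_weight_io poly_weight0.
- move=> x y; have [p [r [r0 ->]]] := fracP x; have [p' [r' [r'0 ->]]] := fracP y.
  rewrite mulf_div -!rmorphM !frac_weightE ?mulf_neq0 // !poly_weightM.
  by rewrite mulf_div.
- move=> x y; have [p [r [r0 ->]]] := fracP x; have [p' [r' [r'0 ->]]] := fracP y.
  have io0 s : s != 0 -> io s != 0 by rewrite /= tofrac_eq0.
  rewrite addf_div ?io0 // -!rmorphM -rmorphD !frac_weightE ?mulf_neq0 //.
  have w0 s : s != 0 -> poly_weight s != 0 by move=> /poly_weight_gt0/gt_eqF ->.
  rewrite addf_div ?w0 // poly_weightM ler_pM2r -?poly_weightM ?invr_gt0 ?poly_weight_gt0 ?mulf_neq0 //.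
  exact: poly_weightD.
- by move=> a a0; rewrite frac_weight_io poly_weight_ge1.
- move=> x; have [p [r [r0 ->]]] := fracP x; exists (p %/ r).
  have io0 : io r != 0 by rewrite /= tofrac_eq0.
  have -> : io p / io r - io (p %/ r) = io (p %% r) / io r.
    by rewrite {1}(divp_eq p r) rmorphD rmorphM mulrDl mulfK // addrAC subrr add0r.
  rewrite frac_weightE // ler_pdivrMr ?poly_weight_gt0 // mul1r.
  have [->|m0] := eqVneq (p %% r) 0; first by rewrite poly_weight0 poly_weight_ge0.
  rewrite [leRHS]poly_weightE // poly_weight_le // prednK ?size_poly_gt0 //.
  by rewrite ltnW // ltn_modp.
- by move=> x; have [p [r [r0 ->]]] := fracP x; exists p, r.
- move=> r; have [r0|r0] := leP 0 r; last by rewrite base_ball_lt0 //; exact: frac_weight_ge0.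
  have [r1|r1] := leP 1 r; last by rewrite frac_ball_small ?r0 //; exact: finite_set1.
  have [n h] := exists_expn r1; rewrite (frac_ballE h); exact: finite_poly_ball.
- move=> r r1; apply: le_trans (frac_count_ub r1) _; apply: ler_wpM2r; lra.
- move=> r r0; apply: le_trans (frac_count_lb r0) _.
  by rewrite ler_peMl.
- move=> n r r1; set Y := 3 / 2 * _; set X := q%:R ^+ n in Y *.
  have X1 : 1 <= X by exact: exprn_ege1.
  have XX : 2 * X <= q%:R ^+ n.+1 by rewrite exprS ler_wpM2r // (le_trans ler01).
  have qr : 0 <= 16 * q%:R * r by rewrite mulr_ge0; lra.
  have [rX|rX] := leP (X / 2) r.
    apply: (@le_trans _ _ (q%:R * (Y + r))); first by apply: frac_count_ub; rewrite /Y; lra.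
    apply: (@le_trans _ _ (q%:R * (4 * r))).
      by apply: ler_wpM2l; rewrite /Y; lra.
    apply: (@le_trans _ _ (16 * q%:R * r)); last by rewrite lerDr.
    have : 0 <= q%:R * r by rewrite mulr_ge0; lra.
    lra.
  rewrite (@frac_countE _ n) ?(@frac_countE _ n) ?lerDl // -/X /Y; apply/andP; split; lra.
- by move=> n; have : 1 <= q%:R ^+ n :> R; [exact: exprn_ege1|lra].
- move=> r r1; have [n /andP[h1 h2]] := exists_expn r1; exists n.+1.
  have h3 : q%:R ^+ n.+1 <= q%:R * r by rewrite exprS ler_wpM2l.
  by apply/andP; split; lra.
- move=> r r1; have [n /andP[h1 h2]] := exists_expn r1; exists 'X^(n.+1).
  rewrite frac_weight_io poly_weightE -?size_poly_gt0 ?size_polyXn //=.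
  have h3 : q%:R ^+ n.+1 <= q%:R * r by rewrite exprS ler_wpM2l.
  by apply/andP; split; lra.
case=> [|m].
  exists 1; split; rewrite ?oner_neq0 //.
    by rewrite mulr0 expR0 frac_weight_io poly_weightE ?oner_neq0 // size_poly1.
  move=> I _ /(_ (fun=> 0))[i [j [/andP[ij j0] _]]].
  by have := leq_trans ij j0.
have m1 : 1 <= m.+1%:R :> R by rewrite ler1n.
have [n /andP[h1 h2]] := exists_expn m1.
have [f0 fw] := weight_frobenius_product n.
exists (frobenius_product n); split=> //.
  rewrite frac_weight_io; apply: le_trans fw _.
  have qe : q%:R <= expR q%:R :> R by apply: le_trans (expR_ge1Dx _); rewrite lerDr.
  apply: (@le_trans _ _ (expR q%:R ^+ (q ^ n).*2)).
    by apply: lerXn2r; rewrite ?nnegrE ?expR_ge0.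
  rewrite -expRM_natr ler_expR -mulrA [leRHS]mulrCA ler_wpM2l //.
  by rewrite -muln2 natrM natrX; lra.
(* The polynomials of degree at most n number q^(n+1) > m + 1, so [f] takes distinct values at 0,
   ..., m + 1. Two of them agree modulo I, and their difference has degree at most n. *)
move=> I pI /(_ (fun i => rVpoly (nth 0 (enum 'rV[F]_n.+1) i)))[i [j [/andP[ij jm] It]]].
have mc : (m.+1 < #|'rV[F]_n.+1|)%N.
  by rewrite card_mx mul1n -(ltr_nat R) natrX.
apply: (prime_subset_frobenius pI It).
  rewrite subr_eq0 (can_eq rVpolyK) nth_uniq -?cardE ?enum_uniq //.
  - by rewrite gtn_eqF.
  - exact: leq_ltn_trans jm mc.
  - exact: ltn_trans ij (leq_ltn_trans jm mc).
by rewrite -raddfB; exact: size_poly.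
Qed.

End PolySize.

(** * Sizes on finite extensions *)

Lemma finite_set_injective (U : Type) (T : finType) (X : set U) (f : U -> T) :
  (forall x y, X x -> X y -> f x = f y -> x = y) -> finite_set X.
Proof.
move=> fi; pose g x := if pselect (X x) then Some (f x) else None.
have gX : g @^-1` [set~ None] = X.
  by apply/seteqP; split=> x; rewrite /g /=; case: pselect.
rewrite -gX; apply: finite_preimage; last exact: finite_finset.
rewrite gX => x y /set_mem Xx /set_mem Xy; rewrite /g.
case: pselect => // Xx'; case: pselect => // Xy' [] e; exact: fi.
Qed.

Section CommonDenominator.
Variables (A : idomainType) (k : fieldType) (io : {rmorphism A -> k}).
Hypothesis frac : forall x, exists a c, c != 0 /\ x = io a / io c.
Hypothesis io_neq0 : forall a, a != 0 -> io a != 0.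

Lemma common_denominator (s : seq k) : exists2 D, D != 0 &
  forall c, c \in s -> exists a, io D * c = io a.
Proof.
elim: s => [|c s [D D0 IH]]; first by exists 1 => //; exact: oner_neq0.
have [a [b [b0 ->]]] := frac c; exists (b * D); first by rewrite mulf_neq0.
move=> x; rewrite in_cons => /orP[/eqP ->|/IH[a' e]].
  by exists (D * a); rewrite !rmorphM [io b * _]mulrC -mulrA [io b * _]mulrC divfK // io_neq0.
by exists (b * a'); rewrite !rmorphM -e mulrA.
Qed.

End CommonDenominator.

Section Extension.
Variables (R : realType) (A : idomainType) (k : fieldType) (io : {rmorphism A -> k}).
Variables (av : k -> R) (Y : nat -> R) (Cb : R) (bs : base_size io av Y Cb).
Variable K : fieldExtType k.

Let C0 : 0 < Cb. Proof. exact: lt_le_trans ltr01 (bs_C bs). Qed.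

Lemma base_io_neq0 a : a != 0 -> io a != 0.
Proof.
move=> a0; apply/eqP => e; have := bs_int bs a0.
by rewrite e (bs_0 bs) ler10.
Qed.

Lemma base_av1 : av 1 = 1.
Proof.
have h := bs_int bs (oner_neq0 A); rewrite rmorph1 in h.
have : av 1 != 0 by rewrite gt_eqF // (lt_le_trans ltr01 h).
by move=> /mulfI; apply; rewrite -(bs_M bs) !mulr1.
Qed.

Lemma base_avN x : av (- x) = av x.
Proof.
have : av (-1) ^+ 2 = 1 by rewrite expr2 -(bs_M bs) mulN1r opprK base_av1.
move=> /eqP; rewrite sqrf_eq1 => /orP[/eqP e|/eqP e].
  by rewrite -mulN1r (bs_M bs) e mul1r.
by have := bs_ge0 bs (-1); rewrite e ler0N1.
Qed.

Definition ext_emb : A -> K := in_alg K \o io.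
HB.instance Definition _ := GRing.RMorphism.copy ext_emb (in_alg K \o io).

Definition ext_integers : set K := [set x | integralOver ext_emb x].
Local Notation O := ext_integers.

Lemma ext_embE a x : ext_emb a * x = io a *: x.
Proof. by rewrite /ext_emb /= mulr_algl. Qed.

Lemma ext_integers1 : O 1. Proof. exact: integral1. Qed.
Lemma ext_integersB x y : O x -> O y -> O (x - y). Proof. exact: integral_sub. Qed.
Lemma ext_integersM x y : O x -> O y -> O (x * y). Proof. exact: integral_mul. Qed.
Lemma ext_integers_emb a : O (ext_emb a). Proof. exact: integral_id. Qed.
Let sO : subgroup O := subring_subgroup ext_integers1 ext_integersB.

(** If q is the minimal polynomial of x, of degree n, and D clears its coefficients, then D x is a
    root of the monic polynomial with coefficients D^(n - i) q_i. *)
Lemma clear_denominator (x : K) : exists2 D, D != 0 & O (ext_emb D * x).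
Proof.
have /polyOver1P[p pE] := minPolyOver 1%AS x.
have px := root_minPoly 1%AS x; have pm := monic_minPoly 1%AS x.
set q := minPoly _ x in pE px pm.
have [D D0 Dp] := common_denominator (bs_frac bs) base_io_neq0 p.
exists D => //; pose y := ext_emb D * x.
have Dn : ext_emb D != 0 by rewrite fmorph_eq0 base_io_neq0.
pose n := (size q).-1.
have sq : size q = n.+1 by rewrite prednK // size_poly_gt0 monic_neq0.
have qn : q`_n = 1 by have /monicP := pm; rewrite lead_coefE.
pose r := \poly_(i < n.+1) (ext_emb D ^+ (n - i) * q`_i).
have rn : r`_n = 1 by rewrite coef_poly ltnSn subnn expr0 mul1r qn.
have sr : size r = n.+1 by rewrite size_poly_eq // subnn expr0 mul1r qn oner_neq0.
apply: (@integral_root_monic _ _ ext_emb y r).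
- by rewrite monicE lead_coefE sr rn.
- have -> : root r y = (ext_emb D ^+ n * q.[x] == 0).
    rewrite rootE horner_poly horner_coef sq mulr_sumr; congr (_ == 0).
    apply: eq_bigr => i _; have ni : (i <= n)%N by rewrite -ltnS.
    by rewrite /y exprMn -[X in _ = _ ^+ X * _](subnK ni) exprD mulrACA.
  by have /rootP -> := px; rewrite mulr0.
move=> c /(nthP 0)[i ir <-]; rewrite coef_poly -sr ir.
have [->|ni] := eqVneq i n; first by rewrite subnn expr0 mul1r qn; exact: integral1.
have in' : (i < n)%N by rewrite ltn_neqAle ni -ltnS -sr.
rewrite -(subnSK in') exprSr -mulrA; apply: integral_mul.
  by rewrite -rmorphXn; exact: integral_id.
have /Dp[a Da] : p`_i \in (p : seq k).
  by apply: mem_nth; rewrite -(size_map_poly (in_alg K)) -pE sq ltnS ltnW.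
rewrite pE coef_map.
have -> : ext_emb D * in_alg K p`_i = ext_emb a.
  by rewrite -[ext_emb a]/(in_alg K (io a)) -Da rmorphM.
exact: integral_id.
Qed.

Local Notation d := (\dim {:K}).
Local Notation vb := (vbasis {:K}).

Lemma integral_basis_scale : exists2 D, D != 0 & forall i : 'I_d, O (ext_emb D * vb`_i).
Proof.
have h (i : 'I_d) : {D | D != 0 & O (ext_emb D * vb`_i)}.
  by apply: cid2; exact: clear_denominator.
exists (\prod_(i < d) (s2val (h i))).
  by apply/prodf_neq0 => i _; exact: (s2valP (h i)).
move=> i; rewrite (bigD1 i) //= rmorphM mulrAC; apply: ext_integersM.
  exact: (s2valP' (h i)).
exact: ext_integers_emb.
Qed.

Lemma dim_gt0 : (0 < d)%N.
Proof. exact: adim_gt0. Qed.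

Variable D : A.
Hypothesis D0 : D != 0.
Hypothesis OD : forall i : 'I_d, O (ext_emb D * vb`_i).

Let ioD0 : io D != 0 := base_io_neq0 D0.

(** Coordinates in the basis of the [io D *: vb_i], which are integral over A. *)
Definition crd (x : K) (i : 'I_d) : k := coord vb i x / io D.
Definition combo (c : 'I_d -> k) : K := \sum_(i < d) (c i * io D) *: vb`_i.

Lemma crdK x : combo (crd x) = x.
Proof.
rewrite [RHS](coord_vbasis (memvf x)); apply: eq_bigr => i _.
by rewrite /crd divfK.
Qed.

Lemma comboK c i : crd (combo c) i = c i.
Proof.
rewrite /crd /combo linear_sum /= (bigD1 i) //= big1 => [|j ji].
  by rewrite addr0 linearZ /= coord_free ?(basis_free (vbasisP _)) // eqxx mulr1 mulfK.
by rewrite linearZ /= coord_free ?(basis_free (vbasisP _)) // (negPf ji) mulr0.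
Qed.

Lemma crdB x y i : crd (x - y) i = crd x i - crd y i.
Proof. by rewrite /crd linearB mulrBl. Qed.
Lemma crdD x y i : crd (x + y) i = crd x i + crd y i.
Proof. by rewrite /crd linearD mulrDl. Qed.
Lemma crdN x i : crd (- x) i = - crd x i.
Proof. by rewrite /crd linearN mulNr. Qed.
Lemma crdZ a x i : crd (a *: x) i = a * crd x i.
Proof. by rewrite /crd linearZ mulrA. Qed.
Lemma crd_sum (I : Type) (s : seq I) (f : I -> K) i :
  crd (\sum_(j <- s) f j) i = \sum_(j <- s) crd (f j) i.
Proof. by rewrite /crd linear_sum mulr_suml. Qed.

Lemma crd_inj x y : (forall i, crd x i = crd y i) -> x = y.
Proof.
move=> h; rewrite -(crdK x) -(crdK y); apply: eq_bigr => i _.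
by rewrite h.
Qed.

Definition ext_size (x : K) : R := \big[Num.max/0]_(i < d) av (crd x i).
Local Notation sz := ext_size.

Lemma ext_size_le x r : 0 <= r -> (sz x <= r) <-> forall i, av (crd x i) <= r.
Proof.
move=> r0; split=> [/bigmax_leP[_ h] i|h]; first exact: h.
by apply/bigmax_leP; split=> // i _; exact: h.
Qed.

Lemma ext_size_ge0 x : 0 <= sz x.
Proof. by rewrite /sz; elim/big_rec: _ => // i r _ r0; rewrite le_max r0 orbT. Qed.

Lemma crd_le x i : av (crd x i) <= sz x.
Proof. exact: (ext_size_le x (ext_size_ge0 x)).1. Qed.

Lemma ext_size0 : sz 0 = 0.
Proof.
apply/eqP; rewrite eq_le ext_size_ge0 andbT; apply/ext_size_le => // i.
by rewrite /crd linear0 mul0r (bs_0 bs).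
Qed.

Lemma ext_sizeN x : sz (- x) = sz x.
Proof. by apply: eq_bigr => i _; rewrite crdN base_avN. Qed.

Lemma ext_sizeD x y : sz (x + y) <= sz x + sz y.
Proof.
apply/ext_size_le => [|i]; first by rewrite addr_ge0 // ext_size_ge0.
by rewrite crdD; apply: le_trans (bs_D bs _ _) _; rewrite lerD // crd_le.
Qed.

Lemma ext_sizeZ a x : sz (a *: x) = av a * sz x.
Proof.
have av0 := bs_ge0 bs a.
apply/eqP; rewrite eq_le; apply/andP; split.
  apply/ext_size_le => [|i]; first by rewrite mulr_ge0 // ext_size_ge0.
  by rewrite crdZ (bs_M bs) ler_wpM2l // crd_le.
have [a0|a0] := eqVneq (av a) 0; first by rewrite a0 mul0r ext_size_ge0.
have {}av0 : 0 < av a by rewrite lt_neqAle eq_sym a0.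
rewrite mulrC -ler_pdivlMr //; apply/ext_size_le => [|i].
  by rewrite divr_ge0 ?ext_size_ge0 // ltW.
by rewrite ler_pdivlMr // mulrC -(bs_M bs) -crdZ crd_le.
Qed.

(** B adds up the sizes of the products of basis vectors. *)
Lemma ext_sizeM : exists2 B : R, 0 <= B & forall x y, sz (x * y) <= B * (sz x * sz y).
Proof.
pose e (i : 'I_d) := io D *: vb`_i.
have e_sum x : x = \sum_(i < d) crd x i *: e i.
  by rewrite -{1}(crdK x); apply: eq_bigr => i _; rewrite scalerA.
exists (\sum_(i < d) \sum_(j < d) sz (e i * e j)).
  by apply: sumr_ge0 => i _; apply: sumr_ge0 => j _; exact: ext_size_ge0.
have szs (I : Type) (s : seq I) (f : I -> K) : sz (\sum_(i <- s) f i) <= \sum_(i <- s) sz (f i).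
  elim: s => [|i s IH]; first by rewrite !big_nil ext_size0.
  by rewrite !big_cons; apply: le_trans (ext_sizeD _ _) _; rewrite lerD2l.
move=> x y; rewrite {1}(e_sum x) {1}(e_sum y) mulr_suml mulr_suml.
apply: le_trans (szs _ _ _) _; apply: ler_sum => i _.
rewrite mulr_sumr mulr_suml; apply: le_trans (szs _ _ _) _; apply: ler_sum => j _.
rewrite -scalerAl -scalerAr scalerA ext_sizeZ mulrC ler_wpM2l ?ext_size_ge0 //.
by rewrite (bs_M bs) ler_pM ?(bs_ge0 bs) // crd_le.
Qed.

(** The free A-module on the scaled basis. Its points are counted coordinate by coordinate, and O is
    reached from it through a finite transversal. *)
Definition ext_lattice : set K := [set x | forall i, exists a, crd x i = io a].
Local Notation Lam := ext_lattice.

Lemma ext_lattice_sub : Lam `<=` O.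
Proof.
move=> x Lx; rewrite -(crdK x) /combo.
apply: (big_ind (fun y => O y)) => [|u v|i _]; [exact: sO.1|exact: subgroupD|].
have [a ->] := Lx i; rewrite -rmorphM -ext_embE rmorphM -mulrA.
by apply: ext_integersM => //; exact: ext_integers_emb.
Qed.

Lemma ext_lattice_subgroup : subgroup Lam.
Proof.
split=> [i|x y Lx Ly i]; first by exists 0; rewrite rmorph0 /crd linear0 mul0r.
have [a ea] := Lx i; have [c ec] := Ly i.
by exists (a - c); rewrite crdB ea ec rmorphB.
Qed.

Lemma ext_lattice_cobounded x : exists2 y, Lam y & sz (x - y) <= 1.
Proof.
have h i := cid (bs_round bs (crd x i)).
exists (combo (fun i => io (sval (h i)))).
  by move=> i; rewrite comboK; exists (sval (h i)).
apply/ext_size_le => // i; rewrite crdB comboK; exact: (svalP (h i)).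
Qed.

Lemma ext_lattice_ge1 x : Lam x -> x != 0 -> 1 <= sz x.
Proof.
move=> Lx; apply: contra_neqT; rewrite -ltNge => x1.
apply: crd_inj => i; have [a ea] := Lx i.
rewrite ea [RHS]/crd linear0 mul0r; apply/eqP/negPn/negP => a0.
have a1 : a != 0 by apply: contra_neq a0 => ->; rewrite rmorph0.
have := bs_int bs a1; rewrite -ea leNgt => /negP; apply.
exact: le_lt_trans (crd_le x i) x1.
Qed.

(** Division by a monic equation of x expresses all powers through finitely many of them, whose
    coordinates have a common denominator. *)
Lemma integral_powers_bounded_denominator x : O x ->
  exists2 c, c != 0 & forall j, Lam (ext_emb c * x ^+ j).
Proof.
move=> [p pm px]; pose n := size p.
have [c c0 cP] := common_denominator (bs_frac bs) base_io_neq0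
  [seq crd (x ^+ u.1) u.2 | u <- [seq (i, l) | i <- iota 0 n, l <- enum 'I_d]].
exists c => // j; pose r := Pdiv.CommonRing.rmodp 'X^j p.
have xj : x ^+ j = \sum_(i < size r) ext_emb r`_i * x ^+ i.
  have e := Pdiv.RingMonic.rdivp_eq pm 'X^j.
  have := congr1 (fun s => (map_poly ext_emb s).[x]) e.
  rewrite rmorphD rmorphM map_polyXn hornerXn hornerD hornerM (rootP px) mulr0 add0r.
  rewrite -/r => ->; rewrite horner_coef size_map_inj_poly ?rmorph0 //.
    by apply: eq_bigr => i _; rewrite coef_map.
  move=> a b /eqP; rewrite -subr_eq0 -rmorphB fmorph_eq0 => ab.
  by apply/eqP/negPn/negP; rewrite -subr_eq0 => /base_io_neq0; rewrite ab.
have rn : (size r <= n)%N.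
  by apply: ltnW; rewrite Pdiv.CommonRing.ltn_rmodpN0 // monic_neq0.
move=> l; rewrite xj mulr_sumr crd_sum.
apply: (big_ind (fun y => exists a, y = io a)).
- by exists 0; rewrite rmorph0.
- by move=> u v [a ->] [b ->]; exists (a + b); rewrite rmorphD.
move=> i _; have [|a ea] := cP (crd (x ^+ i) l).
  apply/mapP; exists (val i, l) => //; apply/allpairsP; exists (val i, l).
  by rewrite /= mem_iota mem_enum (leq_trans (ltn_ord i) rn).
exists (r`_i * a); rewrite !ext_embE scalerA crdZ rmorphM -ea.
by rewrite [io c * io _]mulrC mulrA.
Qed.

(** If B sz x < 1/2, the powers of x shrink geometrically, whereas c x^j, with c the common
    denominator of all powers, is a nonzero lattice point and has size at least 1. *)
Lemma ext_discrete : exists2 e : R, 1 <= e & forall x, O x -> x != 0 -> 1 <= e * sz x.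
Proof.
have [B B0 szM] := ext_sizeM; exists (2 * B + 1); first by lra.
move=> x Ox x0; rewrite leNgt; apply/negP => h.
have s0 := ext_size_ge0 x.
have Bs0 : 0 <= B * sz x by exact: mulr_ge0.
have Bs : B * sz x <= 2^-1 by lra.
have pw j : sz (x ^+ j.+1) <= 2^-1 ^+ j * sz x.
  elim: j => [|j IH]; first by rewrite expr0 mul1r expr1.
  rewrite exprS; apply: le_trans (szM _ _) _; rewrite mulrA.
  apply: (@le_trans _ _ (2^-1 * (2^-1 ^+ j * sz x))); last by rewrite mulrA -exprS.
  by apply: ler_pM => //; exact: ext_size_ge0.
have [c c0 cP] := integral_powers_bounded_denominator Ox.
pose M := av (io c) * sz x; have M0 : 0 <= M by rewrite mulr_ge0 ?(bs_ge0 bs).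
(* For this j, 2^j >= j + 1 > M, whereas the two size estimates give 2^j <= M. *)
pose j := Num.truncn M.
have := ext_lattice_ge1 (cP j.+1).
rewrite ext_embE scaler_eq0 expf_eq0 (negPf x0) andbF orbF base_io_neq0 //.
move=> /(_ isT); rewrite ext_sizeZ => h1.
have h2 : av (io c) * sz (x ^+ j.+1) <= 2^-1 ^+ j * M.
  by rewrite /M mulrCA; apply: ler_wpM2l; rewrite ?(bs_ge0 bs).
have h3 := le_trans h1 h2.
have Mj : M < j.+1%:R by have /andP[] := truncn_itv M0.
have j2 : (j.+1%:R : R) <= 2 ^+ j by rewrite -natrX ler_nat ltn_expl.
have p2 : 0 < 2 ^+ j :> R by exact: exprn_gt0.
rewrite exprVn ler_pdivlMl // mulr1 in h3.
by have := le_lt_trans (le_trans j2 h3) Mj; rewrite ltxx.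
Qed.

(** Coordinates multiplied by a large c and rounded to A take finitely many values, and these
    determine x: two integral elements with the same values differ by size at most 2 / av(c) <= 1 /
    (2 e), which discreteness excludes unless they are equal. *)
Lemma ext_finite r : finite_set (ball_in sz O 0 r).
Proof.
have [e e1 disc] := ext_discrete.
have e0 : 0 < e := lt_le_trans ltr01 e1.
have [c /andP[ce _]] : exists c, 4 * e <= av (io c) <= Cb * (4 * e).
  by apply: (bs_large bs); lra.
have avc : 0 < av (io c) by lra.
have ioc0 : io c != 0 by apply/eqP => e'; move: avc; rewrite e' (bs_0 bs) ltxx.
pose rd (y : k) := sval (cid (bs_round bs (y * io c))).
have rdP y : av (y * io c - io (rd y)) <= 1 by exact: (svalP (cid (bs_round bs (y * io c)))).
pose S := fset_set (base_ball io av (`|r| * av (io c) + 1)).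
have SP a : (a \in S) = `[< av (io a) <= `|r| * av (io c) + 1 >].
  rewrite in_fset_set; last exact: (bs_finite bs).
  by apply/idP/asboolP => [/set_mem|h]; [|apply/mem_set].
pose f (x : K) : {ffun 'I_d -> option S} := [ffun i => insub (rd (crd x i))].
apply: (@finite_set_injective _ _ _ f) => x y [Ox xr] [Oy yr] fxy; rewrite !subr0 in xr yr.
apply/eqP; rewrite -subr_eq0; apply/negPn/negP => xy.
have := disc _ (ext_integersB Ox Oy) xy; apply/negP; rewrite -ltNge.
have rS u i : sz u <= r -> rd (crd u i) \in S.
  move=> ur; rewrite SP; apply/asboolP.
  rewrite -(subKr (crd u i * io c) (io (rd (crd u i)))).
  apply: le_trans (bs_D bs _ _) _; rewrite base_avN; apply: lerD (rdP _).
  rewrite (bs_M bs) ler_wpM2r ?(bs_ge0 bs) //.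
  by apply: le_trans (crd_le u i) _; apply: le_trans ur _; exact: ler_norm.
have rxy i : rd (crd x i) = rd (crd y i).
  have := congr1 (fun g : {ffun 'I_d -> option S} => g i) fxy.
  by rewrite /f !ffunE (insubT (mem S) (rS x i xr)) (insubT (mem S) (rS y i yr)) => -[].
have h : sz (x - y) <= 2 / av (io c).
  apply/ext_size_le => [|i]; first by rewrite divr_ge0 // ltW.
  rewrite ler_pdivlMr // -(bs_M bs) crdB.
  have -> : (crd x i - crd y i) * io c =
    (crd x i * io c - io (rd (crd x i))) - (crd y i * io c - io (rd (crd y i))).
    by rewrite rxy mulrBl opprB addrA subrK.
  by apply: le_trans (bs_D bs _ _) _; rewrite base_avN -[leRHS]/(1 + 1); apply: lerD.
apply: (@le_lt_trans _ _ (e * (2 / av (io c)))); first by rewrite ler_pM2l.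
by rewrite mulrA ltr_pdivrMr // mul1r; lra.
Qed.

Local Notation b := (base_count io av).

Lemma ext_finite_ball z r : finite_set (ball_in sz O z r).
Proof.
apply: (ball_in_recenter ext_sizeD); exact: ext_finite.
Qed.

Lemma ext_lattice_count r : 0 <= r -> count_in sz Lam 0 r = (b r ^ d)%N.
Proof.
move=> r0; pose S := fset_set (base_ball io av r).
have SP a : (a \in S) = `[< av (io a) <= r >].
  rewrite in_fset_set; last exact: (bs_finite bs).
  by apply/idP/asboolP => [/set_mem|h]; [|apply/mem_set].
pose g (f : {ffun 'I_d -> S}) : K := combo (fun i => io (val (f i))).
have gi : injective g.
  move=> f f' e; apply/ffunP => i; apply: val_inj; apply/eqP; rewrite -subr_eq0.
  apply/negPn/negP => /base_io_neq0; rewrite rmorphB /= subr_eq0 => /eqP; apply.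
  by have := congr1 (fun x => crd x i) e; rewrite /g !comboK.
have -> : count_in sz Lam 0 r = #|` [fset g f | f : {ffun 'I_d -> S}]%fset|.
  rewrite /count_in -[in RHS](set_fsetK [fset g f | f : {ffun 'I_d -> S}]%fset).
  congr (#|` fset_set _|); apply/seteqP; split=> x.
    move=> [Lx]; rewrite subr0 => /(ext_size_le x r0) xr.
    have h i : {a : S | crd x i = io (val a)}.
      apply: cid; have [a ea] := Lx i; have aS : a \in S.
        by rewrite SP; apply/asboolP; rewrite -ea.
      by exists [` aS]%fset.
    apply/imfsetP; exists [ffun i => sval (h i)] => //=.
    by apply: crd_inj => i; rewrite comboK ffunE; exact: (svalP (h i)).
  move=> /imfsetP[f /= _ ->]; split=> [i|].
    by exists (val (f i)); rewrite comboK.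
  rewrite subr0; apply/ext_size_le => // i; rewrite comboK.
  by have := valP (f i); rewrite SP => /asboolP.
rewrite card_imfset //= -cardE card_ffun card_ord; congr (_ ^ _)%N.
by rewrite -cardfE.
Qed.

Lemma base_count_mono r s : r <= s -> (b r <= b s)%N.
Proof.
move=> rs; apply: fsubset_leq_card; rewrite -fset_set_sub; try exact: (bs_finite bs).
by move=> a /= /le_trans; apply.
Qed.

Lemma base_count_lt0 r : r < 0 -> b r = 0%N.
Proof.
move=> r0; rewrite /base_count base_ball_lt0 ?fset_set0 ?cardfs0 //.
exact: bs_ge0 bs.
Qed.

(** Every element is within 1 of a lattice point, so O modulo the lattice has representatives of
    size at most 1; m is their number. *)
Lemma ext_count_bounds : exists2 m : nat, (0 < m)%N & forall r,
  (m * b (r - 1) ^ d <= count_in sz O 0 r)%N /\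
  (0 <= r -> (count_in sz O 0 r <= m * b (r + 1) ^ d)%N).
Proof.
have gL := ext_lattice_subgroup.
have [|x [] //|c Oc|T TT Tb] := @transversal_from_reps _ O Lam (ball_in sz O 0 1) gL.
- exact: ext_finite.
- have [y Ly yc] := ext_lattice_cobounded c; exists (c - y).
    by split; [apply: ext_integersB => //; exact: ext_lattice_sub|rewrite subr0].
  by rewrite subKr.
have Tr t : t \in T -> sz t <= 1 by move=> /Tb[_]; rewrite subr0.
have T0 : (0 < #|` T|)%N.
  have [_ Ts _] := TT; have [t tT _] := Ts 1 ext_integers1.
  by rewrite cardfs_gt0; apply/fset0Pn; exists t.
exists #|` T| => // r; split.
  have [r1|r1] := leP 1 r; last by rewrite base_count_lt0 ?subr_lt0 // exp0n ?muln0 // dim_gt0.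
  rewrite -ext_lattice_count ?subr_ge0 // -[X in count_in sz O 0 X](subrK 1 r).
  exact: (count_in_mul_le ext_sizeD sO gL ext_lattice_sub ext_finite_ball TT Tr).
move=> r0; rewrite -ext_lattice_count; last by rewrite addr_ge0.
exact: (count_in_le_mul ext_sizeD ext_sizeN ext_lattice_sub ext_finite_ball TT Tr).
Qed.

Local Notation cnt r := (count_in sz O 0 r)%:R.

Lemma ext_count_ub : exists2 C : R, 0 <= C & forall r, 1 <= r -> cnt r <= C * r ^+ d.
Proof.
have [m m0 h] := ext_count_bounds; exists (m%:R * (2 * Cb) ^+ d).
  by rewrite mulr_ge0 ?exprn_ge0 // mulr_ge0 // ltW.
move=> r r1; have r0 : 0 <= r := le_trans ler01 r1.
apply: (@le_trans _ _ (m * b (r + 1) ^ d)%N%:R); first by rewrite ler_nat (h r).2.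
rewrite natrM natrX -mulrA -exprMn ler_wpM2l //.
apply: lerXn2r; rewrite ?nnegrE //; first by rewrite !mulr_ge0 // ltW.
have r2 : 1 <= r + 1 by rewrite lerDr.
apply: le_trans (bs_count_ub bs r2) _; rewrite mulrAC [leRHS]mulrC ler_pM2l //; lra.
Qed.

Lemma ext_count_lb : exists2 C : R, 0 <= C & forall r, 0 <= r -> r ^+ d <= C * cnt r.
Proof.
have [m m0 h] := ext_count_bounds; exists ((2 * Cb) ^+ d).
  by rewrite exprn_ge0 // mulr_ge0 // ltW.
move=> r r0; have C1 := bs_C bs; have Cb0 : 0 <= Cb := ltW C0.
have [r2|r2] := leP 2 r.
  apply: (@le_trans _ _ ((2 * Cb) ^+ d * (b (r - 1) ^ d)%N%:R)); last first.
    rewrite ler_pM2l ?exprn_gt0 ?mulr_gt0 // ler_nat.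
    by apply: leq_trans (h r).1; rewrite leq_pmull.
  rewrite natrX -exprMn; apply: lerXn2r; rewrite ?nnegrE ?mulr_ge0 //.
  have r1 : 0 <= r - 1 by lra.
  by have := bs_count_lb bs r1; rewrite -mulrA; move: (Cb * _) => t; lra.
apply: (@le_trans _ _ ((2 * Cb) ^+ d)).
  by apply: lerXn2r; rewrite ?nnegrE ?mulr_ge0 //; lra.
rewrite ler_peMr ?exprn_ge0 ?mulr_ge0 // ler1n /count_in cardfs_gt0.
apply/fset0Pn; exists 0; rewrite in_fset_set; last exact: ext_finite.
by apply/mem_set; split; [exact: sO.1|rewrite subr0 ext_size0].
Qed.

(** Up to the factor m the counts are compared with d-th powers of base counts u and v, and u^d -
    v^d <= d (u - v) u^(d-1) reduces the claim to the regularity of the base count. *)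
Lemma ext_count_reg : exists2 C : R, 0 <= C & forall n r, 1 <= r ->
  cnt (Y n + r) <= cnt (Y n - r) + C * r * (Y n + r) ^+ d.-1.
Proof.
have [m m0 h] := ext_count_bounds; have Cb0 : 0 <= Cb := ltW C0.
exists (m%:R * (d%:R * (2 * Cb) * (2 * Cb) ^+ d.-1)).
  by rewrite !mulr_ge0 // exprn_ge0 // mulr_ge0.
move=> n r r1; have Y1 := bs_Y1 bs n.
have Yr0 : 0 <= Y n + r by lra.
have up : cnt (Y n + r) <= m%:R * (b (Y n + (r + 1)))%:R ^+ d :> R.
  by rewrite -natrX -natrM ler_nat addrA (h _).2.
have lo : m%:R * (b (Y n - (r + 1)))%:R ^+ d <= cnt (Y n - r) :> R.
  by rewrite -natrX -natrM ler_nat opprD addrA (h _).1.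
set u : R := (b (Y n + (r + 1)))%:R in up; set v : R := (b (Y n - (r + 1)))%:R in lo.
have reg : u - v <= 2 * Cb * r.
  have r1' : 1 <= r + 1 by lra.
  have := bs_count_reg bs n r1'; rewrite -/u -/v.
  have : Cb * 1 <= Cb * r by rewrite ler_pM2l.
  by lra.
have vu : v <= u by rewrite ler_nat base_count_mono //; lra.
have u0 : 0 <= u by [].
have ub : u <= 2 * Cb * (Y n + r).
  have r2 : 1 <= Y n + (r + 1) by lra.
  apply: le_trans (bs_count_ub bs r2) _; rewrite mulrAC [leRHS]mulrC ler_pM2l //; lra.
have key : u ^+ d - v ^+ d <= d%:R * (2 * Cb) * (2 * Cb) ^+ d.-1 * r * (Y n + r) ^+ d.-1.
  apply: le_trans (exprB_le d _ vu) _ => //.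
  have -> : d%:R * (2 * Cb) * (2 * Cb) ^+ d.-1 * r * (Y n + r) ^+ d.-1 =
     d%:R * (2 * Cb * r) * (2 * Cb * (Y n + r)) ^+ d.-1.
    by rewrite [(2 * Cb * (Y n + r)) ^+ _]exprMn; ring.
  apply: ler_pM; rewrite ?mulr_ge0 ?subr_ge0 ?exprn_ge0 //.
    by rewrite ler_wpM2l.
  by apply: lerXn2r; rewrite ?nnegrE //; rewrite !mulr_ge0.
apply: le_trans up _; rewrite -lerBlDl; apply: le_trans (lerB (lexx _) lo) _.
by rewrite -mulrBr; apply: le_trans (ler_wpM2l (ler0n R m) key) _; rewrite !mulrA.
Qed.

(** The elements z n are taken in A, with absolute value of order (B + 1) Y n: multiplication by an
    element of the base scales all sizes exactly, which gives [ls_z_ge]. C adds up all the constants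
    involved. *)
Lemma ext_lattice_size : exists z B C, lattice_size O sz d Y z B C.
Proof.
have [B B0 szM] := ext_sizeM; have [e e1 disc] := ext_discrete.
have [C2 C20 ub] := ext_count_ub; have [C3 C30 lb] := ext_count_lb.
have [C4 C40 reg] := ext_count_reg.
have Cb1 := bs_C bs; have s1 := ext_size_ge0 1.
have zP n : {a : A | (B + 1) * Y n <= av (io a) <= Cb * ((B + 1) * Y n)}.
  apply: cid; apply: (bs_large bs); have := bs_Y1 bs n => Y1.
  by rewrite -[leLHS]mulr1; apply: ler_pM => //; rewrite lerDr.
pose C5 := Cb * (B + 1) * sz 1.
have C50 : 0 <= C5 by rewrite !mulr_ge0 ?addr_ge0 // ltW.
pose C := 1 + e + C2 + C3 + C4 + Cb + C5.
have Cb0 := ltW C0; have e0 : 0 <= e := le_trans ler01 e1.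
have [hC1 hCe hC2 hC3] : [/\ 1 <= C, e <= C, C2 <= C & C3 <= C].
  by rewrite /C; split; lra.
have [hC4 hCb hC5] : [/\ C4 <= C, Cb <= C & C5 <= C].
  by rewrite /C; split; lra.
exists (fun n => ext_emb (sval (zP n))), B, C; split=> //.
- exact: dim_gt0.
- exact: ext_size0.
- exact: ext_size_ge0.
- exact: ext_sizeN.
- exact: ext_sizeD.
- move=> x; have [y Ly xy] := ext_lattice_cobounded x; exists y; first exact: ext_lattice_sub.
  exact: le_trans hC1.
- by move=> x Ox x0; apply: le_trans (disc x Ox x0) _; rewrite ler_wpM2r // ext_size_ge0.
- exact: ext_finite.
- move=> r r1; apply: le_trans (ub r r1) _; rewrite ler_wpM2r // exprn_ge0 //.
  exact: le_trans ler01 r1.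
- by move=> r r0; apply: le_trans (lb r r0) _; rewrite ler_wpM2r.
- move=> n r r1; apply: le_trans (reg n r r1) _; rewrite lerD2l.
  have r0 := le_trans ler01 r1.
  apply: ler_wpM2r; last by rewrite ler_wpM2r.
  by rewrite exprn_ge0 // addr_ge0 //; exact: le_trans ler01 (bs_Y1 bs n).
- exact: (bs_Y1 bs).
- move=> r r1; have [n /andP[h1 h2]] := bs_Ycofinal bs r1; exists n; rewrite h1 /=.
  by apply: le_trans h2 _; rewrite ler_wpM2r // (le_trans ler01 r1).
- by move=> n; exact: ext_integers_emb.
- move=> n; have /andP[_ h] := svalP (zP n).
  have Y0 := le_trans ler01 (bs_Y1 bs n).
  rewrite -[ext_emb _]mulr1 ext_embE ext_sizeZ.
  apply: (@le_trans _ _ (C5 * Y n)); last by rewrite ler_wpM2r.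
  apply: le_trans (ler_wpM2r s1 h) _.
  by rewrite /C5; lra.
- move=> n x; have /andP[h _] := svalP (zP n).
  by rewrite ext_embE ext_sizeZ ler_wpM2r // ext_size_ge0.
Qed.

(** The element comes from A. The trace of p on A is a [prime_subset], and of any m + 1 elements of
    A two agree modulo p when O/p has at most m elements. *)
Lemma ext_prime_product z B C (ls : lattice_size O sz d Y z B C) :
  exists2 Cp : R, 1 <= Cp & forall m, exists a, [/\ O a, a != 0,
    sz a <= Cp * expR (Cp * m%:R)
  & forall p, prime_ideal O p -> (ideal_norm O p <= m)%N -> p a].
Proof.
have s1 := ext_size_ge0 1.
have fin := fin_principal ext_integers1 ext_integersB ext_integersM ls.
exists (1 + sz 1 + Cb); first by rewrite -addrA lerDl addr_ge0 // ltW.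
move=> m; have [a [a0 am aP]] := bs_prime_product bs m.
exists (ext_emb a); split.
- exact: ext_integers_emb.
- by rewrite fmorph_eq0 base_io_neq0.
- rewrite -[ext_emb _]mulr1 ext_embE ext_sizeZ mulrC; apply: ler_pM => //.
  + exact: (bs_ge0 bs).
  + by rewrite addrAC lerDr addr_ge0 // ltW.
  + apply: le_trans am _; rewrite ler_expR ler_wpM2r // lerDr addr_ge0 //.
move=> p pp pm; have ip := ideal_prime pp.
have [T TT] := ideal_transversal ext_integers1 ext_integersB fin ip.
rewrite (ideal_norm_card ext_integers1 ext_integersB ip TT) in pm.
have [[p0 pD pM] pO _ np1 pP] := pp; have [TO Ts Ti] := TT.
apply: (aP [set c | p (ext_emb c)]).
  split=> /=.
  - by move=> c x px; rewrite rmorphM; apply: pM => //; exact: ext_integers_emb.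
  - by rewrite rmorph1.
  - by move=> x y; rewrite rmorphM; apply: pP; exact: ext_integers_emb.
move=> f.
have [g gP] := transversal_rep TT; pose r i := g (ext_emb (f i)).
have rP i : r i \in T /\ p (ext_emb (f i) - r i) := gP _ (ext_integers_emb (f i)).
apply: contrapT => nex.
have inj : injective (fun i : 'I_m.+1 => [` (rP i).1]%fset).
  have wlog_inj (i j : 'I_m.+1) : (i < j)%N -> r i = r j -> False.
    move=> ij e; apply: nex; exists i, j; split; first by rewrite ij -ltnS /=.
    rewrite /= rmorphB.
    have -> : ext_emb (f j) - ext_emb (f i) =
       (ext_emb (f j) - r j) + - (ext_emb (f i) - r i).
      by rewrite e opprB addrA subrK.
    have gp := submodule_subgroup ext_integers1 ext_integersB (And3 p0 pD pM : submodule O p).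
    by apply: gp.2; [exact: (rP j).2|exact: (rP i).2].
  move=> i j /(congr1 val) /= e; apply: val_inj; apply/eqP.
  by case: ltngtP => // ij; [case: (wlog_inj i j ij)|case: (wlog_inj j i ij)].
have := leq_card _ inj; rewrite card_ord -cardfE => h.
by have := leq_trans h pm; rewrite ltnn.
Qed.

End Extension.

(** * Mertens' theorem for a global field *)

Section GlobalField.
Variables (R : realType) (b : global_base) (K : fieldExtType (base_field b)).
Local Notation O := (integers K).
Local Notation N := (ideal_norm O).

Lemma global_integers : exists (A : idomainType) (io : {rmorphism A -> base_field b})
    (av : base_field b -> R) Y C, base_size io av Y C /\ O = ext_integers (K := K) io.
Proof.
case: b K => [|F] L.
  by exists int, intr, (fun x : rat => `|ratr x|), (fun n => n.+1%:R), 8; split;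
    [exact: int_base_size|].
exists {poly F}, (@tofrac {poly F}), (@frac_weight R F), (fun n => 3 / 2 * #|F|%:R ^+ n).
by exists (16 * #|F|%:R); split; [exact: poly_base_size|].
Qed.

Lemma integers1 : O 1.
Proof.
have [A [io [av [Y [C [_ ->]]]]]] := global_integers.
exact: ext_integers1.
Qed.

Lemma integersB x y : O x -> O y -> O (x - y).
Proof.
have [A [io [av [Y [C [_ ->]]]]]] := global_integers.
exact: ext_integersB.
Qed.

Lemma integersM x y : O x -> O y -> O (x * y).
Proof.
have [A [io [av [Y [C [_ ->]]]]]] := global_integers.
exact: ext_integersM.
Qed.

Hypothesis inv : forall I, fractional O I -> exists2 J, fractional O J & ideal_mul I J = O.

Lemma global_mertens :
  [/\ forall m, finite_set [set p | prime_ideal O p /\ (N p <= m)%N],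
      forall p, prime_ideal O p -> (1 < N p)%N
    & exists C : R, forall m, (0 < m)%N ->
      `|\sum_(p <- upto (prime_ideal O) N m) ln (N p)%:R / (N p)%:R - ln m%:R| <= C].
Proof.
have O1 := integers1; have OB := integersB; have OM := integersM.
have [A [io [av [Y [C [bs eO]]]]]] := global_integers.
have [D D0 OD] := integral_basis_scale bs K.
have [z [B [C' ls]]] := ext_lattice_size bs D0 OD.
have [Cp Cp1 pp] := ext_prime_product bs ls.
rewrite -eO in ls pp.
split.
- exact: (finite_primes O1 OB OM inv ls pp).
- exact: (norm_gt1 O1 OB OM ls).
- exact: (mertens O1 OB OM inv ls Cp1 pp).
Qed.

End GlobalField.

(** * Consequences of Mertens' theorem *)

Section MertensConsequences.
Variables (R : realType) (T : choiceType) (S : set T) (N : T -> nat).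
Hypothesis finS : forall n, finite_set [set p | S p /\ (N p <= n)%N].
Hypothesis N_gt1 : forall p, S p -> (1 < N p)%N.
Variable C : R.
Local Notation upto := (upto S N).
Hypothesis mertens : forall m, (0 < m)%N ->
  `|\sum_(p <- upto m) ln (N p)%:R / (N p)%:R - ln m%:R| <= C.

Let C0 : 0 <= C. Proof. exact: le_trans (normr_ge0 _) (mertens (ltn0Sn 0)). Qed.

Let A m : R := \sum_(p <- upto m) ln (N p)%:R / (N p)%:R.

Let A0 m : (m <= 1)%N -> A m = 0.
Proof.
move=> m1; rewrite /A big_seq big1 // => p /(in_upto finS)[/N_gt1 h1 h2].
by have := leq_trans h1 (leq_trans h2 m1).
Qed.

Lemma ln_natS_sub_le k : (0 < k)%N -> ln k.+1%:R - ln k%:R <= k%:R^-1 :> R.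
Proof.
move=> k0; have kR : 0 < k%:R :> R by rewrite ltr0n.
rewrite -ln_div ?posrE ?ltr0n //.
have -> : k.+1%:R / k%:R = 1 + k%:R^-1 :> R by rewrite -natr1; field; rewrite gt_eqF.
by apply: le_ln1Dx; apply: lt_trans (_ : 0 < _); rewrite ?invr_gt0 // ltrN10.
Qed.

Lemma sum_inv_norm_abel n : (2 <= n)%N ->
  \sum_(p <- upto n) (N p)%:R^-1 = A n / ln n%:R +
    \sum_(2 <= k < n) A k * ((ln k%:R)^-1 - (ln k.+1%:R)^-1).
Proof.
move=> n2.
have -> : \sum_(p <- upto n) (N p)%:R^-1 =
    \sum_(p <- upto n) (ln (N p)%:R / (N p)%:R) * (ln (N p)%:R)^-1 :> R.
  rewrite big_seq [RHS]big_seq; apply: eq_bigr => p /(upto_gt1 finS N_gt1) h.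
  by rewrite mulrAC mulfV ?mul1r // gt_eqF // ln_gt0 // ltr1n.
rewrite (partial_summation finS N_gt1 _ (fun k => (ln k%:R)^-1)); congr (_ + _).
rewrite -(big_mkord xpredT (fun k => A k * ((ln k%:R)^-1 - (ln k.+1%:R)^-1))).
(* At k = 0 and k = 1, where 1 / ln k is a default value, [A k] vanishes. *)
rewrite (big_cat_nat (n := 2)) //= big_nat big1 ?add0r // => k k2.
by rewrite A0 ?mul0r.
Qed.

(** Replacing A k by ln k in the partial summation costs a telescoping error. For u = ln k and v =
    ln (k + 1), ln (v / u) lies between (v - u) / v and (v - u) / u; these differ by at most 1 / u -
    1 / v, which telescopes again. *)
Lemma sum_inv_norm : exists K : R, forall n, (2 <= n)%N ->
  `|\sum_(p <- upto n) (N p)%:R^-1 - ln (ln n%:R)| <= K.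
Proof.
have l2 : 0 < ln 2 :> R by rewrite ln_gt0 // ltr1n.
have lk k : (2 <= k)%N -> ln 2 <= ln k%:R :> R.
  by move=> k2; rewrite ler_ln ?posrE ?ltr0n ?ler_nat // (leq_trans _ k2).
have lk0 k : (2 <= k)%N -> 0 < ln k%:R :> R by move=> /lk; exact: lt_le_trans.
pose g k : R := (ln k%:R)^-1.
have gd k : (2 <= k)%N -> 0 <= g k - g k.+1.
  move=> k2; rewrite subr_ge0 lef_pV2 ?posrE ?lk0 // ?(leqW k2) //.
  by rewrite ler_ln ?posrE ?ltr0n ?ler_nat // (leq_trans _ k2).
have g2 n : (2 <= n)%N -> 0 < g n <= (ln 2)^-1.
  by move=> n2; rewrite invr_gt0 lk0 //= lef_pV2 ?posrE ?lk0 // lk.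
have sg n : (2 <= n)%N -> \sum_(2 <= k < n) (g k - g k.+1) = g 2 - g n.
  move=> n2; rewrite -(opprB (g n)) -(telescope_sumr g n2) -sumrN.
  by apply: eq_bigr => k _; rewrite opprB.
have main k : (2 <= k)%N ->
   ln (ln k.+1%:R) - ln (ln k%:R) - (g k - g k.+1) <= ln k%:R * (g k - g k.+1) <=
   ln (ln k.+1%:R) - ln (ln k%:R).
  move=> k2; have u0 := lk0 k k2; have v0 := lk0 k.+1 (leqW k2).
  have uv : ln k.+1%:R - ln k%:R <= 1 :> R.
    apply: le_trans (ln_natS_sub_le _) _; first exact: leq_trans k2.
    by rewrite invf_le1 ?ltr0n ?ler1n // (leq_trans _ k2).
  have uv0 : ln k%:R <= ln k.+1%:R :> R.
    by rewrite ler_ln ?posrE ?ltr0n ?ler_nat // (leq_trans _ k2).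
  have gk := gd k k2; rewrite /g in gk *.
  set u : R := ln k%:R in u0 uv uv0 gk *; set v : R := ln k.+1%:R in v0 uv uv0 gk *.
  have e1 : u * (u^-1 - v^-1) = (v - u) / v by field; rewrite !gt_eqF.
  have e2 : (v - u) / v = (v - u) / u - (v - u) * (u^-1 - v^-1) by field; rewrite !gt_eqF.
  have lvu : ln v - ln u <= (v - u) / u.
    rewrite -ln_div ?posrE //; have -> : v / u = 1 + (v - u) / u by field; rewrite gt_eqF.
    apply: le_ln1Dx; apply: lt_le_trans (_ : 0 <= _); first exact: ltrN10.
    by rewrite divr_ge0 ?subr_ge0 // ltW.
  have luv : ln u - ln v <= - ((v - u) / v).
    rewrite -ln_div ?posrE //; have -> : u / v = 1 + (- ((v - u) / v)) by field; rewrite gt_eqF.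
    apply: le_ln1Dx; rewrite ltrN2 ltr_pdivrMr // mul1r.
    by rewrite ltrBlDr ltrDl.
  rewrite e1; apply/andP; split; last by lra.
  have : (v - u) * (u^-1 - v^-1) <= 1 * (u^-1 - v^-1) by apply: ler_wpM2r.
  rewrite e2; lra.
have Cl : 0 <= C / ln 2 by rewrite divr_ge0 // ltW.
have l20 : 0 <= (ln 2)^-1 :> R by rewrite invr_ge0 ltW.
exists (1 + `|ln (ln 2)| + (ln 2)^-1 + C / ln 2 + C / ln 2) => n n2.
rewrite sum_inv_norm_abel //.
have /andP[gn0 gn] := g2 n n2.
have sgn : \sum_(2 <= k < n) (g k - g k.+1) <= (ln 2)^-1.
  by rewrite sg // lerBlDr lerDl ltW.
have err : `|\sum_(2 <= k < n) A k * (g k - g k.+1) -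
    \sum_(2 <= k < n) ln k%:R * (g k - g k.+1)| <= C / ln 2.
  rewrite -sumrB; apply: le_trans (ler_norm_sum _ _ _) _.
  apply: (@le_trans _ _ (\sum_(2 <= k < n) C * (g k - g k.+1))); last first.
    by rewrite -mulr_sumr; apply: ler_wpM2l.
  rewrite big_nat [leRHS]big_nat; apply: ler_sum => k /andP[k2 _].
  rewrite -mulrBl normrM (ger0_norm (gd k k2)); apply: ler_wpM2r; first exact: gd.
  exact/mertens/(leq_trans _ k2).
have first : `|A n / ln n%:R - 1| <= C / ln 2.
  have -> : A n / ln n%:R - 1 = (A n - ln n%:R) * g n by rewrite /g; field; rewrite gt_eqF // lk0.
  rewrite normrM (gtr0_norm gn0); apply: ler_pM => //; first exact: ltW.
  exact/mertens/(leq_trans _ n2).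
have tele : \sum_(2 <= k < n) (ln (ln k.+1%:R) - ln (ln k%:R)) = ln (ln n%:R) - ln (ln 2) :> R.
  exact: (telescope_sumr (fun k => ln (ln k%:R))).
have up : \sum_(2 <= k < n) ln k%:R * (g k - g k.+1) <= ln (ln n%:R) - ln (ln 2).
  rewrite -tele big_nat [leRHS]big_nat; apply: ler_sum => k /andP[k2 _].
  by have /andP[] := main k k2.
have lo : ln (ln n%:R) - ln (ln 2) - (ln 2)^-1 <= \sum_(2 <= k < n) ln k%:R * (g k - g k.+1).
  apply: (@le_trans _ _ (\sum_(2 <= k < n)
     (ln (ln k.+1%:R) - ln (ln k%:R) - (g k - g k.+1)))).
    by rewrite sumrB tele lerD2l lerN2.
  rewrite big_nat [leRHS]big_nat; apply: ler_sum => k /andP[k2 _].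
  by have /andP[] := main k k2.
have a1 := ler_norm (ln (ln 2 : R)).
have a2 := ler_norm (- ln (ln 2 : R)); rewrite normrN in a2.
move: err first; rewrite !ler_norml => /andP[h1 h2] /andP[h3 h4].
move: up lo h1 h2; rewrite /g.
move: (\sum_(2 <= k < n) ln k%:R * _) (\sum_(2 <= k < n) A k * _) => s1 s2 up lo h1 h2.
by apply/andP; split; lra.
Qed.

(** Between m, the integer part of n / D, and n the sum in Mertens' theorem grows by at least ln (n
    / m) - 2 C >= 1; hence D = exp(2 C + 1), rounded up. Each prime in that range contributes at
    most D ln n / n. *)
Lemma count_norm_ge : exists2 c : R, 0 < c & exists n0, forall n, (n0 <= n)%N ->
  c * n%:R <= (size (upto n))%:R * ln n%:R.
Proof.
pose Dr : R := expR (2 * C + 1); have Dr0 : 0 < Dr by exact: expR_gt0.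
pose D := (Num.truncn Dr).+1; have DD : Dr < D%:R by have /andP[] := truncn_itv (ltW Dr0).
exists (D%:R^-1 : R); first by rewrite invr_gt0 ltr0n.
exists D => n Dn; pose m := (n %/ D)%N.
have D0 : (0 < D)%N by [].
have n0 : (0 < n)%N := leq_trans D0 Dn.
have m0 : (0 < m)%N by rewrite divn_gt0.
have mn : (m <= n)%N by exact: leq_div.
have nm : (n < m.+1 * D)%N by exact: ltn_ceil.
have mD : (m * D <= n)%N by exact: leq_divM.
have lnm : 2 * C + 1 <= ln n%:R - ln m%:R.
  rewrite -ln_div ?posrE ?ltr0n // -ler_expR lnK ?posrE ?divr_gt0 ?ltr0n //.
  apply: le_trans (ltW DD) _; rewrite ler_pdivlMr ?ltr0n // -natrM ler_nat.
  by rewrite mulnC.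
have Am : 1 <= A n - A m.
  have := mertens n0; have := mertens m0; rewrite -/(A m) -/(A n) !ler_norml.
  by move=> /andP[h1 h2] /andP[h3 h4]; lra.
apply: le_trans (_ : n%:R / D%:R * (A n - A m) <= _).
  by rewrite mulrC ler_peMr // divr_ge0.
rewrite -ler_pdivlMl ?divr_gt0 ?ltr0n // invf_div.
apply: le_trans (_ : \sum_(p <- upto n) D%:R / n%:R * ln n%:R <= _); last first.
  rewrite big_const_seq count_predT iter_addr_0 -mulr_natr.
  by rewrite le_eqVlt; apply/orP; left; apply/eqP; ring.
rewrite /A (upto_sumB finS _ mn) big_mkcond big_seq [leRHS]big_seq.
apply: ler_sum => p /(in_upto finS)[Sp pn]; have p1 := N_gt1 Sp.
have ln0 : 0 <= ln n%:R :> R by rewrite ln_ge0 // ler1n.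
case: ifP => mp; last by rewrite mulr_ge0 // divr_ge0.
rewrite mulrC; apply: ler_pM; rewrite ?invr_ge0 ?ln_ge0 ?ler1n ?(ltnW p1) //.
  rewrite -[leRHS]invf_div lef_pV2 ?posrE ?divr_gt0 ?ltr0n ?(ltnW p1) //.
  rewrite ler_pdivrMr ?ltr0n // -natrM ler_nat.
  by apply: leq_trans (ltnW nm) _; rewrite leq_mul2r mp orbT.
by rewrite ler_ln ?posrE ?ltr0n ?ler_nat // ltnW.
Qed.

End MertensConsequences.

(** * Characters of finite commutative groups *)

Section AbelianCharacters.
Variables (F : numClosedFieldType) (gT : finGroupType).
Hypothesis comm : forall s t : gT, (s * t = t * s)%g.

Definition character (chi : gT -> F) : Prop :=
  chi 1%g = 1 /\ forall s t, chi (s * t)%g = chi s * chi t.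

Lemma Xn_sub_1_split n : (0 < n)%N ->
  exists2 rs : seq F, uniq rs & 'X^n - 1 = \prod_(z <- rs) ('X - z%:P).
Proof.
move=> n0; have n1 : n%:R != 0 :> F by rewrite pnatr_eq0 -lt0n.
have [rs e] := closed_field_poly_normal ('X^n - 1 : {poly F}).
have m : 'X^n - 1 \is @monic F by exact: monicXnsubC.
rewrite (monicP m) scale1r in e; exists rs => //.
by rewrite -separable_prod_XsubC -e separable_Xn_sub_1.
Qed.

(* The matrices of a faithful representation commute and have finite order, so
   they are simultaneously diagonalizable; each diagonal entry is a character. *)
Lemma character_separates a : a != 1%g -> exists2 chi, character chi & chi a != 1.
Proof.
move=> a1; pose G := [set: gT]%G.
have := regular_mx_faithful F G; move: (gcard G) (regular_repr F G) => [|m] rG faith.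
  case/negP: a1; apply/eqP; apply: (mx_faithful_inj faith); rewrite ?inE //.
  by apply/matrixP => i; have := ltn_ord i.
have XG s : rG s ^+ #|G| = 1.
  by rewrite -repr_mxX ?inE // expg_cardG ?inE // repr_mx1.
pose As := [seq rG s | s <- enum gT].
have [P Pu PD] : exists2 P, P \in unitmx & all [pred A | similar_diag P A] As.
  apply/codiagonalizableP; split.
    move=> _ _ /mapP[s _ ->] /mapP[t _ ->]; rewrite /comm_mx.
    by rewrite -!repr_mxM ?inE // comm.
  move=> _ /mapP[s _ ->]; apply/diagonalizableP.
  have [rs urs e] := Xn_sub_1_split (cardG_gt0 G); exists rs => //.
  rewrite -e; apply: mxminpoly_min.
  by rewrite rmorphB rmorphXn /= horner_mx_X rmorph1 XG subrr.
pose D s := P *m rG s *m invmx P.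
have Dd s : is_diag_mx (D s).
  have /allP/(_ (rG s)) := PD; rewrite /D -conjumx // => /(_ _)/= h.
  by apply: h; apply/mapP; exists s; rewrite ?mem_enum.
have D1 : D 1%g = 1%:M by rewrite /D repr_mx1 mulmx1 mulmxV.
have DM s t : D (s * t)%g = D s *m D t.
  rewrite /D repr_mxM ?inE // !mulmxA; congr (_ *m _ *m _).
  by rewrite -[LHS]mulmx1 -(mulVmx Pu) mulmxA.
have [i Di] : exists i, D a i i != 1.
  apply/existsP; apply: contraNT a1 => /existsPn h.
  have Da : D a = 1%:M.
    apply/matrixP => i j; rewrite [RHS]mxE; have [<-|ij] := eqVneq i j.
      by have := h i; rewrite negbK => /eqP ->.
    by have /is_diag_mxP/(_ i j ij) := Dd a.
  apply/eqP; apply: (mx_faithful_inj faith); rewrite ?inE // repr_mx1.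
  have : invmx P *m D a *m P = 1%:M by rewrite Da mulmx1 mulVmx.
  by rewrite /D !mulmxA mulVmx // mul1mx -mulmxA mulVmx // mulmx1.
exists (fun s => D s i i) => //; split; first by rewrite D1 mxE eqxx.
move=> s t; rewrite DM [LHS]mxE (bigD1 i) //= big1 ?addr0 // => j ji.
by have /is_diag_mxP/(_ i j) := Dd s; rewrite eq_sym ji => /(_ isT) ->; rewrite mul0r.
Qed.

Lemma character_neq0 chi s : character chi -> chi s != 0.
Proof.
move=> [c1 cM]; apply/eqP => c0; have := cM s s^-1%g.
by rewrite mulgV c1 c0 mul0r; apply/eqP/oner_neq0.
Qed.

Lemma characterX chi s n : character chi -> chi (s ^+ n)%g = chi s ^+ n.
Proof. by move=> [c1 cM]; elim: n => [|n IH]; rewrite ?expg0 // expgS exprS cM IH. Qed.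

Lemma character_unity chi s : character chi -> chi s ^+ #|gT| = 1.
Proof.
move=> cc; rewrite -characterX //.
have -> : (s ^+ #|gT| = 1)%g.
  by rewrite -cardsT; apply: (@expg_cardG _ [set: gT]%G); rewrite inE.
by case: cc.
Qed.

Lemma character_norm chi s : character chi -> `|chi s| = 1.
Proof.
move=> /(character_unity s) e.
have n0 : (0 < #|gT|)%N by rewrite -cardsT cardG_gt0.
by apply/eqP; rewrite -(pexpr_eq1 n0) // -normrX e normr1.
Qed.

Lemma finite_characters : finite_set character.
Proof.
have n0 : (0 < #|gT|)%N by rewrite -cardsT cardG_gt0.
have [rs urs e] := Xn_sub_1_split n0.
have crs chi s : character chi -> chi s \in rs.
  move=> /(character_unity s) h; rewrite -root_prod_XsubC -e rootE.
  by rewrite !(hornerE, hornerXn) h subrr.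
pose f (chi : gT -> F) : {ffun gT -> option (seq_sub rs)} := [ffun s => insub (chi s)].
apply: (@finite_set_injective _ _ _ f) => chi psi cc cp fe.
apply: funext => s; have := congr1 (fun g : {ffun gT -> option (seq_sub rs)} => g s) fe.
rewrite /f !ffunE (insubT (fun x => x \in rs) (crs chi s cc)).
by rewrite (insubT (fun x => x \in rs) (crs psi s cp)) => -[].
Qed.

Local Notation X := (fset_set character).

Lemma in_characters chi : (chi \in X) <-> character chi.
Proof.
rewrite in_fset_set; last exact: finite_characters.
by split=> [/set_mem|/mem_set].
Qed.

Lemma sum_character chi : character chi -> (exists s, chi s != 1) ->
  \sum_s chi s = 0.
Proof.
move=> cc [t ct]; have [c1 cM] := cc.
have e : chi t * \sum_s chi s = \sum_s chi s.
  rewrite mulr_sumr [RHS](reindex_inj (mulgI t)) /=.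
  by apply: eq_bigr => s _; rewrite cM.
apply/eqP; move/eqP: e; rewrite -subr_eq0 -[X in _ - X]mul1r -mulrBl mulf_eq0.
by rewrite subr_eq0 (negPf ct).
Qed.

(** Multiplication by a character psi with psi a != 1 permutes the characters and multiplies the sum
    by psi a. *)
Lemma sum_characters a : a != 1%g -> \sum_(chi <- X) chi a = 0.
Proof.
move=> /character_separates[psi cp pa].
pose m (chi : gT -> F) : gT -> F := fun s => psi s * chi s.
have mi : injective m.
  move=> c c' e; apply: funext => s; apply: (mulfI (character_neq0 s cp)).
  exact: (congr1 (fun g : gT -> F => g s) e).
have mc chi : character chi -> character (m chi).
  move=> [c1 cM]; have [p1 pM] := cp; rewrite /m; split; first by rewrite p1 c1 mulr1.
  by move=> s t; rewrite cM pM mulrACA.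
have mX : (m @` X)%fset = X.
  apply/eqP; rewrite eqEfcard card_imfset //= leqnn andbT.
  by apply/fsubsetP => _ /imfsetP[chi /= /in_characters/mc cc ->]; apply/in_characters.
have e : psi a * \sum_(chi <- X) chi a = \sum_(chi <- X) chi a.
  rewrite -[in RHS]mX big_imfset /=; last by move=> ? ? _ _ /mi.
  by rewrite mulr_sumr.
apply/eqP; move/eqP: e; rewrite -subr_eq0 -[X in _ - X]mul1r -mulrBl mulf_eq0.
by rewrite subr_eq0 (negPf pa).
Qed.

Lemma trivial_character : character (fun=> 1).
Proof. by split=> // s t; rewrite mulr1. Qed.

Lemma character_nontrivial (chi : gT -> F) : chi != (fun=> 1) -> exists s, chi s != 1.
Proof.
move=> h; apply: contrapT => nex; case/negP: h; apply/eqP/funext => s.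
by apply: contrapT => hs; apply: nex; exists s; apply/eqP.
Qed.

Lemma sum_one_group : \sum_(s : gT) 1 = #|gT|%:R :> F.
Proof. by rewrite sumr_const. Qed.

Lemma card_characters : (size X)%:R = #|gT|%:R :> F.
Proof.
have e : \sum_(s : gT) \sum_(chi <- X) chi s = (size X)%:R.
  rewrite (bigD1 1%g) //= [X in _ + X]big1 ?addr0 => [|s]; last exact: sum_characters.
  rewrite big_seq (eq_bigr (fun=> 1)) => [|chi /in_characters[] //].
  by rewrite -big_seq big_const_seq count_predT iter_addr_0.
rewrite -e exchange_big /= (big_fsetD1 (fun=> 1)) /=; last exact/in_characters/trivial_character.
rewrite [X in _ + X]big_seq [X in _ + X]big1 ?addr0 ?sum_one_group // => chi.
rewrite in_fsetD1 => /andP[c1 /in_characters cc].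
by apply: sum_character => //; exact: character_nontrivial.
Qed.

(** Sum chi(s^2) over all chi and s. If no nontrivial chi had chi^2 = 1, only the trivial character
    would contribute and the sum would be |G|. Summed over chi first, it is |G| times the number of
    s with s^2 = 1, which is at least 2 by Cauchy's theorem. *)
Lemma character_order2 : ~~ odd #|gT| -> exists chi, [/\ character chi,
  exists s, chi s != 1 & forall s, chi s ^+ 2 = 1].
Proof.
move=> ev; apply: contrapT => nex.
have d2 : (2 %| #|[set: gT]%G|)%N by rewrite cardsT dvdn2.
have [a _ a2] := @Cauchy _ 2 [set: gT]%G isT d2.
have sq chi : character chi -> character (fun s => chi (s * s)%g).
  move=> [c1 cM]; split; first by rewrite mulg1.
  by move=> s t; rewrite !cM mulrACA.
have e1 : \sum_(s : gT) \sum_(chi <- X) chi (s * s)%g = #|gT|%:R :> F.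
  rewrite exchange_big /= (big_fsetD1 (fun=> 1)) /=; last exact/in_characters/trivial_character.
  rewrite [X in _ + X]big_seq [X in _ + X]big1 ?addr0 ?sum_one_group // => chi.
  rewrite in_fsetD1 => /andP[c1 /in_characters cc].
  apply: (sum_character (sq chi cc)); apply: contrapT => h; apply: nex; exists chi; split=> //.
    exact: character_nontrivial.
  move=> s; have [_ cM] := cc; rewrite expr2 -cM.
  by apply: contrapT => hs; apply: h; exists s; apply/eqP.
have e2 : \sum_(s : gT) \sum_(chi <- X) chi (s * s)%g =
    #|[set s : gT | (s * s == 1)%g]%SET|%:R * #|gT|%:R :> F.
  rewrite (bigID (fun s : gT => (s * s == 1)%g)) /= [X in _ + X]big1 ?addr0; last first.
    by move=> s; exact: sum_characters.
  rewrite (eq_bigr (fun=> #|gT|%:R)) => [|s /eqP ->].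
    by rewrite sumr_const mulr_natl cardsE.
  rewrite -card_characters big_seq (eq_bigr (fun=> 1)) => [|chi /in_characters[] //].
  by rewrite -big_seq big_const_seq count_predT iter_addr_0.
have n0 : #|gT|%:R != 0 :> F by rewrite pnatr_eq0 -lt0n -cardsT cardG_gt0.
move: e1; rewrite e2 -[RHS]mul1r => /(mulIf n0)/eqP; rewrite pnatr_eq1.
suff : (1 < #|[set s : gT | (s * s == 1)%g]%SET|)%N by case: #|_| => // -[].
rewrite (cardsD1 1%g) inE mulg1 eqxx (cardsD1 a) !inE.
have -> : a != 1%g by apply/eqP => a1; move: a2; rewrite a1 order1.
have aa : (a * a)%g = 1%g by have := expg_order a; rewrite a2.
by rewrite aa eqxx.
Qed.

(** Fourier inversion: pairing the relation with psi^-1 leaves |G| m(psi). It serves to pass from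
    m(sigma) = 0 for all sigma to m_chi = 0. *)
Lemma character_coef_eq0 (m : (gT -> F) -> F) (Y : set (gT -> F)) :
  Y `<=` character -> (forall s, \sum_(chi \in Y) chi s * m chi = 0) ->
  forall psi, Y psi -> m psi = 0.
Proof.
move=> YX h psi Ypsi.
have finY : finite_set Y := sub_finite_set YX finite_characters.
have YP chi : (chi \in fset_set Y) <-> Y chi.
  by rewrite in_fset_set //; split=> [/set_mem|/mem_set].
have e : \sum_s (psi s)^-1 * \sum_(chi <- fset_set Y) chi s * m chi = 0.
  by rewrite big1 // => s _; rewrite -fsbig_finite // h mulr0.
have n0 : #|gT|%:R != 0 :> F by rewrite pnatr_eq0 -lt0n -cardsT cardG_gt0.
have cp := YX _ Ypsi; apply: (mulfI n0); rewrite mulr0 -[RHS]e.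
under [RHS]eq_bigr do rewrite mulr_sumr.
rewrite exchange_big (big_fsetD1 psi) /=; last exact/YP.
rewrite [X in _ + X]big_seq [X in _ + X]big1 ?addr0 => [|chi].
  rewrite (eq_bigr (fun=> m psi)) ?sumr_const ?mulr_natl // => s _.
  by rewrite mulrA mulVf ?mul1r // character_neq0.
rewrite in_fsetD1 => /andP[cp' /YP/YX cc].
under eq_bigr do rewrite mulrA.
rewrite -mulr_suml.
have -> : \sum_s (psi s)^-1 * chi s = 0; last by rewrite mul0r.
apply: (@sum_character (fun s => (psi s)^-1 * chi s)).
  have [c1 cM] := cc; have [p1 pM] := cp; split; first by rewrite p1 c1 invr1 mulr1.
  by move=> s t; rewrite cM pM invfM mulrACA.
apply: contrapT => nex; case/negP: cp'; apply/eqP/funext => s.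
apply: contrapT => hs; apply: nex; exists s; apply/eqP => hs'; apply: hs.
by apply: (mulfI (_ : (psi s)^-1 != 0)); rewrite ?invr_eq0 ?character_neq0 // hs' mulVf ?character_neq0.
Qed.

End AbelianCharacters.

(** * Euler products at 1/2 *)

Section LogExpansion.
Variable R : realType.

Lemma ln1B_derive (K x : R) : x < 1 ->
  is_derive x 1 (fun t : R => ln (1 - t) + t + t ^+ 2 / 2 + K * t ^+ 3)
    (- (1 - x)^-1 + 1 + x + 3 * K * x ^+ 2).
Proof.
move=> x1; have x0 : 0 < 1 - x by rewrite subr_gt0.
have d1 := is_derive1_ln x0.
have d2 : is_derive x 1 (fun t : R => 1 - t) (-1).
  apply: is_derive_eq. by rewrite add0r mul1r.
have d3 := @is_derive1_comp R (@ln R) (fun t => 1 - t) x _ _ d1 d2.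
have d4 := is_derive_id x (1 : R).
have d5 : is_derive x 1 (fun t : R => t ^+ 2 / 2) x.
  have -> : (fun t : R => t ^+ 2 / 2) = 2^-1 *: (id ^+ 2 : R -> R).
    by apply: funext => t; rewrite !fctE mulrC.
  by apply: is_derive_eq; rewrite /GRing.scale /= expr1 mulr1 mulKf ?pnatr_eq0.
have d6 : is_derive x 1 (fun t : R => K * t ^+ 3) (3 * K * x ^+ 2).
  have -> : (fun t : R => K * t ^+ 3) = K *: (id ^+ 3 : R -> R).
    by apply: funext => t; rewrite !fctE.
  by apply: is_derive_eq; rewrite /GRing.scale /= mulr1 mulrCA mulrA.
apply: (is_derive_eq (is_deriveD (is_deriveD (is_deriveD d3 d4) d5) d6)).
by rewrite mulrN1.
Qed.

(* With [K = 0] the derivative is [- t^2 / (1 - t)]; the cubic correction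
   makes it nonnegative. *)
Lemma ln1B_third_order (t : R) : t <= 45 / 49 ->
  `|ln (1 - t) + t + t ^+ 2 / 2| <= 5 * `|t| ^+ 3.
Proof.
pose f (K t : R) : R := ln (1 - t) + t + t ^+ 2 / 2 + K * t ^+ 3.
have f0 K : f K 0 = 0 by rewrite /f subr0 ln1 !expr0n /= mul0r mulr0 !addr0.
have fd (K x : R) : x < 1 -> derivable (f K) x 1.
  by move=> x1; have := ln1B_derive K x1; case.
have fE (K x : R) : x < 1 -> derive1 (f K) x = x ^+ 2 * (3 * K - (1 - x)^-1).
  move=> x1; rewrite derive1E (@derive_val _ _ _ _ _ _ _ (ln1B_derive K x1)).
  have x0 : 1 - x != 0 by rewrite gt_eqF // subr_gt0.
  by field.
have fc (K a c : R) : c < 1 -> {within `[a, c], continuous (f K)}.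
  move=> c1; apply: derivable_within_continuous => x; rewrite in_itv /= => /andP[_ xc].
  by apply: fd; exact: le_lt_trans c1.
have decr (a c : R) : a <= c -> c < 1 -> f 0 c <= f 0 a.
  move=> ac c1; apply: (@ler0_derive1_le_cc _ (f 0) a c) => // [x|x| | |].
  - by rewrite in_itv /= => /andP[_ xc]; apply: fd; exact: lt_trans c1.
  - rewrite in_itv /= => /andP[_ xc]; have x1 := lt_trans xc c1.
    rewrite fE // mulr0 sub0r mulrN oppr_le0 mulr_ge0 ?sqr_ge0 //.
    by rewrite invr_ge0 subr_ge0 ltW.
  - exact: fc.
  - by rewrite in_itv /= lexx ?ac.
  - by rewrite in_itv /= lexx ?ac.
have incr (a c : R) : a <= c -> c <= 45 / 49 -> f 5 a <= f 5 c.
  move=> ac c1; have c1' : c < 1 by lra.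
  apply: (@ger0_derive1_le_cc _ (f 5) a c) => // [x|x| | |].
  - by rewrite in_itv /= => /andP[_ xc]; apply: fd; exact: lt_trans c1'.
  - rewrite in_itv /= => /andP[_ xc]; have x1 := lt_trans xc c1'.
    rewrite fE // mulr_ge0 ?sqr_ge0 // subr_ge0.
    (* For x < 45 / 49, 1 / (1 - x) < 49 / 4 < 15. *)
    rewrite -[leRHS]invrK lef_pV2 ?posrE ?subr_gt0 ?invr_gt0 //; lra.
  - exact: fc.
  - by rewrite in_itv /= lexx ?ac.
  - by rewrite in_itv /= lexx ?ac.
move=> t1.
have -> : ln (1 - t) + t + t ^+ 2 / 2 = f 0 t by rewrite /f mul0r addr0.
have e : f 5 t = f 0 t + 5 * t ^+ 3 by rewrite /f mul0r addr0.
have [t0|/ltW t0] := leP 0 t.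
  have h1 := decr 0 t t0 (le_lt_trans t1 _); have h2 := incr 0 t t0 t1.
  rewrite f0 in h1; rewrite f0 e in h2.
  have {}h1 : f 0 t <= 0 by apply: h1; lra.
  by rewrite (ger0_norm t0) ler0_norm //; lra.
have h1 := decr t 0 t0 ltr01; have h2 := incr t 0 t0 _.
rewrite f0 in h1; rewrite f0 e in h2.
have {}h2 : f 0 t + 5 * t ^+ 3 <= 0 by apply: h2; lra.
rewrite (ler0_norm t0) (ger0_norm h1) exprNn -signr_odd /= expr1; lra.
Qed.

End LogExpansion.

Lemma bounded_of_eventually (R : realDomainType) (f : nat -> R) n0 C :
  (forall n, (n0 <= n)%N -> `|f n| <= C) -> exists D, forall n, `|f n| <= D.
Proof.
move=> fC; exists (`|C| + \sum_(k < n0) `|f k|) => n; have [nn|nn] := leqP n0 n.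
  apply: le_trans (fC _ nn) _; apply: le_trans (ler_norm C) _.
  by rewrite lerDl sumr_ge0.
apply: ler_wpDl => //; rewrite (bigD1 (Ordinal nn)) //= lerDl sumr_ge0 //.
Qed.

Lemma bounded_sum (R : realDomainType) (I : choiceType) (A : pred nat) (r : seq I) (w : nat -> R)
    (f : I -> nat -> R) : (forall n, 0 <= w n) ->
  (forall i, i \in r -> exists C, forall n, A n -> `|f i n| <= C * w n) ->
  exists C, forall n, A n -> `|\sum_(i <- r) f i n| <= C * w n.
Proof.
move=> w0; elim: r => [_|i r IH fC].
  by exists 0 => n _; rewrite big_nil normr0 mul0r.
have [|C rC] := IH; first by move=> j jr; apply: fC; rewrite in_cons jr orbT.
have [D iD] := fC i (mem_head _ _); exists (D + C) => n An.
by rewrite big_cons mulrDl (le_trans (ler_normD _ _)) // lerD ?iD ?rC.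
Qed.

Section EulerFactors.
Variables (R : realType) (T : choiceType) (S : set T) (N : T -> nat).
Hypothesis finS : forall n, finite_set [set p | S p /\ (N p <= n)%N].
Hypothesis N_gt1 : forall p, S p -> (1 < N p)%N.
Variable C : R.
Local Notation upto := (upto S N).
Hypothesis mertens : forall m, (0 < m)%N ->
  `|\sum_(p <- upto m) ln (N p)%:R / (N p)%:R - ln m%:R| <= C.

Let C0 : 0 <= C. Proof. exact: le_trans (normr_ge0 _) (mertens (ltn0Sn 0)). Qed.

Lemma ln_le_qrt n : (0 < n)%N -> ln n%:R <= 4 * qrt R n.
Proof.
move=> n0; have q0 := qrt_gt0 R n0.
have -> : n%:R = qrt R n ^+ 4 by rewrite (exprM _ 2 2) qrt_sqr sqrt_sqr.
by rewrite lnXn // -(mulr_natl (ln _)) ler_wpM2l // ltW // ln_sublinear.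
Qed.

(** Weaker than [sum_inv_norm], but in the shape that [sum_div_norm_le] takes; it follows from
    Mertens' theorem by ln N(p) >= ln 2 and ln n <= 4 n^(1/4). *)
Lemma sum_inv_norm_le_qrt :
  exists2 D : R, 0 <= D & forall n, \sum_(p <- upto n) (N p)%:R^-1 <= D * qrt R n.
Proof.
have l2 : 0 < ln 2 :> R by rewrite ln_gt0 // ltr1n.
exists ((ln 2)^-1 * (C + 4)); first by rewrite mulr_ge0 ?addr_ge0 // invr_ge0 ltW.
case=> [|n]; first
  by rewrite upto0 // big_seq_fset0 mulr_ge0 ?qrt_ge0 // mulr_ge0 ?addr_ge0 // invr_ge0 ltW.
apply: (@le_trans _ _ ((ln 2)^-1 * \sum_(p <- upto n.+1) ln (N p)%:R / (N p)%:R)).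
  rewrite mulr_sumr big_seq [leRHS]big_seq ler_sum // => p /(upto_gt1 finS N_gt1) h.
  rewrite mulrA ler_peMl ?invr_ge0 // mulrC ler_pdivlMr // mul1r.
  by rewrite ler_ln ?posrE ?ltr0n ?ler_nat // (leq_trans _ h).
rewrite -mulrA ler_wpM2l ?invr_ge0 ?(ltW l2) //.
have := mertens (ltn0Sn n); rewrite ler_distl => /andP[_ h]; apply: le_trans h _.
rewrite mulrDl addrC lerD ?ln_le_qrt // ler_peMr // qrt_ge1 //.
Qed.

(** This is [sum_div_norm_le] for the function 1 / sqrt (N p). It controls the cubic errors of the
    logarithmic expansion. *)
Lemma sum_norm_three_halves : exists2 D : R, 0 <= D & forall n,
  \sum_(p <- upto n) (Num.sqrt (N p)%:R)^-1 ^+ 3 <= D.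
Proof.
have [D D0 h] := sum_inv_norm_le_qrt; exists (3 * D); first by rewrite mulr_ge0.
move=> n; have := @sum_div_norm_le R _ _ _ finS N_gt1 (fun p => (Num.sqrt (N p)%:R)^-1) D D0 _ n.
have e (p : T) : (Num.sqrt (N p)%:R)^-1 / (N p)%:R = (Num.sqrt (N p)%:R)^-1 ^+ 3 :> R.
  by rewrite -[X in _ / X]sqrt_sqr -exprVn -exprS.
rewrite (eq_bigr _ (fun p _ => e p)) => h2; apply: le_trans (ler_norm _) (h2 _) => m m0.
rewrite ger0_norm; last by rewrite sumr_ge0 // => p _; rewrite mulr_ge0 ?invr_ge0 ?sqrtr_ge0.
apply: le_trans (h m); rewrite (eq_bigr (fun p => (N p)%:R^-1)) // => p _.
by rewrite -invfM -expr2 sqrt_sqr.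
Qed.

(* [t = 2us - s^2] gives [(t + t^2/2)/2 = us + (2u^2-1)s^2/2 - us^3 + s^4/4]. *)
Lemma ln_euler_factor (u s : R) : `|u| <= 1 -> 0 < s -> s <= 5 / 7 ->
  `|u * s + (2 * u ^+ 2 - 1) * s ^+ 2 / 2 + ln (1 - (2 * u * s - s ^+ 2)) / 2|
    <= 70 * s ^+ 3.
Proof.
rewrite ler_norml => /andP[u1 u2] s0 s1; set t := _ - s ^+ 2.
(* Here 1 - t >= (1 - s)^2 >= (2 / 7)^2. *)
have t1 : t <= 45 / 49 by rewrite /t; nra.
have tn : `|t| <= 3 * s by rewrite /t ler_norml; apply/andP; split; nra.
have := ln1B_third_order t1.
(* Origin of 70: the cubic error gives 5 * 27 / 2, and u s^3 and s^4 / 4 give at most 5 / 4. *)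
have t3 : `|t| ^+ 3 <= 27 * s ^+ 3.
  have -> : 27 * s ^+ 3 = (3 * s) ^+ 3 by ring.
  by rewrite lerXn2r // nnegrE ?mulr_ge0 // ltW.
rewrite !ler_norml => /andP[h1 h2].
have s3 : 0 <= s ^+ 3 by rewrite exprn_ge0 // ltW.
have e : t ^+ 2 / 2 = 2 * u ^+ 2 * s ^+ 2 - 2 * u * s ^+ 3 + s ^+ 3 * s / 2 by rewrite /t; field.
have e1 : s ^+ 3 * s <= s ^+ 3 by rewrite ler_piMr //; lra.
have e2 : 0 <= s ^+ 3 * s by rewrite mulr_ge0 // ltW.
have e3 : u * s ^+ 3 <= s ^+ 3 by rewrite ler_piMl.
have e4 : - s ^+ 3 <= u * s ^+ 3 by rewrite -mulN1r ler_wpM2r.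
have e5 : t = 2 * (u * s) - s ^+ 2 by rewrite /t mulrA.
move: h1 h2 t3; rewrite e; move: (`|t| ^+ 3) (ln (1 - t)) => d l.
rewrite e5 -[2 * u ^+ 2 * s ^+ 2]mulrA -[2 * u * s ^+ 3]mulrA mulrBl mul1r -[2 * u ^+ 2 * s ^+ 2]mulrA.
move: e1 e2 e3 e4; move: (u ^+ 2 * s ^+ 2) (s ^+ 3 * s) (u * s ^+ 3) => f a b.
move: (s ^+ 3) (s ^+ 2) (u * s) => c g h.
by move=> *; apply/andP; split; lra.
Qed.

Variable u : T -> R.
Hypothesis u1 : forall p, `|u p| <= 1.

(** The product stands for the inverse square of the absolute value of an Euler product. Bounds away
    from 0 and infinity bound its logarithm, and the errors of [ln_euler_factor] add up to O(1) by
    [sum_norm_three_halves]. *)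
Lemma euler_product_log :
  (exists n0 c D, 0 < c /\ forall n, (n0 <= n)%N ->
     c <= \prod_(p <- upto n) (1 - (2 * u p * (Num.sqrt (N p)%:R)^-1 - (Num.sqrt (N p)%:R)^-1 ^+ 2)) <= D) ->
  exists D, forall n, `|\sum_(p <- upto n) u p / Num.sqrt (N p)%:R +
    2^-1 * \sum_(p <- upto n) (2 * u p ^+ 2 - 1) / (N p)%:R| <= D.
Proof.
move=> [n0 [c [D [c0 hcD]]]].
have [E E0 hE] := sum_norm_three_halves.
pose s p : R := (Num.sqrt (N p)%:R)^-1.
pose l p : R := ln (1 - (2 * u p * s p - s p ^+ 2)).
apply: (@bounded_of_eventually _ _ n0 (70 * E + (`|ln c| + `|ln D|) / 2)) => n nn.
have s0 p : (1 < N p)%N -> 0 < s p by move=> h; rewrite invr_gt0 sqrtr_gt0 ltr0n ltnW.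
(* 1 / sqrt 2 < 5 / 7, because (7 / 5)^2 < 2. *)
have s1 p : (1 < N p)%N -> s p <= 5 / 7.
  move=> h; rewrite -[leRHS]invrK lef_pV2 ?posrE ?invr_gt0 //; last first.
    by rewrite sqrtr_gt0 ltr0n ltnW.
  rewrite -(ler_pXn2r (n := 2)) ?nnegrE ?sqrtr_ge0 ?invr_ge0 // sqrt_sqr.
  by apply: (@le_trans _ _ 2); [lra|rewrite ler_nat].
have f0 p : (1 < N p)%N -> 0 < 1 - (2 * u p * s p - s p ^+ 2).
  move=> h; have := u1 p; have := s0 p h; have := s1 p h; rewrite ler_norml.
  by move: (s p) (u p) => x y *; nra.
have eS : \sum_(p <- upto n) l p = ln (\prod_(p <- upto n) (1 - (2 * u p * s p - s p ^+ 2))).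
  rewrite big_seq [in RHS]big_seq.
  apply: (@eq_trans _ _ (ln (expR (\sum_(p <- upto n | p \in upto n) l p)))); first by rewrite expRK.
  rewrite expR_sum; congr ln; apply: eq_bigr => p /(upto_gt1 finS N_gt1)/f0 h.
  by rewrite lnK.
have lb : `|\sum_(p <- upto n) l p| <= `|ln c| + `|ln D|.
  have /andP[h1 h2] := hcD n nn; rewrite eS.
  have P0 := lt_le_trans c0 h1; have D0 := lt_le_trans P0 h2.
  move: h1 h2; rewrite -ler_ln ?posrE // => h1; rewrite -ler_ln ?posrE // => h2.
  rewrite ler_norml; apply/andP; split.
    apply: le_trans h1; rewrite opprD; have := lerNnormlW (lexx `|ln c|).
    by have := normr_ge0 (ln D); lra.
  by apply: le_trans h2 _; have := ler_norm (ln D); have := normr_ge0 (ln c); lra.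
have e p : u p / Num.sqrt (N p)%:R + 2^-1 * ((2 * u p ^+ 2 - 1) / (N p)%:R) =
   (u p * s p + (2 * u p ^+ 2 - 1) * s p ^+ 2 / 2 + l p / 2) - l p / 2.
  rewrite addrK /s exprVn sqrt_sqr; congr (_ + _); by rewrite mulrC.
rewrite mulr_sumr -big_split /= (eq_bigr _ (fun p _ => e p)) big_split /= sumrN.
apply: le_trans (ler_normB _ _) _; apply: lerD.
  apply: le_trans (ler_norm_sum _ _ _) _.
  apply: le_trans (_ : \sum_(p <- upto n) 70 * s p ^+ 3 <= _).
    rewrite big_seq [leRHS]big_seq ler_sum // => p /(upto_gt1 finS N_gt1) h.
    by apply: ln_euler_factor; rewrite ?s0 ?s1.
  by rewrite -mulr_sumr ler_wpM2l.
by rewrite -mulr_suml normrM [X in _ * X]ger0_norm ?ler_wpM2r ?invr_ge0.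
Qed.

End EulerFactors.

Section ComplexParts.
Variable R : realType.
Local Notation Re := (@complex.Re R).

Lemma Re_sum (I : Type) (r : seq I) (P : pred I) (f : I -> R[i]) :
  Re (\sum_(i <- r | P i) f i) = \sum_(i <- r | P i) Re (f i).
Proof. by apply: (big_morph Re) => // -[x1 x2] [y1 y2]. Qed.

Lemma Re_nat n : Re n%:R = n%:R.
Proof. by elim: n => // n IH; rewrite -!natr1 -IH; case: (n%:R). Qed.

Lemma norm1_sqr_sum (z : R[i]) : `|z| = 1 -> Re z ^+ 2 + complex.Im z ^+ 2 = 1.
Proof.
by move=> z1; have := add_Re2_Im2 z; rewrite z1 expr1n => /(congr1 Re).
Qed.

Lemma norm1_Re_le1 (z : R[i]) : `|z| = 1 -> `|Re z| <= 1.
Proof.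
move=> /norm1_sqr_sum e; rewrite -(ler_pXn2r (n := 2)) ?nnegrE // expr1n.
by rewrite real_normK ?num_real // -e lerDl sqr_ge0.
Qed.

Lemma norm1_Re_sqr (z : R[i]) : `|z| = 1 -> Re (z ^+ 2) = 2 * Re z ^+ 2 - 1.
Proof.
move=> /norm1_sqr_sum; case: z => x y /= e.
by rewrite expr2 /= -[X in _ = _ - X]e; ring.
Qed.

End ComplexParts.

(** * Sums of characters over the primes *)

Section CharacterSums.
Variables (R : realType) (T : choiceType) (S : set T) (N : T -> nat).
Hypothesis finS : forall n, finite_set [set p | S p /\ (N p <= n)%N].
Hypothesis N_gt1 : forall p, S p -> (1 < N p)%N.
Variable C : R.
Local Notation upto := (upto S N).
Hypothesis mertens : forall m, (0 < m)%N ->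
  `|\sum_(p <- upto m) ln (N p)%:R / (N p)%:R - ln m%:R| <= C.
Variables (gT : finGroupType) (a : T -> gT).
Hypothesis comm : forall s t : gT, (s * t = t * s)%g.
Local Notation Re := (@complex.Re R).
Local Notation character := (@character R[i] gT).
Local Notation X := (fset_set character).
Hypothesis euler_bounded : forall chi : gT -> R[i], character chi ->
  (exists s, chi s != 1) -> exists n0 c D, 0 < c /\ forall n, (n0 <= n)%N ->
    c <= \prod_(p <- upto n) (1 - (2 * Re (chi (a p)) * (Num.sqrt (N p)%:R)^-1 -
           (Num.sqrt (N p)%:R)^-1 ^+ 2)) <= D.

Lemma character_Re_le1 chi s : character chi -> `|Re (chi s)| <= 1.
Proof. by move=> cc; apply/norm1_Re_le1/character_norm. Qed.

Lemma character_Re_sqr chi s : character chi -> Re (chi s ^+ 2) = 2 * Re (chi s) ^+ 2 - 1.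
Proof. by move=> cc; apply/norm1_Re_sqr/character_norm. Qed.

Lemma character_log chi : character chi -> (exists s, chi s != 1) -> exists D : R, forall n,
  `|\sum_(p <- upto n) Re (chi (a p)) / Num.sqrt (N p)%:R +
    2^-1 * \sum_(p <- upto n) Re (chi (a p) ^+ 2) / (N p)%:R| <= D.
Proof.
move=> cc ct; have u1 p : `|Re (chi (a p))| <= 1 by exact: character_Re_le1.
have [D hD] := euler_product_log finS N_gt1 mertens u1 (euler_bounded cc ct).
exists D => n; apply: le_trans (hD n); rewrite le_eqVlt; apply/orP; left; apply/eqP.
by congr (`|_ + _ * _|); apply: eq_bigr => p _; rewrite character_Re_sqr.
Qed.

Lemma character_sqr chi : character chi -> character (fun s => chi s ^+ 2).
Proof. by move=> [c1 cM]; split; [rewrite c1 expr1n|move=> s t; rewrite cM exprMn]. Qed.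

(** Obtained by bounding |Re chi^2| by 1. Crude as it is, applied to chi^2 it makes the sum of Re
    chi^2(p) / N p bounded, and applied to chi it leads to the ratio of the prime counts. *)
Lemma character_sum_le_qrt chi : character chi -> (exists s, chi s != 1) ->
  exists2 D : R, 0 <= D & forall n, (0 < n)%N ->
  `|\sum_(p <- upto n) Re (chi (a p)) / Num.sqrt (N p)%:R| <= D * qrt R n.
Proof.
move=> cc ct; have [D hD] := character_log cc ct.
have [E E0 hE] := sum_inv_norm_le_qrt finS N_gt1 mertens.
have D0 : 0 <= D by exact: le_trans (normr_ge0 _) (hD 0).
exists (D + E) => [|n n0]; first exact: addr_ge0.
set x := \sum_(p <- _) _; set y := \sum_(p <- upto n) Re (chi (a p) ^+ 2) / (N p)%:R.
have -> : x = (x + 2^-1 * y) - 2^-1 * y by rewrite addrK.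
apply: le_trans (ler_normB _ _) _; rewrite mulrDl lerD //.
  by apply: le_trans (hD n) _; rewrite ler_peMr ?qrt_ge1.
rewrite normrM ger0_norm ?invr_ge0 //.
apply: le_trans (_ : `|y| <= _); first by rewrite ler_piMl //; lra.
apply: le_trans (hE n); apply: le_trans (ler_norm_sum _ _ _) _.
apply: ler_sum => p _; rewrite normrM [X in _ * X]ger0_norm ?invr_ge0 //.
by rewrite ler_piMl ?invr_ge0 //; exact: (character_Re_le1 _ (character_sqr cc)).
Qed.

(** For chi^2 nontrivial the secondary term is bounded by partial summation from the crude estimate
    for chi^2; for chi^2 = 1 it is half the sum of 1 / N p. *)
Lemma character_sum chi : character chi -> (exists s, chi s != 1) ->
  exists D : R, forall n, (2 <= n)%N ->
  `|\sum_(p <- upto n) Re (chi (a p)) / Num.sqrt (N p)%:R +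
    (if [forall s, chi s ^+ 2 == 1] then 2^-1 else 0) * ln (ln n%:R)| <= D.
Proof.
move=> cc ct; have [D hD] := character_log cc ct.
case: ifPn => [/forallP chi2|]; last first.
  rewrite negb_forall => /existsP ct2.
  have [E E0 hE] := character_sum_le_qrt (character_sqr cc) ct2.
  have {}hE := sum_div_norm_le finS N_gt1 E0 hE.
  exists (D + 2^-1 * (3 * E)) => n _; rewrite mul0r addr0.
  set x := \sum_(p <- _) _; set y := \sum_(p <- upto n) Re (chi (a p) ^+ 2) / (N p)%:R.
  have -> : x = (x + 2^-1 * y) - 2^-1 * y by rewrite addrK.
  apply: le_trans (ler_normB _ _) _; rewrite lerD ?hD // normrM.
  by rewrite ger0_norm ?invr_ge0 // ler_wpM2l ?invr_ge0 ?hE.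
have [E hE] := sum_inv_norm finS N_gt1 mertens.
exists (D + 2^-1 * E) => n n2; set x := \sum_(p <- _) _.
have := hD n; have := hE n n2.
have -> : \sum_(p <- upto n) Re (chi (a p) ^+ 2) / (N p)%:R =
    \sum_(p <- upto n) (N p)%:R^-1 :> R.
  by apply: eq_bigr => p _; rewrite (eqP (chi2 _)) mul1r.
rewrite -/x; set y := \sum_(p <- _) _ => h1 h2.
have -> : x + 2^-1 * ln (ln n%:R) = (x + 2^-1 * y) - 2^-1 * (y - ln (ln n%:R)) by rewrite mulrBr; ring.
apply: le_trans (ler_normB _ _) _; rewrite lerD // normrM.
by rewrite ger0_norm ?invr_ge0 // ler_wpM2l ?invr_ge0.
Qed.

(** By orthogonality this is the sum of chi(s) over the nontrivial characters. *)
Definition unit_weight (s : gT) : R := (if s == 1%g then #|gT|%:R else 0) - 1.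

Local Notation Y := (X `\ (fun=> 1))%fset.

Lemma in_nontrivial_characters chi : chi \in Y -> character chi /\ exists s, chi s != 1.
Proof.
rewrite in_fsetD1 => /andP[c1 /in_characters cc]; split=> //.
exact: character_nontrivial.
Qed.

Lemma sum_nontrivial_characters s :
  \sum_(chi <- Y) Re (chi s) = unit_weight s.
Proof.
have e : \sum_(chi <- X) chi s = if s == 1%g then #|gT|%:R else 0.
  case: eqVneq => [->|s1]; last exact: sum_characters.
  rewrite -card_characters // big_seq (eq_bigr (fun=> 1)) => [|chi /in_characters[] //].
  by rewrite -big_seq big_const_seq count_predT iter_addr_0.
rewrite -Re_sum; move: e; rewrite (big_fsetD1 (fun=> 1)) /=; last exact/in_characters/trivial_character.
set x := \sum_(chi <- _) _ => e.
have -> : x = (if s == 1%g then #|gT|%:R else 0) - 1 by rewrite -e addrAC subrr add0r.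
by rewrite /unit_weight; case: ifP => _ //; rewrite -Re_nat; case: (#|gT|%:R).
Qed.

Hypothesis even : ~~ odd #|gT|.

(** The constant c is half the number of characters of order 2, positive because |G| is even. *)
Lemma unit_weight_log : exists2 c : R, 0 < c & exists D : R, forall n, (2 <= n)%N ->
  `|\sum_(p <- upto n) unit_weight (a p) / Num.sqrt (N p)%:R + c * ln (ln n%:R)| <= D.
Proof.
pose e (chi : gT -> R[i]) : R := if [forall s, chi s ^+ 2 == 1] then 2^-1 else 0.
exists (\sum_(chi <- Y) e chi).
  have [psi [cp [s ps] p2]] := character_order2 R[i] comm even.
  rewrite (big_fsetD1 psi) /=; last first.
    rewrite in_fsetD1; apply/andP; split; last exact/in_characters.
    by apply: contra_neq ps => ->.
  rewrite ltr_pwDl //.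
    by rewrite /e; case: ifPn => [_|/forallPn[t]]; rewrite ?invr_gt0 // p2 eqxx.
  by apply: sumr_ge0 => chi _; rewrite /e; case: ifP.
have [chi /in_nontrivial_characters[cc ct]|D hD] := @bounded_sum R _ (leq 2) Y (fun=> 1) (fun chi n =>
    \sum_(p <- upto n) Re (chi (a p)) / Num.sqrt (N p)%:R + e chi * ln (ln n%:R)) (fun=> ler01).
  by have [D hD] := character_sum cc ct; exists D => n n2; rewrite mulr1 hD.
exists D => n n2; have := hD n n2; rewrite mulr1 big_split /= -mulr_suml exchange_big /=.
congr (`|_ + _| <= _); apply: eq_bigr => p _.
by rewrite -sum_nontrivial_characters mulr_suml.
Qed.

Lemma sum_unit_weight_le : exists2 D : R, 0 <= D & forall n,
  `|\sum_(p <- upto n) unit_weight (a p)| <= D * qrt R n ^+ 3.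
Proof.
have [chi /in_nontrivial_characters[cc ct]|D hD] := @bounded_sum R _ (leq 1) Y (qrt R) (fun chi n =>
    \sum_(p <- upto n) Re (chi (a p)) / Num.sqrt (N p)%:R) (@qrt_ge0 R).
  by have [D _ hD] := character_sum_le_qrt cc ct; exists D.
have D0 : 0 <= D.
  have := le_trans (normr_ge0 _) (hD 1%N isT).
  by rewrite pmulr_lge0 // qrt_gt0.
exists (2 * D) => [|n]; first by rewrite mulr_ge0.
apply: (sum_norm_le finS N_gt1 D0) => m m0.
have := hD m m0; rewrite exchange_big /=; congr (`|_| <= _); apply: eq_bigr => p _.
by rewrite -sum_nontrivial_characters mulr_suml.
Qed.

End CharacterSums.

(** * Asymptotics *)

Section Limits.
Variables (R : realType) (T : choiceType) (S : set T) (N : T -> nat).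
Hypothesis finS : forall n, finite_set [set p | S p /\ (N p <= n)%N].
Hypothesis N_gt1 : forall p, S p -> (1 < N p)%N.
Variable C : R.
Local Notation upto := (upto S N).
Hypothesis mertens : forall m, (0 < m)%N ->
  `|\sum_(p <- upto m) ln (N p)%:R / (N p)%:R - ln m%:R| <= C.
Variables (gT : finGroupType) (a : T -> gT).
Hypothesis comm : forall s t : gT, (s * t = t * s)%g.
Local Notation Re := (@complex.Re R).
Hypothesis euler_bounded : forall chi : gT -> R[i], character chi ->
  (exists s, chi s != 1) -> exists n0 c D, 0 < c /\ forall n, (n0 <= n)%N ->
    c <= \prod_(p <- upto n) (1 - (2 * Re (chi (a p)) * (Num.sqrt (N p)%:R)^-1 -
           (Num.sqrt (N p)%:R)^-1 ^+ 2)) <= D.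
Hypothesis even : ~~ odd #|gT|.

Lemma sum_unit_weight (f : T -> R) n :
  \sum_(p <- upto n) unit_weight R (a p) * f p =
  (#|gT|%:R - 1) * \sum_(p <- upto n | a p == 1%g) f p -
  \sum_(p <- upto n | a p != 1%g) f p.
Proof.
rewrite (bigID (fun p => a p == 1%g)) /= mulr_sumr -sumrN.
congr (_ + _); apply: eq_bigr => p; rewrite /unit_weight; first by move=> ->.
by move=> /negPf ->; rewrite sub0r mulN1r.
Qed.

Lemma class_sums_log : exists2 c : R, 0 < c & exists D : R, forall n, (2 <= n)%N ->
  `|\sum_(p <- upto n | a p != 1%g) (Num.sqrt (N p)%:R)^-1 -
    (#|gT|%:R - 1) * \sum_(p <- upto n | a p == 1%g) (Num.sqrt (N p)%:R)^-1 -
    c * ln (ln n%:R)| <= D.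
Proof.
have [c c0 [D hD]] := unit_weight_log finS N_gt1 mertens comm euler_bounded even.
exists c => //; exists D => n n2; have := hD n n2; rewrite sum_unit_weight.
by rewrite -normrN opprD opprB.
Qed.

Lemma root8_large (M : R) : exists n0, forall n, (n0 <= n)%N -> M <= Num.sqrt (qrt R n).
Proof.
exists (Num.truncn (`|M| ^+ 8)).+1 => n nn.
have w0 : 0 <= Num.sqrt (qrt R n) by exact: sqrtr_ge0.
apply: le_trans (ler_norm M) _; rewrite -(ler_pXn2r (n := 8)) ?nnegrE //.
have -> : Num.sqrt (qrt R n) ^+ 8 = n%:R.
  by rewrite (exprM _ 2 4) sqr_sqrtr ?qrt_ge0 // (exprM _ 2 2) qrt_sqr sqrt_sqr.
have M8 : 0 <= `|M| ^+ 8 by exact: exprn_ge0.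
by have /andP[_ /ltW h] := truncn_itv M8; apply: le_trans h _; rewrite ler_nat.
Qed.

(** In terms of w = n^(1/8), the counts x of the p with trivial [a p] and y of the others satisfy
    (|G| - 1) x - y = O(w^6), while x + y is at least a constant times w^7 because ln n <= 8 w. So x
    outgrows w^6. *)
Lemma class_counts_ratio (e : R) : 0 < e -> exists n0, forall n, (n0 <= n)%N ->
  `|(\sum_(p <- upto n | a p != 1%g) 1) / (\sum_(p <- upto n | a p == 1%g) 1) -
    (#|gT|%:R - 1)| <= e.
Proof.
move=> e0; have [D D0 hD] := sum_unit_weight_le finS N_gt1 mertens comm euler_bounded.
have [c c0 [n1 hc]] := count_norm_ge finS N_gt1 mertens.
have h0 : 0 < #|gT|%:R :> R by rewrite ltr0n -cardsT cardG_gt0.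
(* In |G| x = ((|G| - 1) x - y) + (x + y), the summand D offsets the error, 1 makes x positive, and
   |G| D / e makes the error at most e x. *)
have [n2 hM] := root8_large (8 / c * (D + 1 + #|gT|%:R * D / e)).
exists (n1 + n2 + 2)%N => n nn.
have /hc {}hc : (n1 <= n)%N by rewrite (leq_trans _ nn) // -addnA leq_addr.
have /hM {}hM : (n2 <= n)%N by rewrite (leq_trans _ nn) // addnAC leq_addl.
have n0 : (1 < n)%N by rewrite (leq_trans _ nn) // leq_addl.
have := hD n; under eq_bigr do rewrite -[unit_weight _ _]mulr1.
rewrite sum_unit_weight; set x := \sum_(p <- _ | a p == 1%g) 1; set y := \sum_(p <- _ | a p != 1%g) 1.
have xy : x + y = (size (upto n))%:R.
  rewrite /x /y -(bigID (fun p => a p == 1%g) predT) /=.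
  by rewrite big_const_seq count_predT iter_addr_0.
set w := Num.sqrt (qrt R n) in hM *; have w0 : 0 < w by rewrite sqrtr_gt0 qrt_gt0 // ltnW.
have qw : qrt R n = w ^+ 2 by rewrite sqr_sqrtr ?qrt_ge0.
have nw : n%:R = w ^+ 8 by rewrite (exprM _ 2 4) -qw (exprM _ 2 2) qrt_sqr sqrt_sqr.
have lnw : ln n%:R <= 8 * w.
  by rewrite nw lnXn // -(mulr_natl (ln _)) ler_wpM2l // ltW // ln_sublinear.
have pw : c / 8 * w ^+ 7 <= x + y.
  have h := le_trans hc (ler_wpM2l (ler0n R (size (upto n))) lnw).
  rewrite xy -(ler_pM2r (_ : 0 < 8 * w)) ?mulr_gt0 //; apply: le_trans h.
  by rewrite nw le_eqVlt; apply/orP; left; apply/eqP; field.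
rewrite qw -[(w ^+ 2) ^+ 3]exprM -[(2 * 3)%N]/6%N => hD'.
have w6 : 0 < w ^+ 6 by rewrite exprn_gt0.
have cw : (D + 1 + #|gT|%:R * D / e) * w ^+ 6 <= c / 8 * w ^+ 7.
  rewrite (exprS w 6) [c / 8 * (w * _)]mulrA ler_pM2r //.
  by rewrite -ler_pdivrMl ?divr_gt0 // invf_div.
have xlow : (1 + #|gT|%:R * D / e) * w ^+ 6 <= #|gT|%:R * x.
  have /ler_normlP[_ h] := hD'.
  have -> : #|gT|%:R * x = ((#|gT|%:R - 1) * x - y) + (x + y) by ring.
  have := le_trans cw pw; move: hD'; rewrite ler_norml => /andP[h1 _].
  move: (_ * x - y) (x + y) (w ^+ 6) h1 => u v z h1 h2.
  rewrite -addrA mulrDl in h2; move: (D * z) (_ * z) h1 h2 => s t *; lra.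
have x0 : 0 < x.
  rewrite -(pmulr_rgt0 _ h0); apply: lt_le_trans xlow; rewrite mulr_gt0 //.
  by rewrite ltr_pwDl // divr_ge0 ?mulr_ge0 // ltW.
have -> : y / x - (#|gT|%:R - 1) = - ((#|gT|%:R - 1) * x - y) / x by field; rewrite gt_eqF.
rewrite normrM normrN normfV [X in _ / X]gtr0_norm // ler_pdivrMr //.
apply: le_trans hD' _; rewrite -(ler_pM2l h0).
have -> : #|gT|%:R * (D * w ^+ 6) = e * (#|gT|%:R * D / e * w ^+ 6).
  by field; rewrite gt_eqF.
rewrite [leRHS]mulrCA ler_wpM2l ?(ltW e0) //; apply: le_trans xlow.
by rewrite ler_wpM2r ?(ltW w6) // lerDr.
Qed.

End Limits.

(** * From integers to a real variable x *)

Section RealLimits.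
Variable R : realType.

Lemma cvg_pinftyP (f : R -> R) (l : R) :
  (forall e, 0 < e -> exists M, forall x, M <= x -> `|f x - l| <= e) ->
  f x @[x --> +oo] --> l.
Proof.
move=> h; apply/cvgrPdist_le => e e0; have [M hM] := h e e0.
exists M; split; first exact: num_real.
by move=> x /ltW Mx; rewrite distrC; exact: hM.
Qed.

(** The integer part n is at least 3, so x < n + 1 <= n^2 and ln x <= 2 ln n: the iterated
    logarithms differ by at most ln 2. *)
Lemma ln_ln_truncn (x : R) : 3 <= x -> `|ln (ln x) - ln (ln (Num.truncn x)%:R)| <= 2.
Proof.
move=> x3; have x0 : 0 <= x by lra.
have /andP[n1 n2] := truncn_itv x0; set n := Num.truncn x in n1 n2 *.
have n3 : (2 < n)%N by rewrite -(ltr_nat R); rewrite -natr1 in n2; lra.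
have nR : 2 < n%:R :> R by rewrite ltr_nat.
have l0 : 0 < ln n%:R :> R by rewrite ln_gt0 //; lra.
have h1 : ln n%:R <= ln x by rewrite ler_ln ?posrE //; lra.
have h2 : ln x <= 2 * ln n%:R.
  rewrite mulr_natl -lnXn; last by lra.
  by rewrite ler_ln ?posrE ?exprn_gt0 //; [rewrite -natr1 in n2; rewrite expr2; nra|lra|lra].
have l0' := lt_le_trans l0 h1.
have h3 : ln (ln n%:R) <= ln (ln x) by rewrite ler_ln ?posrE.
have h4 : ln (ln x) <= ln 2 + ln (ln n%:R) by rewrite -lnM ?posrE // ler_ln ?posrE // mulr_gt0.
have := @ln_sublinear R 2 (ltr0n _ 2); rewrite ger0_norm; lra.
Qed.

Lemma ln_ln_asymptotic (f : nat -> R) (c D : R) : 0 < c ->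
  (forall n, (2 <= n)%N -> `|f n - c * ln (ln n%:R)| <= D) ->
  f (Num.truncn x) / (c * ln (ln x)) @[x --> +oo] --> (1 : R).
Proof.
move=> c0 hf; apply: cvg_pinftyP => e e0.
(* From here on ln (ln x) >= 1 + (|D| + 2 c) / (c e), where 2 c pays for replacing x by its integer
   part. *)
exists (Num.max 3 (expR (expR (1 + (`|D| + 2 * c) / (c * e))))) => x.
rewrite ge_max => /andP[x3 xM]; have x0 : 0 < x by lra.
have l1 : expR (1 + (`|D| + 2 * c) / (c * e)) <= ln x by rewrite -ler_expR lnK.
have l0 := lt_le_trans (expR_gt0 _) l1.
have l2 : 1 + (`|D| + 2 * c) / (c * e) <= ln (ln x) by rewrite -ler_expR lnK.
have q0 : 0 <= (`|D| + 2 * c) / (c * e).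
  by rewrite divr_ge0 ?addr_ge0 // ?mulr_ge0 // ltW.
have ll0 : 0 < ln (ln x) by lra.
have n2 : (2 <= Num.truncn x)%N.
  by rewrite truncn_ge_nat ?(ltW x0) //; lra.
have ck : 0 < c * ln (ln x) by rewrite mulr_gt0.
have -> : f (Num.truncn x) / (c * ln (ln x)) - 1 =
    (f (Num.truncn x) - c * ln (ln x)) / (c * ln (ln x)).
  by rewrite mulrBl divff // gt_eqF.
rewrite normrM normfV [X in _ / X]gtr0_norm // ler_pdivrMr //.
apply: le_trans (_ : `|D| + 2 * c <= _); last first.
  rewrite mulrA (mulrC e) -ler_pdivrMl ?mulr_gt0 //; rewrite mulrC; lra.
have -> : f (Num.truncn x) - c * ln (ln x) =
  (f (Num.truncn x) - c * ln (ln (Num.truncn x)%:R)) - c * (ln (ln x) - ln (ln (Num.truncn x)%:R)).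
  by ring.
apply: le_trans (ler_normB _ _) _; apply: lerD; first exact: le_trans (hf _ n2) (ler_norm D).
by rewrite normrM gtr0_norm // mulrC ler_wpM2r ?(ltW c0) // ln_ln_truncn.
Qed.

End RealLimits.

(** * The class group *)

Section ClassGroup.
Variables (E : fieldType) (O : set E) (gT : finGroupType) (art : set E -> gT).
Hypothesis O1 : O 1.
Hypothesis OB : forall x y, O x -> O y -> O (x - y).
Hypothesis OM : forall x y, O x -> O y -> O (x * y).
Local Notation "I ** J" := (ideal_mul I J) (at level 40, left associativity).
Hypothesis artM : forall I J, fractional O I -> fractional O J ->
  art (I ** J) = (art I * art J)%g.
Hypothesis art_surj : forall s, exists2 I, fractional O I & art I = s.
Hypothesis art_ker : forall I, fractional O I -> (art I = 1%g <-> principal O I).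

Lemma artin_group_commutative (s t : gT) : (s * t = t * s)%g.
Proof.
have [I fI <-] := art_surj s; have [J fJ <-] := art_surj t.
by rewrite -!artM // ideal_mulC.
Qed.

Lemma fractional_principal a : a != 0 -> fractional O (principal_ideal O a).
Proof.
move=> a0; have [_ OD _] := submodule_ring O1 OB OM; split.
- split; [by exists 0; rewrite ?mulr0 // -(subrr 1); exact: OB| |].
    by move=> _ _ [u Ou <-] [v Ov <-]; exists (u + v); rewrite ?mulrDr //; exact: OD.
  by move=> c _ Oc [u Ou <-]; exists (c * u); [exact: OM|rewrite mulrCA].
- by exists a => //; exists 1; rewrite ?mulr1.
- by exists a^-1; [rewrite invr_eq0|move=> _ [u Ou <-]; rewrite mulKf].
Qed.

Lemma principal_ideal1 : principal_ideal O 1 = O.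
Proof.
by apply/seteqP; split=> [_ [u Ou <-]|u Ou]; [rewrite mul1r|exists u; rewrite ?mul1r].
Qed.

Lemma principal_ring : principal O O.
Proof. by exists 1; [exact: oner_neq0|rewrite principal_ideal1]. Qed.

Lemma principal_idealM a b :
  principal_ideal O a ** principal_ideal O b = principal_ideal O (a * b).
Proof.
have [_ OD _] := submodule_ring O1 OB OM; apply/seteqP; split.
  apply: ideal_mul_min.
  - by move=> _ _ [u Ou <-] [v Ov <-]; exists (u * v); [exact: OM|rewrite mulrACA].
  - by exists 0; rewrite ?mulr0 // -(subrr 1); exact: OB.
  by move=> _ _ [u Ou <-] [v Ov <-]; exists (u + v); rewrite ?mulrDr //; exact: OD.
move=> _ [u Ou <-]; rewrite -mulrA; apply: ideal_mulM; last by exists u.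
by exists 1; rewrite ?mulr1.
Qed.

(** If art J is inverse to art I, then I J lies in the kernel and is some aO, so a^-1 J is inverse
    to I. *)
Lemma fractional_invertible I : fractional O I ->
  exists2 J, fractional O J & I ** J = O.
Proof.
move=> fI; have [J fJ aJ] := art_surj (art I)^-1%g.
have fIJ := fractional_mul O1 OB OM fI fJ.
have [|a a0 e] := (art_ker fIJ).1; first by rewrite artM // aJ mulgV.
have ai0 : a^-1 != 0 by rewrite invr_eq0.
exists (J ** principal_ideal O a^-1).
  by apply: fractional_mul => //; exact: fractional_principal.
by rewrite ideal_mulA e principal_idealM mulfV // principal_ideal1.
Qed.

Lemma art_ring : art O = 1%g.
Proof.
by apply/art_ker; [exact/ideal_fractional/ideal_ring|exact: principal_ring].
Qed.

Lemma ideal_class_subset I J : fractional O I -> fractional O J -> art I = art J ->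
  ideal_class O I `<=` ideal_class O J.
Proof.
move=> fI fJ IJ _ [P pP <-]; have [J' fJ' JJ'] := fractional_invertible fJ.
have fP : fractional O P by have [a a0 ->] := pP; exact: fractional_principal.
have fIP : fractional O (I ** P) by exact: fractional_mul.
have fQ : fractional O (J' ** (I ** P)) by exact: fractional_mul.
exists (J' ** (I ** P)).
  apply/art_ker => //; rewrite !artM // (art_ker fP).2 // mulg1 IJ.
  by rewrite artin_group_commutative -artM // JJ' art_ring.
by rewrite ideal_mulA JJ' ideal_mul1 //; case: fIP.
Qed.

Lemma ideal_class_eq I J : fractional O I -> fractional O J ->
  ideal_class O I = ideal_class O J <-> art I = art J.
Proof.
move=> fI fJ; split=> [e|e]; last by apply/seteqP; split; exact: ideal_class_subset.
have : ideal_class O I I.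
  by exists O; [exact: principal_ring|rewrite ideal_mulC ideal_mul1 //; case: fI].
rewrite e => -[P pP <-].
have fP : fractional O P by have [a a0 ->] := pP; exact: fractional_principal.
by rewrite artM // (art_ker fP).2 // mulg1.
Qed.

(** It carries the evenness of the class number over to the Galois group. *)
Lemma class_number_card : class_number O = #|gT|.
Proof.
have /choice[I hI] : forall s, exists I, fractional O I /\ art I = s.
  by move=> s; have [I fI aI] := art_surj s; exists I.
have inj : injective (fun s => ideal_class O (I s)).
  move=> s t /ideal_class_eq h; rewrite -(hI s).2 -(hI t).2.
  by apply: h; [exact: (hI s).1|exact: (hI t).1].
pose F := [fset x in map (fun s => ideal_class O (I s)) (enum gT)]%fset.
have -> : class_number O = #|` F|.
  rewrite /class_number; suff -> : class_group O = [set` F] by rewrite set_fsetK.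
  apply/seteqP; split=> [_ [J fJ <-]|x] /=.
    rewrite inE /=; apply/mapP; exists (art J); first by rewrite mem_enum.
    apply/ideal_class_eq => //; first exact: (hI _).1.
    by rewrite (hI _).2.
  by rewrite inE /= => /mapP[s _ ->]; exists (I s) => //; exact: (hI s).1.
rewrite card_fseq undup_id; first by rewrite size_map -cardE.
by rewrite map_inj_uniq //; exact: enum_uniq.
Qed.

End ClassGroup.

(** * Euler products at 1/2 under DRH(A) *)

Section EulerProducts.
Variables (R : realType) (b : global_base) (K : fieldExtType (base_field b)).
Variable L : splittingFieldType K.
Local Notation O := (integers K).
Local Notation N := (ideal_norm O).
Local Notation upto := (upto (prime_ideal O) N).
Local Open Scope complex_scope.
Hypothesis finS : forall n, finite_set [set p | prime_ideal O p /\ (N p <= n)%N].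
Hypothesis N_gt1 : forall p, prime_ideal O p -> (1 < N p)%N.

Lemma cpow_neg_half n : (0 < n)%N -> cpow n (- 2^-1 : R[i]) = (Num.sqrt n%:R)^-1%:C.
Proof.
move=> n0; have nR : 0 < n%:R :> R by rewrite ltr0n.
have -> : - 2^-1 = (- 2^-1)%:C :> R[i] by rewrite rmorphN fmorphV rmorph_nat.
rewrite /cpow /= mul0r cos0 sin0 mulr1; congr (_ %:C).
rewrite mulNr expRN; congr (_^-1); rewrite -[n%:R in RHS](lnK nR).
have -> : ln n%:R = 2^-1 * ln n%:R + 2^-1 * ln n%:R :> R by rewrite -mulrDl; field.
by rewrite expRD -expr2 sqrtr_sqr ger0_norm ?expR_ge0 //; congr (expR (_ * _)); field.
Qed.

Lemma euler_factor_sqr_norm (z : R[i]) (s : R) : `|z| = 1 ->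
  `|1 - z * s%:C| ^+ 2 = (1 - (2 * complex.Re z * s - s ^+ 2))%:C.
Proof.
move=> /norm1_sqr_sum; case: z => x y /= e; rewrite -add_Re2_Im2 /=; congr (_ %:C).
rewrite !mulr0 subr0.
have -> : s ^+ 2 = (x ^+ 2 + y ^+ 2) * s ^+ 2 by rewrite e mul1r.
by ring.
Qed.

Lemma primes_upto_nat n :
  primes_upto K (n%:R : R) = [set p | prime_ideal O p /\ (N p <= n)%N].
Proof. by apply/seteqP; split=> p; rewrite /primes_upto /= ler_nat. Qed.

Lemma euler_product_sqr_norm (chi : gal_of {:L} -> R[i]) n : character chi ->
  `|euler_product chi 2^-1 (n%:R : R)| ^+ 2 =
  (\prod_(p <- upto n) (1 - (2 * complex.Re (chi (frobenius L p)) * (Num.sqrt (N p)%:R)^-1 -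
           (Num.sqrt (N p)%:R)^-1 ^+ 2)))^-1%:C.
Proof.
move=> cc; rewrite /euler_product primes_upto_nat fsbig_finite // -/(upto n).
rewrite fmorphV rmorph_prod normr_prod -prodrXl -prodfV big_seq [RHS]big_seq.
apply: eq_bigr => p /(upto_gt1 finS N_gt1) h.
rewrite cpow_neg_half ?(ltnW h) // normfV [LHS]exprVn euler_factor_sqr_norm //.
exact: character_norm.
Qed.

(** For m_chi = 0 the power of ln x in DRH(A) is 1, so the Euler product E itself converges to some
    l != 0, and the product to be bounded is |E|^-2. *)
Lemma DRH_euler_bounded (chi : gal_of {:L} -> R[i]) : character chi ->
  ord_half chi = 0 -> DRH_A L chi -> exists n0 c D, 0 < c /\ forall n, (n0 <= n)%N ->
    c <= \prod_(p <- upto n) (1 - (2 * complex.Re (chi (frobenius L p)) *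
       (Num.sqrt (N p)%:R)^-1 - (Num.sqrt (N p)%:R)^-1 ^+ 2)) <= D.
Proof.
move=> cc o0 [l l0 hl].
have [r lr] : exists r, `|l| = r%:C by exists (complex.Re `|l|); rewrite RRe_real // normr_real.
have r0 : 0 < r by rewrite -ltcR -lr normr_gt0.
move/cvgrPdist_lt: hl => /(_ (`|l| / 2)) [|M [_ hM]]; first by rewrite divr_gt0 ?normr_gt0.
(* The bounds come from r / 2 < |E| < 3 r / 2 with r = |l|. *)
exists (Num.truncn `|M|).+1, (4 / 9 * r ^- 2), (4 * r ^- 2); split.
  by rewrite mulr_gt0 ?invr_gt0 ?exprn_gt0 // divr_gt0.
move=> n nn; have Mn : M < n%:R.
  apply: le_lt_trans (ler_norm M) _; have /andP[_ h] := truncn_itv (normr_ge0 M).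
  by apply: lt_le_trans h _; rewrite ler_nat.
have := hM _ Mn; rewrite /= o0 expr0z mul1r; set e := euler_product _ _ _ => he.
have := euler_product_sqr_norm n cc; rewrite -/e; set Q := \prod_(p <- _) _ => eQ.
have [t et] : exists t, `|e| = t%:C by exists (complex.Re `|e|); rewrite RRe_real // normr_real.
have h2 : (2^-1)%:C = 2^-1 :> R[i] by rewrite fmorphV rmorph_nat.
rewrite lr -h2 -rmorphM /= in he.
have t1 : r - t < r / 2.
  rewrite -ltcR; apply: le_lt_trans he; rewrite rmorphB /= -lr -et.
  exact: lerB_dist.
have t2 : t - r < r / 2.
  rewrite -ltcR; apply: le_lt_trans he; rewrite rmorphB /= -lr -et distrC.
  exact: lerB_dist.
have {}eQ : t ^+ 2 = Q^-1.
  by apply: (fmorph_inj (real_complex R)); rewrite rmorphXn /= -et.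
have -> : Q = t ^- 2 by rewrite eQ invrK.
have t0 : 0 < t by lra.
have -> : 4 / 9 * r ^- 2 = (9 / 4 * r ^+ 2)^-1 by field; rewrite gt_eqF.
have -> : 4 * r ^- 2 = (4^-1 * r ^+ 2)^-1 by field; rewrite gt_eqF.
by rewrite !lef_pV2 ?posrE ?mulr_gt0 ?invr_gt0 ?exprn_gt0 //; apply/andP; split; nra.
Qed.

End EulerProducts.

(** * The Chebyshev bias *)

Section PrimeSums.
Variables (R : realType) (b : global_base) (K : fieldExtType (base_field b)).
Local Notation O := (integers K).
Local Notation N := (ideal_norm O).
Local Notation upto := (upto (prime_ideal O) N).
Hypothesis finS : forall n, finite_set [set p | prime_ideal O p /\ (N p <= n)%N].
Variables (A : set (set K)) (Q : pred (set K)).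
Hypothesis AQ : forall p, prime_ideal O p -> (A p <-> Q p).

Lemma fset_set_primes (x : R) : 0 <= x -> finite_set (A `&` primes_upto K x) /\
  forall f : set K -> R, \sum_(p <- fset_set (A `&` primes_upto K x)) f p =
    \sum_(p <- upto (Num.truncn x) | Q p) f p.
Proof.
move=> x0; have e : primes_upto K x = [set p | prime_ideal O p /\ (N p <= Num.truncn x)%N].
  by apply/seteqP; split=> p; rewrite /primes_upto /= truncn_ge_nat.
have fin : finite_set (A `&` primes_upto K x) by rewrite e; apply: finite_setIr.
split=> // f; rewrite -[RHS]big_filter; apply: perm_big; apply: uniq_perm.
- exact: fset_uniq.
- exact/filter_uniq/fset_uniq.
move=> p; rewrite in_fset_set // mem_filter; apply/idP/andP.
  rewrite inE e => -[Ap [pp pn]]; split; first exact/AQ.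
  exact/(in_upto finS).
by move=> [Qp /(in_upto finS)[pp pn]]; rewrite inE e; split=> //; apply/AQ.
Qed.

Lemma sum_inv_sqrtE (x : R) : 0 <= x ->
  sum_inv_sqrt A x = \sum_(p <- upto (Num.truncn x) | Q p) (Num.sqrt (N p)%:R)^-1.
Proof.
by move=> x0; have [fin <-] := fset_set_primes x0; rewrite /sum_inv_sqrt fsbig_finite.
Qed.

Lemma count_primesE (x : R) : 0 <= x ->
  count_primes A x = \sum_(p <- upto (Num.truncn x) | Q p) 1.
Proof.
move=> x0; have [fin <-] := fset_set_primes x0.
by rewrite /count_primes big_const_seq count_predT iter_addr_0.
Qed.

End PrimeSums.

Theorem corollary3p5 (R : realType) (b : global_base)
  (K : fieldExtType (base_field b)) (L : splittingFieldType K)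
  (artin : set K -> gal_of {:L})
  (hilbertL : hilbert_class_field L)
  (artin_iso : artin_isomorphism artin)
  (drh : forall chi, nontrivial_characters R L chi -> DRH_A L chi)
  (m0 : forall a, fractional (integers K) a -> m_sum R L (artin a) = 0)
  (even_cl : ~~ odd (class_number (integers K))) :
  chebyshev_bias R (nonprincipal_primes K) (principal_primes K).
Proof.
have [[artM art_prime] art_surj art_ker] := artin_iso.
have O1 := @integers1 R b K; have OB := @integersB R b K; have OM := @integersM R b K.
have comm := artin_group_commutative artM art_surj.
have inv := fractional_invertible O1 OB OM artM art_surj art_ker.
have even : ~~ odd #|{: gal_of {:L}}|.
  by rewrite -(class_number_card O1 OB OM artM art_surj art_ker).
have [finS N_gt1 [C mertens]] := global_mertens R inv.
(* Every element of the Galois group is the Artin symbol of a fractional ideal, so m vanishes on the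
   whole group and Fourier inversion applies. *)
have ord0 chi : nontrivial_characters R L chi -> ord_half chi = 0.
  move=> nt; apply/eqP; rewrite -(intr_eq0 R[i]); apply/eqP.
  apply: (character_coef_eq0 (m := fun psi => (ord_half psi)%:~R) (Y := nontrivial_characters R L)) => //.
    by move=> psi [].
  by move=> s; have [I fI <-] := art_surj s; exact: m0.
have euler (chi : gal_of {:L} -> R[i]) := @DRH_euler_bounded R b K L finS N_gt1 chi.
have {}euler chi (cc : character chi) (ct : exists s, chi s != 1) :=
  euler chi cc (ord0 chi (conj cc ct)) (drh chi (conj cc ct)).
(* The kernel of the Artin map turns principality of a prime into triviality of its Frobenius
   element. *)
have PQ p : prime_ideal (integers K) p -> principal_primes K p <-> frobenius L p == 1%g.
  move=> pp; rewrite -art_prime //.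
  have /ideal_fractional/art_ker e := ideal_prime pp.
  by split=> [[_ /e/eqP]|/eqP/e].
have nPQ p : prime_ideal (integers K) p -> nonprincipal_primes K p <-> frobenius L p != 1%g.
  move=> pp; split=> [[_ np]|/negP np]; first by apply/negP => /(PQ _ pp)[_ /np].
  by split=> // h; apply/np/PQ.
split.
- apply/seteqP; split=> p; first by case=> -[].
  by move=> pp; have [h|h] := pselect (principal (integers K) p); [right|left].
- by apply/seteqP; split=> p // [[_ h] [_ /h]].
(* One class out of |G| is principal, whence delta = |G| - 1. The same number is the value at the
   identity of the sum of the nontrivial characters, so the difference in the bias is minus the sum
   weighted by [unit_weight]. *)
exists (#|{: gal_of {:L}}|%:R - 1); split.
  apply: cvg_pinftyP => e e0.
  have [n0 hn] := class_counts_ratio finS N_gt1 mertens comm euler e0.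
  exists n0%:R => x xn; have x0 : 0 <= x by exact: le_trans xn.
  by rewrite (count_primesE finS PQ x0) (count_primesE finS nPQ x0) hn // truncn_ge_nat.
have [c c0 [D hD]] := class_sums_log finS N_gt1 mertens comm euler even.
exists c => //; apply: cvg_trans (ln_ln_asymptotic c0 hD).
apply: near_eq_cvg; near=> x; have x0 : 0 <= x by near: x; exact: nbhs_pinfty_ge.
by rewrite (sum_inv_sqrtE finS PQ x0) (sum_inv_sqrtE finS nPQ x0).
Unshelve. all: by end_near.
Qed.
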